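(* Let $m\ge4$. Let $V$ have a chi-square distribution with $\binom{m-2}{2}$ degrees of freedom and let $W$ be distributed like the smaller of the two eigenvalues of a $2\times2$-Wishart matrix with $m-2$ degrees of freedom and scale parameter the identity matrix $I$. If $\Sigma_0=(\sigma_{gh})\in F_{m,1}$ has exactly one nonzero off-diagonal entry $\sigma_{ij}$ with $i<j$, then the distribution of the squared Mahalanobis distance $$\min_{\Sigma\in A_{F_{m,1}}(\Sigma_0)}(Z-\Sigma)^tI(\Sigma_0)(Z-\Sigma),\qquad Z\sim\mathcal{N}_{\binom{m+1}{2}}(0,I(\Sigma_0)^{-1}),$$ is the distribution of $V+W$, where $V$ and $W$ are independent.
   Context: One-factor model: $F_{m,1}=\{\Delta+\Gamma\Gamma^t\mid\Delta\in\mathbb{R}^{m\times m}\text{ diagonal and positive definite},\ \Gamma\in\mathbb{R}^m\}$, a subset of the space $\mathbb{R}^{m\times m}_{\mathrm{sym}}$ of symmetric matrices, which is identified with $\mathbb{R}^{\binom{m+1}{2}}$ by indexing vectors by ordered pairs $ij$ with $i\le j$. Fisher-information: $I(\Sigma)$ denotes the Fisher-information matrix of the model $(\mathcal{N}_m(0,\Sigma)\mid\Sigma\text{ positive definite})$ at $\Sigma=(\sigma_{ij})$; its inverse $I(\Sigma)^{-1}$ is the $\binom{m+1}{2}\times\binom{m+1}{2}$ matrix with $(ij,k\ell)$-entry $\sigma_{ik}\sigma_{j\ell}+\sigma_{i\ell}\sigma_{jk}$. Algebraic tangent cone: for $\theta$ in a semi-algebraic set $\Theta\subseteq\mathbb{R}^k$,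 let $\mathcal{I}(\Theta)$ be the ideal of polynomials in $\mathbb{R}[t_1,\dots,t_k]$ vanishing on $\Theta$. For nonzero $f\in\mathcal{I}(\Theta)$ let $f_\theta$ be obtained from $f$ by substituting $t_i+\theta_i$ for $t_i$, and let $f_{\theta,\min}$ be the nonzero homogeneous component of $f_\theta$ of smallest degree. Then $A_\Theta(\theta)=\{\tau\in\mathbb{R}^k\mid f_{\theta,\min}(\tau)=0\ \forall f\in\mathcal{I}(\Theta)\}$. (For $\Sigma_0$ as in the claim, $A_{F_{m,1}}(\Sigma_0)$ is the set of $S\in\mathbb{R}^{m\times m}_{\mathrm{sym}}$ whose principal submatrix with rows and columns outside $\{i,j\}$ is diagonal and whose submatrix with rows $\{i,j\}$ and columns outside $\{i,j\}$ has rank at most one.) *)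

(* Defs.v *)
From HB Require Import structures.
From mathcomp Require Import all_boot all_order all_algebra.
From mathcomp Require Import all_classical all_reals all_analysis.
(* The notations of mpoly clash with those of analysis. *)
From mathcomp Require mpoly.
Import -(notations) mpoly.

Set Implicit Arguments.
Unset Strict Implicit.
Unset Printing Implicit Defensive.

Import Order.TTheory GRing.Theory Num.Theory.
Import numFieldNormedType.Exports.

Local Open Scope classical_set_scope.
Local Open Scope ring_scope.

Definition mevalv (R : realType) (k : nat) (f : mpoly k R)
    (x : 'cV[R]_k) : R :=
  meval (fun i => x i 0) f.

Definition vanishing_ideal (R : realType) (k : nat) (Theta : set 'cV[R]_k) :
    set (mpoly k R) :=
  [set f | forall x, Theta x -> mevalv f x = 0].

(* [f] with [t_i + theta_i] substituted for [t_i] *)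
Definition mshift (R : realType) (k : nat) (theta : 'cV[R]_k)
    (f : mpoly k R) : mpoly k R :=
  comp_mpoly
    [tuple mpolyX R (mnm1 i) + mpolyC k (theta i 0) | i < k]
    f.

(* [g] is the nonzero homogeneous component of [f] of smallest degree; every
   nonzero [f] has exactly one, and [0] has none. *)
Definition is_lowest_form (R : realType) (k : nat) (f g : mpoly k R) :
    Prop :=
  exists e : nat,
    [/\ g = pihomog (@mdeg k) e f, g != 0 &
        forall e', (e' < e)%N -> pihomog (@mdeg k) e' f = 0].

Definition algebraic_tangent_cone (R : realType) (k : nat)
    (Theta : set 'cV[R]_k) (theta : 'cV[R]_k) : set 'cV[R]_k :=
  [set tau | forall f g, f != 0 -> vanishing_ideal Theta f ->
     is_lowest_form (mshift theta f) g -> mevalv g tau = 0].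

Definition sympair (m : nat) : finType :=
  {p : 'I_m * 'I_m | (p.1 <= p.2)%N}.

Definition symdim (m : nat) : nat := #|{: sympair m}|.

Lemma symdimE (m : nat) : symdim m = 'C(m.+1, 2).
Proof.
rewrite /symdim card_sig -sum1_card.
rewrite (eq_bigl (fun p : 'I_m * 'I_m => true && (p.1 <= p.2)%N)) //.
rewrite -(pair_big_dep xpredT (fun i j : 'I_m => (i <= j)%N) (fun _ _ => 1%N)) /=.
rewrite (exchange_big_dep xpredT) //=.
have step (j : 'I_m) : (\sum_(i < m | (i <= j)%N) 1 = j.+1)%N.
  rewrite -(big_ord_widen_cond m (fun=> true) (fun=> 1%N) (ltn_ord j)).
  by rewrite sum1_card card_ord.
rewrite (eq_bigr _ (fun j _ => step j)) -bin2_sum big_mkord big_ord_recl add0n.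
by apply: eq_bigr => i _; rewrite lift0.
Qed.

Definition pair_of (m : nat) (a : 'I_(symdim m)) : 'I_m * 'I_m :=
  val (enum_val a).

Definition vech (R : realType) (m : nat) (S : 'M[R]_m) : 'cV[R]_(symdim m) :=
  \col_a S (pair_of a).1 (pair_of a).2.

Definition unvech (R : realType) (m : nat) (theta : 'cV[R]_(symdim m)) :
    'M[R]_m :=
  \matrix_(g, h)
    \sum_(a | (pair_of a == (g, h)) || (pair_of a == (h, g))) theta a 0.

Lemma vechK (R : realType) (m : nat) (S : 'M[R]_m) :
  S^T = S -> unvech (vech S) = S.
Proof.
move=> symS; apply/matrixP => g h; rewrite mxE.
have Sgh x y : S x y = S y x by rewrite -[in LHS]symS mxE.
wlog le_gh : g h / (g <= h)%N.
  move=> wl; case: (leqP g h) => [/wl //|/ltnW/wl]; rewrite Sgh => <-.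
  by apply: eq_bigl => a; rewrite orbC.
have pP : ((g, h).1 <= (g, h).2)%N by [].
rewrite (big_pred1 (enum_rank (exist _ (g, h) pP : sympair m))) => [|a].
  by rewrite mxE /pair_of enum_rankK.
apply/idP/eqP => [|->]; last by rewrite /pair_of enum_rankK eqxx.
move=> pa; apply: enum_val_inj; rewrite enum_rankK; apply: val_inj.
move: (valP (enum_val a)) pa; rewrite /pair_of.
move: (val (enum_val a)) => [x y] /= le_xy /orP[/eqP -> //|/eqP[ex ey]].
move: le_xy; rewrite ex ey => le_hg.
by have -> : g = h by apply/val_inj/eqP; rewrite eqn_leq le_gh.
Qed.

Definition one_factor (R : realType) (m : nat) : set 'M[R]_m :=
  [set S | exists (d : 'rV[R]_m) (g : 'cV[R]_m),
     (forall i, 0 < d 0 i) /\ S = diag_mx d + g *m g^T].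

(* Iterated Lebesgue integral over the coordinates; by Tonelli and Fubini this
   is the integral against Lebesgue measure on R^n for Borel functions that are
   nonnegative or integrable. *)
Fixpoint iint (R : realType) (n : nat) : ('cV[R]_n -> \bar R) -> \bar R :=
  match n with
  | 0 => fun f => f 0
  | n'.+1 => fun f =>
      (\int[lebesgue_measure]_(x in [set: R])
          iint (fun y : 'cV[R]_n' => f (col_mx x%:M y)))%E
  end.

Definition normal_density (R : realType) (n : nat) (C : 'M[R]_n)
    (x : 'cV[R]_n) : R :=
  (Num.sqrt ((2 * pi) ^+ n * \det C))^-1
  * expR (- (x^T *m invmx C *m x) 0 0 / 2).

Definition normal_law (R : realType) (n : nat) (C : 'M[R]_n)
    (B : set 'cV[R]_n) : \bar R :=
  iint (fun x => (\1_B x * normal_density C x)%:E).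

Definition borel (R : realType) (n : nat) : set (set 'cV[R]_n) :=
  <<s [set U | open U] >>.

Definition is_normal_vector (R : realType) (d : measure_display)
    (T : measurableType d) (P : probability T R) (n : nat) (Z : T -> 'cV[R]_n)
    (C : 'M[R]_n) : Prop :=
  forall B, borel B ->
    measurable (Z @^-1` B) /\ P (Z @^-1` B) = normal_law C B.

Definition score (R : realType) (k n : nat) (p : 'cV[R]_k -> 'cV[R]_n -> R)
    (theta : 'cV[R]_k) (a : 'I_k) (x : 'cV[R]_n) : R :=
  'D_(delta_mx a 0) (fun t => ln (p t x)) theta.

Definition fisher_information (R : realType) (k n : nat)
    (p : 'cV[R]_k -> 'cV[R]_n -> R) (theta : 'cV[R]_k) : 'M[R]_k :=
  \matrix_(a, b)
    fine (iint (fun x =>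
      (score p theta a x * score p theta b x * p theta x)%:E)).

Definition normal_fisher (R : realType) (m : nat) (S : 'M[R]_m) :
    'M[R]_(symdim m) :=
  fisher_information (fun theta => normal_density (unvech theta)) (vech S).

(* law of the sum of the squares of [k] independent standard normals *)
Definition has_chi_square_law (R : realType) (d : measure_display)
    (T : measurableType d) (P : probability T R) (k : nat) (V : {RV P >-> R}) :
    Prop :=
  forall B, measurable B ->
    distribution P V B =
    normal_law (1%:M : 'M[R]_k) [set x | B (\sum_i x i 0 ^+ 2)].

(* law of [G *m G^T] where [G] is [p] by [n] with independent standard normal
   entries *)
Definition wishart_law (R : realType) (p n : nat) (B : set 'M[R]_p) : \bar R :=
  normal_law (1%:M : 'M[R]_(p * n))
    [set x | let G : 'M[R]_(p, n) := vec_mx x^T in B (G *m G^T)].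

(* a minimum whenever the set of eigenvalues is nonempty, e.g. for real
   symmetric matrices of positive size *)
Definition min_eigenvalue (R : realType) (p : nat) (A : 'M[R]_p) : R :=
  inf [set a | eigenvalue A a].

Definition has_min_wishart_law (R : realType) (d : measure_display)
    (T : measurableType d) (P : probability T R) (p n : nat)
    (W : {RV P >-> R}) : Prop :=
  forall B, measurable B ->
    distribution P W B = wishart_law n (@min_eigenvalue R p @^-1` B).

Definition independent_RV (R : realType) (d : measure_display)
    (T : measurableType d) (P : probability T R) (V W : {RV P >-> R}) : Prop :=
  forall A B : set R, measurable A -> measurable B ->
    P (V @^-1` A `&` W @^-1` B) = (P (V @^-1` A) * P (W @^-1` B))%E.

Definition sq_mahalanobis (R : realType) (k : nat) (J : 'M[R]_k)
    (z s : 'cV[R]_k) : R :=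
  ((z - s)^T *m J *m (z - s)) 0 0.

Definition is_minimum (R : realType) (E : set R) (x : R) : Prop :=
  E x /\ lbound E x.

(* Main.v *)
(* Let [A] be the inverse Cholesky factor of [S0]; it is supported on the diagonal and the entry
   [(i, j)]. The Fisher information is [K^T *m K], where [K] maps [z] to the entries of
   [A *m unvech z *m A^T], those on the diagonal divided by sqrt 2: the score is a quadratic form
   in [A *m x], and the second moments of such forms are given by Isserlis' theorem. Hence
   [xi = K *m Z] is standard normal and the Mahalanobis distance is Euclidean in [xi].

   The tangent cone is the set of [S] with [S g h = 0] for [g != h] outside [{i, j}] and vanishing
   2 x 2 minors in the block of the rows [i], [j] and the remaining columns. These equations are
   the lowest forms of tetrads; conversely, generic such [S] are velocities of parabolas
   [S0 + t S + t^2 q] in the Zariski closure of the model, along which every [f] in the vanishing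
   ideal is zero.

   The cone is invariant under [S |-> A S A^T]. The squared distance is therefore the sum of the
   [xi g h ^+ 2] over [g < h] outside [{i, j}] plus the squared distance of the 2 x (m - 2) block
   [Y] of [xi] to the matrices of rank at most one, which is the smallest eigenvalue of [Y Y^T].
   The two terms involve disjoint coordinates of [xi] and are hence independent. *)
Require Import Defs.
From HB Require Import structures.
From mathcomp Require Import all_boot all_order all_algebra perm.
From mathcomp Require Import all_classical all_reals all_analysis.
From mathcomp Require Import ring lra zify.
From mathcomp Require Import measurable_realfun.
From mathcomp Require mpoly.

Set Implicit Arguments.
Unset Strict Implicit.
Unset Printing Implicit Defensive.

Import Order.TTheory GRing.Theory Num.Theory.
Import numFieldNormedType.Exports.

Local Open Scope classical_set_scope.
Local Open Scope ring_scope.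

(** Expectations are iterated one-dimensional integrals, and for a signed integrand an inner
    integral may be a default value. Hence a measure [leb] is built along the same recursion: the
    two integrals agree for nonnegative functions by Tonelli, and for the products of scores because
    these are dominated by a Gaussian. A polynomial in the vanishing ideal is known to vanish only
    for positive noise variances and a positive coefficient of the rank-one term. The parabolas
    leave this region: their coefficient may be negative and their diagonal part has arbitrary sign.
    The bridge is that a polynomial vanishing on a ray vanishes on the whole line. The same fact
    removes the genericity of [S]: the loadings of [i] and [j] must both be nonzero, as their
    product has to produce [S0 i j], and a shift along a line inside the cone achieves this when a
    row of the block vanishes. The law of V + W is never computed. The distance and V + W are both
    sums of two independent variables with the same marginals, hence images of one product
    measure. *)

Notation mvec R n := (g_sigma_algebraType [set U : set 'cV[R]_n | open U]).

(** * Borel sets of column vectors *)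

Section VectorMeasurability.
Context {R : realType}.

Definition box n (A : 'I_n -> set R) : set 'cV[R]_n :=
  [set x | forall k, A k (x k 0)].

(** The corners are stored in a finite function, so that the boxes are indexed by a countable
    type. *)
Definition rat_box n (q : {ffun 'I_n -> rat * rat}) : set 'cV[R]_n :=
  box (fun k => `]ratr (q k).1, ratr (q k).2[%classic).

Lemma open_bigcup_rat_box n (U : set 'cV[R]_n) : open U ->
  U = \bigcup_(q in [set q | rat_box q `<=` U]) rat_box q.
Proof.
move=> oU; rewrite predeqE => x; split=> [Ux|[q qU /qU//]].
have [P Px PU] : nbhs x U by exact: open_nbhs_nbhs.
have /choice [q qP] (k : 'I_n) : exists q : rat * rat,
    (`]ratr q.1, ratr q.2[%classic : set R) (x k 0) /\
    (`]ratr q.1, ratr q.2[%classic : set R) `<=` P k 0.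
  have /nbhs_ballP [e /= e0 Pe] := Px k 0.
  have [|q1] := @rat_in_itvoo R (x k 0 - e) (x k 0); first lra.
  rewrite in_itv/= => /andP[q1l q1r].
  have [|q2] := @rat_in_itvoo R (x k 0) (x k 0 + e); first lra.
  rewrite in_itv/= => /andP[q2l q2r].
  exists (q1, q2) => /=; split; first by rewrite in_itv/= q1r.
  move=> y; rewrite /= in_itv/= => /andP[qy yq]; apply: Pe.
  rewrite /ball/= ltr_norml; apply/andP; split; lra.
exists [ffun k => q k] => /=.
  by move=> y yq; apply: PU => k l; rewrite ord1; have := yq k; rewrite ffunE; apply: (qP k).2.
by move=> k; rewrite ffunE; exact: (qP k).1.
Qed.

Lemma measurable_coord n (k : 'I_n) :
  measurable_fun setT (fun x : mvec R n => x k 0).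
Proof.
apply: (measurability _ (measurable_realfun.RGenOpens.measurableE R)).
move=> _ [_ [a [b ->] <-]]; rewrite setTI; apply: sub_sigma_algebra.
apply: open_comp; last exact: interval_open.
by move=> x _; exact: coord_continuous.
Qed.

Lemma measurable_to_mvec d (T : measurableType d) n (h : T -> mvec R n) :
  (forall k, measurable_fun setT (fun t => h t k 0)) -> measurable_fun setT h.
Proof.
move=> mh; apply: (@measurability _ _ _ (mvec R n) _ _ [set U : set 'cV[R]_n | open U]) => //.
move=> _ [U oU <-]; rewrite setTI (open_bigcup_rat_box oU) preimage_bigcup.
rewrite bigcup_mkcond; apply: countable_bigcupT_measurable; first exact: countableP.
move=> q; case: ifP => // _.
have -> : h @^-1` rat_box q =
    \bigcap_(k in [set: 'I_n]) ((fun t => h t k 0) @^-1` `]ratr (q k).1, ratr (q k).2[%classic).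
  by rewrite predeqE => t; split=> [H k _|H k]; exact: H.
apply: fin_bigcap_measurable; first exact: finite_finset.
by move=> k _; rewrite -[X in measurable X]setTI; exact: mh.
Qed.

Lemma measurable_box n (A : 'I_n -> set R) :
  (forall k, measurable (A k)) -> measurable (box A : set (mvec R n)).
Proof.
move=> mA; have -> : box A = \bigcap_(k in [set: 'I_n]) ((fun x : mvec R n => x k 0) @^-1` A k).
  by rewrite predeqE => t; split=> [H k _|H k]; exact: H.
apply: fin_bigcap_measurable; first exact: finite_finset.
by move=> k _; rewrite -[X in measurable X]setTI; exact: measurable_coord.
Qed.

Definition boxes n : set (set (mvec R n)) :=
  [set B | exists2 A : 'I_n -> set R, (forall k, measurable (A k)) & B = box A].

Lemma measurable_mvecE n : @measurable _ (mvec R n) = <<s @boxes n >>.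
Proof.
rewrite eqEsubset; split.
  apply: smallest_sub; first exact: smallest_sigma_algebra.
  move=> U oU; rewrite (open_bigcup_rat_box oU) bigcup_mkcond.
  apply: (@countable_bigcupT_measurable _ (g_sigma_algebraType (@boxes n))).
    exact: countableP.
  move=> q; case: ifP => // _; apply: sub_sigma_algebra.
  by eexists; last reflexivity; move=> k; exact: measurable_itv.
apply: smallest_sub; first exact: sigma_algebra_measurable.
by move=> _ [A mA ->]; exact: measurable_box.
Qed.

(** Uniqueness of measures: the boxes are stable under intersection and generate the Borel sets, and
    the cubes with sides [-k, k] exhaust the space with finite measure. *)
Lemma measurable_mvec_eq n (m1 m2 : {measure set (mvec R n) -> \bar R}) :
  (forall A : 'I_n -> set R, (forall k, measurable (A k)) -> m1 (box A) = m2 (box A)) ->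
  (forall r : R, (m1 (box (fun=> `[(- r)%R, r]%classic : set R)) < +oo)%E) ->
  forall B, measurable B -> m1 B = m2 B.
Proof.
move=> m12 m1fin.
apply: (measure_unique (@boxes n) (fun k => box (fun=> `[- (k%:R), k%:R]%classic))).
- exact: measurable_mvecE.
- move=> _ _ [A mA ->] [B mB ->]; exists (fun k => A k `&` B k).
    by move=> k; exact: measurableI.
  by rewrite predeqE => x; split=> [[a b] k|H]; split=> // k; case: (H k).
- by move=> k; eexists; last reflexivity; move=> i; exact: measurable_itv.
- rewrite -subTset => x _.
  exists (Num.bound (\sum_k `|x k 0|)) => // k /=.
  rewrite in_itv/= -ler_norml ltW//; apply: le_lt_trans (archi_boundP _); last exact: sumr_ge0.
  by rewrite (bigD1 k)//= lerDl sumr_ge0.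
- by move=> _ [A mA ->]; exact: m12.
- by move=> k; exact: m1fin.
Qed.

Lemma col_mx_ord0 n (x : R) (y : 'cV[R]_n) :
  (col_mx x%:M y : 'cV[R]_n.+1) ord0 0 = x.
Proof.
rewrite (_ : ord0 = lshift n (0 : 'I_1)); last exact: val_inj.
by rewrite (@col_mxEu _ 1 n) mxE eqxx mulr1n.
Qed.

Lemma col_mx_lift n (x : R) (y : 'cV[R]_n) (k : 'I_n) :
  (col_mx x%:M y : 'cV[R]_n.+1) (lift ord0 k) 0 = y k 0.
Proof.
rewrite (_ : lift ord0 k = rshift 1 k); last exact: val_inj.
by rewrite (@col_mxEd _ 1 n).
Qed.

Lemma measurable_col_mx n :
  measurable_fun setT (fun xy : R * mvec R n => col_mx xy.1%:M xy.2 : mvec R n.+1).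
Proof.
apply: measurable_to_mvec => k; have [j ->|->] := unliftP ord0 k.
  rewrite (_ : (fun _ => _) = (fun y : mvec R n => y j 0) \o snd).
    by apply: (measurableT_comp (measurable_coord j)); exact: measurable_snd.
  by apply: funext => xy /=; rewrite col_mx_lift.
rewrite (_ : (fun _ => _) = fst); first exact: measurable_fst.
by apply: funext => xy /=; rewrite col_mx_ord0.
Qed.

Lemma measurable_col_mx_cons n (x : R) :
  measurable_fun setT (fun y : mvec R n => col_mx x%:M y : mvec R n.+1).
Proof.
apply: (measurableT_comp (@measurable_col_mx n) (g := fun y : mvec R n => (x, y))).
by apply: measurable_fun_pair; [exact: measurable_cst|exact: measurable_id].
Qed.

Lemma measurable_mulmx n p (A : 'M[R]_(p, n)) :
  measurable_fun setT (fun x : mvec R n => A *m x : mvec R p).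
Proof.
apply: measurable_to_mvec => k.
rewrite (_ : (fun _ => _) = (fun x : mvec R n => \sum_l A k l * x l 0)); last first.
  by apply: funext => x; rewrite mxE.
apply: measurable_sum => l; apply: measurable_funM => //.
exact: measurable_coord.
Qed.

Lemma measurable_mulmxD n p (A : 'M[R]_(p, n)) (b : 'cV[R]_p) :
  measurable_fun setT (fun x : mvec R n => A *m x + b : mvec R p).
Proof.
apply: measurable_to_mvec => k.
rewrite (_ : (fun _ => _) = (fun x : mvec R n => (A *m x) k 0 + b k 0)); last first.
  by apply: funext => x; rewrite mxE.
apply: measurable_funD => //; apply: (measurableT_comp (measurable_coord k)).
exact: measurable_mulmx.
Qed.

End VectorMeasurability.

(** * Lebesgue measure on column vectors and iterated integrals *)

Definition pushforward_measure d d' (T1 : measurableType d) (T2 : measurableType d')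
    (R : realFieldType) (m : {measure set T1 -> \bar R}) (f : T1 -> T2)
    (mf : measurable_fun setT f) : {measure set T2 -> \bar R} :=
  measure_function_pushforward__canonical__measure_function_Measure m mf.

(** The recursion that defines [leb] has to return sigma-finiteness together with the measure, since
    the next product measure asks for it. *)
Definition sigma_finite_pack d (T : measurableType d) (R : realType)
    (m : {measure set T -> \bar R}) (sf : sigma_finite setT m) :
    {sigma_finite_measure set T -> \bar R} :=
  HB.pack (Measure.sort m)
    (isSFinite.Build _ _ _ (Measure.sort m) (sfinite_measure_sigma_finite sf))
    (isSigmaFinite.Build _ _ _ (Measure.sort m) sf).

Section VectorLebesgue.
Context {R : realType}.
Local Notation lambda := (@lebesgue_measure R).

Definition cons_vec n (xy : measurableTypeR R * mvec R n) : mvec R n.+1 := col_mx xy.1%:M xy.2.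

Lemma measurable_cons_vec n : measurable_fun setT (@cons_vec n).
Proof. exact: measurable_col_mx. Qed.

Definition uncons_vec n (z : mvec R n.+1) : measurableTypeR R * mvec R n :=
  (z ord0 0, \col_k z (lift ord0 k) 0).

Lemma cons_vecK n : cancel (@cons_vec n) (@uncons_vec n).
Proof.
move=> [x y]; rewrite /cons_vec /uncons_vec /= col_mx_ord0; congr pair.
by apply/colP => k; rewrite mxE col_mx_lift.
Qed.

Lemma measurable_uncons_vec n : measurable_fun setT (@uncons_vec n).
Proof.
apply: measurable_fun_pair; first exact: measurable_coord.
apply: measurable_to_mvec => k.
rewrite (_ : (fun _ => _) = (fun z : mvec R n.+1 => z (lift ord0 k) 0)).
  exact: measurable_coord.
by apply: funext => z; rewrite mxE.
Qed.

Definition leb_cons_measure n (mu : {sigma_finite_measure set (mvec R n) -> \bar R}) :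
    {measure set (mvec R n.+1) -> \bar R} :=
  pushforward_measure (lambda \x mu)%E (@measurable_cons_vec n).

(** Exhausting sets of the two factors are pulled back along [uncons_vec]; as this is a left inverse
    of [cons_vec], their measure is that of a product set. *)
Lemma leb_cons_sigma_finite n (mu : {sigma_finite_measure set (mvec R n) -> \bar R}) :
  sigma_finite setT (leb_cons_measure mu).
Proof.
have /sigma_finiteP[F [TF ndF Foo]] := sigma_finiteT lambda.
have /sigma_finiteP[G [TG ndG Goo]] := sigma_finiteT mu.
exists (fun k => @uncons_vec n @^-1` (F k `*` G k)).
  apply/esym; rewrite -subTset => z _.
  have [k _ Fk] : (\bigcup_k F k) (uncons_vec z).1 by rewrite -TF.
  have [l _ Gl] : (\bigcup_k G k) (uncons_vec z).2 by rewrite -TG.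
  exists (maxn k l) => //; split.
  - by move: (uncons_vec z).1 Fk; apply/subsetPset; exact: (ndF _ _ (leq_maxl _ _)).
  - by move: (uncons_vec z).2 Gl; apply/subsetPset; exact: (ndG _ _ (leq_maxr _ _)).
move=> k; have [mF Fk] := Foo k; have [mG Gk] := Goo k; split.
  rewrite -[X in measurable X]setTI; apply: measurable_uncons_vec => //.
  exact: measurableX.
rewrite /leb_cons_measure /= /pushforward -/(@cons_vec n) -comp_preimage.
rewrite (_ : _ \o _ = id) ?preimage_id; last first.
  by apply: funext => z /=; rewrite cons_vecK.
by rewrite product_measure1E// lte_mul_pinfty// ge0_fin_numE.
Qed.

Definition leb_cons n (mu : {sigma_finite_measure set (mvec R n) -> \bar R}) :
    {sigma_finite_measure set (mvec R n.+1) -> \bar R} :=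
  sigma_finite_pack (leb_cons_sigma_finite mu).

(** The recursion mirrors that of [iint], so that comparing the two integrals is one application of
    Tonelli or Fubini per coordinate. *)
Fixpoint leb n : {sigma_finite_measure set (mvec R n) -> \bar R} :=
  match n with
  | 0 => \d_(0 : mvec R 0)
  | n'.+1 => leb_cons (leb n')
  end.

Lemma ge0_integral_leb_cons n (f : mvec R n.+1 -> \bar R) :
  measurable_fun setT f -> (forall x, 0 <= f x)%E ->
  (\int[leb n.+1]_x f x = \int[lambda \x leb n]_z (f \o @cons_vec n) z)%E.
Proof.
move=> mf f0.
apply: (ge0_integral_pushforward (@measurable_cons_vec n) (lambda \x leb n)%E measurableT mf).
by move=> x _; exact: f0.
Qed.

Lemma ge0_integral_lebS n (f : mvec R n.+1 -> \bar R) :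
  measurable_fun setT f -> (forall x, 0 <= f x)%E ->
  (\int[leb n.+1]_x f x = \int[lambda]_x \int[leb n]_y f (cons_vec (x, y)))%E.
Proof.
move=> mf f0; rewrite ge0_integral_leb_cons//.
apply: (@fubini_tonelli1 _ _ _ _ _ lambda (leb n) (f \o @cons_vec n)).
  exact: measurableT_comp (@measurable_cons_vec n).
by move=> z; exact: f0.
Qed.

Lemma iintE n (f : mvec R n -> \bar R) :
  measurable_fun setT f -> (forall x, 0 <= f x)%E ->
  iint f = (\int[leb n]_x f x)%E.
Proof.
elim: n f => [|n IH] f mf f0.
  by rewrite /= integral_dirac// diracT mul1e.
rewrite ge0_integral_lebS//; apply: eq_integral => x _ /=; rewrite -IH//.
apply: measurableT_comp => //; exact: measurable_col_mx_cons.
Qed.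

Lemma leb_box n (A : 'I_n -> set R) : (forall k, measurable (A k)) ->
  leb n (box A) = (\prod_k lambda (A k))%E.
Proof.
elim: n A => [|n IH] A mA.
  rewrite big_ord0 /= (_ : box A = setT) ?diracT//.
  by rewrite -subTset => x _ [].
rewrite big_ord_recl /= /leb_cons /pushforward.
rewrite (_ : _ @^-1` _ = A ord0 `*` (box (fun k => A (lift ord0 k)))).
  rewrite product_measure1E//; [|exact: mA|exact: measurable_box (fun k => mA (lift ord0 k))].
  by rewrite IH.
rewrite predeqE => -[x y]; split=> [H|[/= A0 A1] k].
  split; first by have := H ord0; rewrite /cons_vec col_mx_ord0.
  by move=> k; have := H (lift ord0 k); rewrite /cons_vec col_mx_lift.
rewrite /cons_vec; have [j ->|->] := unliftP ord0 k; last by rewrite col_mx_ord0.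
by rewrite col_mx_lift; exact: A1.
Qed.

Lemma leb_box_lty n (r : R) : (leb n (box (fun=> `[(- r)%R, r]%classic : set R)) < +oo)%E.
Proof.
rewrite leb_box => [|k]; last exact: measurable_itv.
have fin : (\prod_(k < n) lambda `[(- r)%R, r]%classic)%E \is a fin_num.
  by apply: prode_fin_num => k _; rewrite lebesgue_measure_itv/=; case: ifP.
by rewrite -ge0_fin_numE//; apply: prode_ge0 => k _.
Qed.

Lemma leb_eq n (m : {measure set (mvec R n) -> \bar R}) :
  (forall A : 'I_n -> set R, (forall k, measurable (A k)) ->
     m (box A) = (\prod_k lambda (A k))%E) ->
  forall B, measurable B -> m B = leb n B.
Proof.
move=> mE; apply: measurable_mvec_eq => [A mA|r].
  by rewrite mE//; apply/esym; exact: leb_box.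
rewrite (mE (fun=> _)) => [|k]; last exact: measurable_itv.
by rewrite -leb_box => [|k]; [exact: leb_box_lty|exact: measurable_itv].
Qed.

(** The constant [c] is general because the induction moves the factor of the first coordinate into
    it. The factors may change sign: linearity of one-dimensional integrals of integrable functions
    carries each step. *)
Lemma iint_prod n (g : 'I_n -> R -> R) (c : R) :
  (forall k, lambda.-integrable setT (EFin \o g k)) ->
  iint (fun x : 'cV[R]_n => (c * \prod_k g k (x k 0))%:E) =
  (c%:E * \prod_k \int[lambda]_x (g k x)%:E)%E.
Proof.
elim: n g c => [|n IH] g c ig; first by rewrite /= !big_ord0 mule1 mulr1.
have fin : (\prod_k \int[lambda]_x (g (lift ord0 k) x)%:E)%E \is a fin_num.
  by apply: prode_fin_num => k _; exact: (integrable_fin_num measurableT (ig _)).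
rewrite big_ord_recl /= -(fineK fin) muleCA -EFinM muleC.
rewrite -integralZl//; [|exact: ig]; apply: eq_integral => x _.
under [X in iint X]eq_fun => y.
  rewrite big_ord_recl col_mx_ord0 mulrA.
  under eq_bigr do rewrite col_mx_lift.
  over.
apply: (etrans (IH (fun i => g (lift ord0 i)) _ (fun i => ig _))).
by rewrite -{1}(fineK fin) -!EFinM; congr EFin; rewrite mulrAC.
Qed.

Lemma integrable_gauss_scaled (e : R) : 0 < e ->
  lambda.-integrable setT (EFin \o (fun x => expR (- e * x ^+ 2))).
Proof.
move=> e0; have s0 : (Num.sqrt (2 * e))^-1 != 0.
  by rewrite invr_eq0 lt0r_neq0// sqrtr_gt0; lra.
(* The standard deviation for which x^2 / (2 s^2) equals e x^2. *)
set s : R := (Num.sqrt (2 * e))^-1 in s0 *; pose p : R := (normal_peak s)^-1.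
have := integrableZl measurableT p (integrable_normal_pdf 0 s).
apply: eq_integrable => // x _.
rewrite /= normal_pdfE// -EFinM mulrA mulVf ?gt_eqF ?normal_peak_gt0// mul1r.
rewrite /normal_fun subr0 exprVn sqr_sqrtr; last lra.
by congr (_%:E); congr expR; field; lra.
Qed.

Lemma measurable_prod_coord n (g : 'I_n -> R -> R) :
  (forall k, measurable_fun setT (g k)) ->
  measurable_fun setT (fun x : mvec R n => \prod_k g k (x k 0)).
Proof.
move=> mg; apply: measurable_prod => k _.
by apply: (measurableT_comp (mg k)); exact: measurable_coord.
Qed.

(** The envelope is a product over the coordinates, so a section of a dominated function is
    dominated at the same rate [e], with the factor of the fixed coordinate absorbed into [c]. *)
Definition dominated n (f : mvec R n -> R) (e c : R) :=
  forall x, `|f x| <= c * \prod_k expR (- e * x k 0 ^+ 2).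

Lemma dominated_integrable n (f : mvec R n -> R) (e c : R) : 0 < e ->
  measurable_fun setT f -> dominated f e c -> (leb n).-integrable setT (EFin \o f).
Proof.
move=> e0 mf fe; have c0 : 0 <= c.
  have := le_trans (normr_ge0 _) (fe 0); rewrite pmulr_lge0//.
  by apply: prodr_gt0 => k _; exact: expR_gt0.
apply: (le_integrable measurableT
  (g := fun x : mvec R n => (c * \prod_k expR (- e * x k 0 ^+ 2))%:E)).
- exact/measurable_EFinP.
- move=> x _; rewrite /= lee_fin; apply: le_trans (fe x) _; exact: ler_norm.
have mg : measurable_fun setT (fun x : mvec R n => c * \prod_k expR (- e * x k 0 ^+ 2)).
  apply: measurable_funM => //; apply: (measurable_prod_coord (g := fun _ y => expR (- e * y ^+ 2))) => k.
  by apply: measurableT_comp => //; apply: measurable_funM.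
have g0 (x : mvec R n) : 0 <= c * \prod_k expR (- e * x k 0 ^+ 2).
  by rewrite mulr_ge0// prodr_ge0// => k _; exact: expR_ge0.
apply/integrableP; split; first exact/measurable_EFinP.
under eq_integral => x _ do rewrite gee0_abs ?lee_fin//.
rewrite -iintE; [|exact/measurable_EFinP|by move=> x; rewrite lee_fin].
rewrite (@iint_prod n (fun _ y => expR (- e * y ^+ 2)) c) => [|k]; last first.
  exact: integrable_gauss_scaled.
rewrite -ge0_fin_numE.
  rewrite fin_numM// prode_fin_num// => k _.
  exact: (integrable_fin_num measurableT (integrable_gauss_scaled e0)).
rewrite mule_ge0// prode_ge0// => k _; apply: integral_ge0 => x _.
by rewrite lee_fin expR_ge0.
Qed.

(* The domination makes every section of [f] integrable, so that the iterated
   integral of the signed function [f] involves no junk value. *)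
Lemma iint_dominated n (f : mvec R n -> R) (e c : R) : 0 < e ->
  measurable_fun setT f -> dominated f e c ->
  iint (EFin \o f) = (\int[leb n]_x (f x)%:E)%E.
Proof.
move=> e0; elim: n f c => [|n IH] f c mf fe.
  by rewrite /= integral_dirac ?diracT ?mul1e//; exact/measurable_EFinP.
have intf := dominated_integrable e0 mf fe.
have mEf : measurable_fun setT (EFin \o f) by exact/measurable_EFinP.
have intfc : (lambda \x leb n)%E.-integrable setT (EFin \o f \o @cons_vec n).
  apply/integrableP; split; first exact: measurableT_comp (@measurable_cons_vec n).
  have /integrableP[_] := intf; rewrite (@ge0_integral_leb_cons n (fun x => `|(f x)%:E|)%E)//.
  exact: measurableT_comp.
transitivity (\int[lambda \x leb n]_z (EFin \o f \o @cons_vec n) z)%E; last first.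
  apply/esym.
  exact: (integral_pushforward (@measurable_cons_vec n) (mu := (lambda \x leb n)%E) mEf intfc measurableT).
rewrite -(@integral12_prod_meas1 _ _ _ _ _ lambda (leb n) _ intfc).
apply: eq_integral => x _ /=.
apply: (IH (fun y => f (cons_vec (x, y))) (c * expR (- e * x ^+ 2))).
  exact: measurableT_comp mf (@measurable_col_mx_cons R n x).
move=> y; apply: le_trans (fe _) _; rewrite big_ord_recl mulrA {1}/cons_vec col_mx_ord0.
rewrite (eq_bigr (fun i => expR (- e * y i 0 ^+ 2))) // => i _.
by rewrite /cons_vec /= col_mx_lift.
Qed.

End VectorLebesgue.

(** * Linear changes of variables *)

Section LinearChange.
Context {R : realType}.
Local Notation lambda := (@lebesgue_measure R).

Lemma measurable_affine (a b : R) :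
  measurable_fun [set: measurableTypeR R] (fun x : measurableTypeR R => a * x + b : measurableTypeR R).
Proof.
apply: measurable_funD => //; apply: measurable_funM => //.
Qed.

(** Both sides are measures in [B], so half-open intervals suffice; a negative [a] exchanges the
    closed and the open end. *)
Lemma lebesgue_measure_affine (a b : R) (B : set R) : a != 0 -> measurable B ->
  (`|a|%:E * lambda ((fun x => a * x + b)%R @^-1` B) = lambda B)%E.
Proof.
move=> a0 mB; pose k : {nonneg R} := NngNum (normr_ge0 a).
pose m := mscale k (pushforward_measure lambda (measurable_affine a b)).
rewrite [RHS](@lebesgue_measure_unique R m)// => _ [[u v] _ <-] /=.
rewrite /m /mscale /= /pushforward.
have [agt|alt|/eqP] := ltgtP 0 a; last by rewrite eq_sym (negbTE a0).
  have -> : (fun x => a * x + b) @^-1` `]u, v]%classic = `](u - b) / a, (v - b) / a]%classic.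
    rewrite predeqE => x /=; rewrite !in_itv/= ltr_pdivrMr// ler_pdivlMr//.
    by rewrite ltrBlDr lerBrDr (mulrC x).
  rewrite !lebesgue_measure_itv/= !lte_fin ltr_pM2r ?invr_gt0// ltrD2r.
  case: ifPn => _; last by rewrite mule0.
  by rewrite -!EFinB -EFinM gtr0_norm//; congr EFin; field; rewrite gt_eqF.
have -> : (fun x => a * x + b) @^-1` `]u, v]%classic = `[(v - b) / a, (u - b) / a[%classic.
  rewrite predeqE => x /=; rewrite !in_itv/= ler_ndivrMr// ltr_ndivlMr//.
  by rewrite andbC lerBrDr ltrBlDr (mulrC x).
rewrite !lebesgue_measure_itv/= !lte_fin ltr_nM2r ?invr_lt0// ltrD2r.
case: ifPn => _; last by rewrite mule0.
by rewrite -!EFinB -EFinM ltr0_norm//; congr EFin; field; rewrite lt_eqF.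
Qed.

Lemma ge0_integral_affine (a b : R) (f : R -> \bar R) : a != 0 ->
  measurable_fun setT f -> (forall x, 0 <= f x)%E ->
  (`|a|%:E * \int[lambda]_x f (a * x + b)%R = \int[lambda]_x f x)%E.
Proof.
move=> a0 mf f0; pose k : {nonneg R} := NngNum (normr_ge0 a).
pose m := mscale k (pushforward_measure lambda (measurable_affine a b)).
transitivity (\int[m]_x f x)%E; last first.
  apply: eq_measure_integral => B mB _; rewrite /m /mscale /= /pushforward.
  exact: lebesgue_measure_affine.
rewrite ge0_integral_mscale//; congr (_ * _)%E.
by rewrite (ge0_integral_pushforward (measurable_affine a b)).
Qed.

Let change_vars n (L : 'M[R]_n) := forall (b : 'cV[R]_n) (f : mvec R n -> \bar R),
  L \in unitmx -> measurable_fun setT f -> (forall x, 0 <= f x)%E ->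
  (`|\det L|%:E * \int[leb n]_x f (L *m x + b)%R = \int[leb n]_x f x)%E.

(** Induction on the size. The translation [b] is general because the first coordinate enters the
    remaining ones through the shift [c *m x%:M]. *)
Lemma ge0_integral_trig_mulmxD n (L : 'M[R]_n) : is_trig_mx L -> change_vars L.
Proof.
apply: (@trigsqmx_ind R change_vars) => [|{}n a c {}L Ltrig IH] b f uL mf f0.
  rewrite det_mx00 normr1 mul1e; apply: eq_integral => x _; congr f.
  by apply/colP => -[].
move: uL; rewrite unitmxE (@det_lblock _ 1 n) det_mx11 unitrM => /andP[ua uL].
have {}uL : L \in unitmx by rewrite unitmxE.
have {}ua : a 0 0 != 0 by rewrite -unitfE.
set M := block_mx _ _ _ _; rewrite -[b](@vsubmxK _ 1 n).
set b0 := usubmx b; set b1 := dsubmx b.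
have ME x y : M *m cons_vec (x, y) + col_mx b0 b1 =
    cons_vec (a 0 0 * x + b0 0 0, L *m y + (c *m x%:M + b1)) :> 'cV_n.+1.
  rewrite /M /cons_vec /= (@mul_block_col _ 1 n 1 n) (@add_col_mx _ 1 n).
  congr (@col_mx _ 1 n); last by rewrite addrCA addrA.
  apply/matrixP => i j; rewrite !ord1 mul0mx !mxE big_ord1 !mxE eqxx !mulr1n.
  by rewrite addr0.
rewrite ge0_integral_lebS; [|exact: measurableT_comp mf (measurable_mulmxD _ _)|by []].
rewrite [RHS]ge0_integral_lebS//.
pose G x := (\int[leb n]_y f (cons_vec (x, y)))%E.
have G0 x : (0 <= G x)%E by apply: integral_ge0.
have mG : measurable_fun setT G.
  apply: (@measurable_fun_fubini_tonelli_F _ _ (measurableTypeR R) (mvec R n) R (leb n)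
      (f \o @cons_vec R n)); last by move=> z; exact: f0.
  exact: measurableT_comp mf (@measurable_cons_vec R n).
have dL0 : \det L != 0 by rewrite -unitfE -unitmxE.
rewrite (eq_integral (fun x : measurableTypeR R =>
  (`|\det L|^-1)%:E * G (a 0 0 * x + b0 0 0)%R)%E); last first.
  move=> x _; rewrite /G.
  rewrite -(IH (c *m x%:M + b1) (fun y => f (cons_vec (a 0 0 * x + b0 0 0, y))))//.
    rewrite muleA -EFinM mulVf ?normr_eq0// mul1e.
    by apply: eq_integral => y _; rewrite ME.
  exact: measurableT_comp mf (measurable_col_mx_cons _).
rewrite ge0_integralZl//; last exact: measurableT_comp mG (measurable_affine _ _).
by rewrite muleA -EFinM normrM mulfK ?normr_eq0// ge0_integral_affine.
Qed.

(** On sets the scaling rule is visibly multiplicative in the matrix, so it can be checked on the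
    factors of an LUP decomposition. *)
Let leb_scales n (A : 'M[R]_n) := forall B : set (mvec R n), measurable B ->
  (`|\det A|%:E * leb n (mulmx A @^-1` B) = leb n B)%E.

Lemma measurable_preim_mulmx n (A : 'M[R]_n) (B : set (mvec R n)) :
  measurable B -> measurable (mulmx A @^-1` B : set (mvec R n)).
Proof. by move=> mB; rewrite -[X in measurable X]setTI; exact: measurable_mulmx. Qed.

Lemma leb_scales_trig n (L : 'M[R]_n) : is_trig_mx L -> L \in unitmx -> leb_scales L.
Proof.
move=> Lt uL B mB.
have m1 : measurable_fun setT (EFin \o \1_B : mvec R n -> \bar R).
  by apply/measurable_EFinP; exact: measurable_indic.
have indE (C : set (mvec R n)) : measurable C -> (\int[leb n]_x (\1_C x)%:E = leb n C)%E.
  by move=> mC; rewrite integral_indic// setIT.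
rewrite -indE; last exact: measurable_preim_mulmx.
rewrite -[RHS]indE// -(ge0_integral_trig_mulmxD Lt 0 uL m1); last by move=> x; rewrite lee_fin.
by congr (_ * _)%E; apply: eq_integral => x _; rewrite /= addr0.
Qed.

Lemma leb_scalesM n (A C : 'M[R]_n) : leb_scales A -> leb_scales C -> leb_scales (A *m C).
Proof.
move=> hA hC B mB; rewrite -(hA B mB) -(hC _ (measurable_preim_mulmx A mB)).
rewrite det_mulmx normrM EFinM muleA; congr (_ * leb _ _)%E.
by rewrite predeqE => x /=; rewrite mulmxA.
Qed.

Lemma leb_scales_perm n (s : 'S_n) : leb_scales (perm_mx s).
Proof.
move=> B mB; rewrite det_perm normr_sign mul1e.
pose m := pushforward_measure (leb n) (@measurable_mulmx R n n (perm_mx s)).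
rewrite -[RHS](@leb_eq R n m)// => A mA; rewrite /m /= /pushforward.
rewrite (reindex_perm s^-1) -leb_box /=; last by move=> k; exact: mA.
congr (leb n _); rewrite predeqE => x.
have sE k : (perm_mx s *m x) k 0 = x (s k) 0 by rewrite -row_permE mxE.
rewrite /box /=; split=> H k; first by have := H (s^-1%g k); rewrite sE permKV.
by rewrite sE; have := H (s k); rewrite permK.
Qed.

Lemma leb_mulmx n (A : 'M[R]_n) : A \in unitmx -> leb_scales A.
Proof.
case: n A => [|n] A uA.
  by apply: leb_scales_trig => //; apply/is_trig_mxP => -[].
have := cormen_lup_perm A; have := cormen_lup_correct A; have := cormen_lup_detL A.
have := @cormen_lup_lower _ _ A; have := @cormen_lup_upper _ _ A.
case: (cormen_lup A) => -[P L] U /= Uup Llo detL PA /is_perm_mxP [s Ps].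
rewrite Ps in PA.
have -> : A = perm_mx s^-1 *m (L *m U).
  by rewrite -[L *m U]/(L * U) -PA mulmxA -perm_mxM mulVg perm_mx1 mul1mx.
have uL : L \in unitmx by rewrite unitmxE detL unitr1.
have uU : U \in unitmx.
  have : L *m U \in unitmx by rewrite -[L *m U]/(L * U) -PA unitmx_mul uA unitmx_perm.
  by rewrite unitmx_mul uL.
(* Conjugation by the reversal of the coordinates turns the upper triangular factor into a lower
   triangular one. *)
pose r := perm (@rev_ord_inj n.+1).
have rr : (r * r = 1)%g by apply/permP => k; rewrite permM !permE rev_ordK.
have rV : (r^-1 = r)%g by rewrite -[LHS]mulg1 -rr mulgA mulVg mul1g.
have -> : U = perm_mx r *m (perm_mx r *m U *m perm_mx r) *m perm_mx r.
  by rewrite -!mulmxA -perm_mxM rr perm_mx1 mulmx1 mulmxA -perm_mxM rr perm_mx1 mul1mx.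
apply: leb_scalesM; first exact: leb_scales_perm.
apply: leb_scalesM.
  apply: leb_scales_trig => //; apply/is_trig_mxP => i j ij.
  by rewrite Llo 1?ltnW// -val_eqE ltn_eqF.
apply: leb_scalesM; last exact: leb_scales_perm.
apply: leb_scalesM; first exact: leb_scales_perm.
apply: leb_scales_trig; last by rewrite !unitmx_mul uU !unitmx_perm.
apply/is_trig_mxP => i j ij.
rewrite -row_permE -[r]invgK -col_permE !mxE Uup//.
by rewrite invgK rV !permE /=; have := ltn_ord j; lia.
Qed.

Lemma ge0_integral_mulmx n (A : 'M[R]_n) (f : mvec R n -> \bar R) : A \in unitmx ->
  measurable_fun setT f -> (forall x, 0 <= f x)%E ->
  (`|\det A|%:E * \int[leb n]_x f (A *m x)%R = \int[leb n]_x f x)%E.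
Proof.
move=> uA mf f0; pose k : {nonneg R} := NngNum (normr_ge0 (\det A)).
pose m := mscale k (pushforward_measure (leb n) (@measurable_mulmx R n n A)).
transitivity (\int[m]_x f x)%E; last first.
  by apply: eq_measure_integral => B mB _; exact: leb_mulmx.
rewrite ge0_integral_mscale//; congr (_ * _)%E.
by rewrite (ge0_integral_pushforward (@measurable_mulmx R n n A)).
Qed.

Lemma integral_mulmx n (A : 'M[R]_n) (f : mvec R n -> R) : A \in unitmx ->
  measurable_fun setT f ->
  (leb n).-integrable setT (EFin \o f \o mulmx A) ->
  (`|\det A|%:E * \int[leb n]_x (f (A *m x)%R)%:E = \int[leb n]_x (f x)%:E)%E.
Proof.
move=> uA mf fA; have mEf : measurable_fun setT (EFin \o f) by exact/measurable_EFinP.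
have ip := integrable_pos_fin_num measurableT fA.
have ineg := integrable_neg_fin_num measurableT fA.
rewrite [in RHS]integralE -(ge0_integral_mulmx uA (measurable_funepos mEf))//.
rewrite -(ge0_integral_mulmx uA (measurable_funeneg mEf))//.
rewrite [in LHS]integralE muleBr//; last exact: fin_num_adde_defr ip.
by congr (_ * _ - _ * _)%E; apply: eq_integral => x _; rewrite ?funeposE ?funenegE.
Qed.

End LinearChange.

(** * Moments of the standard normal distribution on the line *)

Section GaussianMoments.
Context {R : realType}.
Local Notation lambda := (@lebesgue_measure R).
Local Notation nonneg_half := (`[0%R, +oo[%classic : set R).

Lemma cvg_expRNy (c : R) : c * expR (- x) @[x --> +oo] --> (0 : R).
Proof.
rewrite -(mulr0 c); apply: cvgM; first exact: cvg_cst.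
exact: cvgr_expR.
Qed.

(** The fundamental theorem on a half-line is applied to a nonnegative integrand: the envelope C
    e^(-x) is added to [g], which subtracts it from the primitive [F]. *)
Lemma integral_half_line (F g : R -> R) (C : R) :
  continuous g -> (forall x : R, is_derive x 1 F (g x)) ->
  F x @[x --> +oo] --> (0 : R) -> (forall x, 0 <= x -> `|g x| <= C * expR (- x)) ->
  (\int[lambda]_(x in nonneg_half) (g x + C * expR (- x))%:E = (C - F 0)%:E)%E.
Proof.
move=> cg dF F0 gC.
pose H x := F x - C * expR (- x).
have dH (x : R) : is_derive x 1 H (g x + C * expR (- x)).
  have ? := dF x; rewrite /H; apply: is_derive_eq.
  by rewrite mulrN1 scalerN opprK.
have cH : continuous H.
  by move=> x; apply/differentiable_continuous/derivable1_diffP; have [] := dH x.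
have ce : continuous (fun x => g x + C * expR (- x)).
  move=> x; apply: cvgD; first exact: cg.
  apply: cvgM; first exact: cvg_cst.
  by apply: (continuous_comp (f := -%R)); [exact: oppr_continuous|exact: continuous_expR].
rewrite (@ge0_continuous_FTC2y R _ H 0 0).
- by rewrite /H oppr0 expR0 mulr1 -EFinB; congr EFin; ring.
- by move=> x x0; have := gC x x0; rewrite ler_norml => /andP[+ _]; lra.
- exact: continuous_subspaceT.
- rewrite -[X in _ --> X](subr0 (0 : R)); apply: cvgB => //; exact: cvg_expRNy.
- by move=> x _; have [] := dH x.
- exact: cvg_at_right_filter (cH 0).
- by move=> x _; rewrite derive1E; have := dH x => ?; exact: derive_val.
Qed.

Lemma integral_split (f : R -> R) : (forall x, 0 <= f x) -> measurable_fun setT f ->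
  (\int[lambda]_x (f x)%:E = \int[lambda]_(x in nonneg_half) (f x)%:E +
    \int[lambda]_(x in nonneg_half) (f (- x))%:E)%E.
Proof.
move=> f0 mf.
have mEf : measurable_fun setT (EFin \o f) by exact/measurable_EFinP.
have mE : measurable nonneg_half by exact: measurable_itv.
rewrite -(setUv nonneg_half) ge0_integral_setU//=; last 4 first.
- exact: measurableC.
- by rewrite setUv.
- by move=> x _; rewrite lee_fin.
- exact/disj_setPCl.
congr +%E; rewrite setCitvr integral_itv_bndo_bndc; last exact: measurable_funTS.
rewrite (@ge0_integration_by_substitution0 R (fun x => (f (- x))%:E)); last 2 first.
- by apply/measurable_EFinP; exact: measurableT_comp.
- by move=> x; rewrite lee_fin.
by apply: eq_integral => x _; rewrite opprK.
Qed.

(** The two half-lines contribute C - F(0) and C + F(0). Since the envelope alone also integrates to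
    2C, the integral of [g] must vanish. *)
Lemma integral_derivativeD (F g : R -> R) (C : R) :
  continuous g -> (forall x : R, is_derive x 1 F (g x)) ->
  F x @[x --> +oo] --> (0 : R) -> F (- x) @[x --> +oo] --> (0 : R) ->
  (forall x, `|g x| <= C * expR (- `|x|)) ->
  (\int[lambda]_x (g x + C * expR (- `|x|))%:E = (C *+ 2)%:E)%E.
Proof.
move=> cg dF F0 F0' gC; rewrite integral_split; last 2 first.
- by move=> x; have := gC x; rewrite ler_norml => /andP[+ _]; lra.
- apply: measurable_funD; first exact: continuous_measurable_fun.
  by apply: measurable_funM => //; do 2 apply: measurableT_comp => //.
rewrite (eq_integral (fun x : measurableTypeR R => (g x + C * expR (- x))%:E)); last first.
  by move=> x; rewrite inE/= in_itv/= andbT => x0; rewrite (ger0_norm x0).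
rewrite (integral_half_line cg dF F0); last first.
  by move=> x x0; have := gC x; rewrite (ger0_norm x0).
rewrite (eq_integral (fun x : measurableTypeR R => (g (- x) + C * expR (- x))%:E)); last first.
  by move=> x; rewrite inE/= in_itv/= andbT => x0; rewrite normrN (ger0_norm x0).
have dF' (x : R) : is_derive x 1 (fun x => - F (- x)) (g (- x)).
  have ? := dF (- x).
  have ? : is_derive x 1 (F \o -%R) (g (- x) * -1) by apply: is_derive1_comp.
  have : is_derive x 1 (- (F \o -%R)) (- (g (- x) * -1)) by apply: is_deriveN.
  by rewrite mulrN1 opprK.
rewrite (integral_half_line _ dF'); last 3 first.
- by move=> x; apply: (continuous_comp (f := -%R)); [exact: oppr_continuous|exact: cg].
- by rewrite -(oppr0 R); exact: cvgN.
- by move=> x x0; have := gC (- x); rewrite normrN (ger0_norm x0).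
by rewrite oppr0 -EFinD; congr EFin; ring.
Qed.

Lemma integral_expR_Nnorm (C : R) : 0 <= C ->
  (\int[lambda]_x (C * expR (- `|x|))%:E = (C *+ 2)%:E)%E.
Proof.
move=> C0; rewrite -(@integral_derivativeD (cst 0) (cst 0)).
- by apply: eq_integral => x _; rewrite /= add0r.
- by move=> x; exact: cvg_cst.
- exact: cvg_cst.
- exact: cvg_cst.
- by move=> x; rewrite /= normr0 mulr_ge0// expR_ge0.
Qed.

Lemma integrable_expR_Nnorm (C : R) : 0 <= C ->
  lambda.-integrable setT (fun x => (C * expR (- `|x|))%:E).
Proof.
move=> C0; have e0 (x : R) : 0 <= C * expR (- `|x|) by rewrite mulr_ge0// expR_ge0.
apply/integrableP; split.
  apply/measurable_EFinP; apply: measurable_funM => //.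
  by do 2 apply: measurableT_comp => //.
by under eq_integral do rewrite gee0_abs ?lee_fin//; rewrite integral_expR_Nnorm// ltry.
Qed.

Lemma integrable_le_expR_Nnorm (g : R -> R) (C : R) : measurable_fun setT g ->
  (forall x, `|g x| <= C * expR (- `|x|)) -> lambda.-integrable setT (EFin \o g).
Proof.
move=> mg gC; have C0 : 0 <= C.
  by have := le_trans (normr_ge0 _) (gC 0); rewrite pmulr_lge0// expR_gt0.
have e0 (x : R) : 0 <= C * expR (- `|x|) by rewrite mulr_ge0// expR_ge0.
apply: (le_integrable measurableT _ _ (integrable_expR_Nnorm C0)).
  exact/measurable_EFinP.
by move=> x _; rewrite /= lee_fin (ger0_norm (e0 _)).
Qed.

Lemma integral_derivative_eq0 (F g : R -> R) (C : R) :
  continuous g -> (forall x : R, is_derive x 1 F (g x)) ->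
  F x @[x --> +oo] --> (0 : R) -> F (- x) @[x --> +oo] --> (0 : R) ->
  (forall x, `|g x| <= C * expR (- `|x|)) ->
  (\int[lambda]_x (g x)%:E = 0)%E.
Proof.
move=> cg dF F0 F0' gC.
have C0 : 0 <= C.
  by have := le_trans (normr_ge0 _) (gC 0); rewrite pmulr_lge0// expR_gt0.
have ig := integrable_le_expR_Nnorm (continuous_measurable_fun cg) gC.
have := integral_derivativeD cg dF F0 F0' gC.
under eq_integral do rewrite EFinD.
rewrite integralD//; last exact: integrable_expR_Nnorm.
rewrite integral_expR_Nnorm// -(fineK (integrable_fin_num measurableT ig)) -EFinD.
by move=> -[X0]; congr EFin; lra.
Qed.

Definition std_pdf (x : R) : R := (Num.sqrt (2 * pi))^-1 * expR (- x ^+ 2 / 2).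

Lemma std_pdf_ge0 x : 0 <= std_pdf x.
Proof. by rewrite mulr_ge0 ?invr_ge0 ?expR_ge0. Qed.

Lemma continuous_std_pdf : continuous std_pdf.
Proof.
move=> x; apply: cvgM; first exact: cvg_cst.
apply: (@continuous_comp _ _ _ (fun x : R => - x ^+ 2 / 2) expR); last exact: continuous_expR.
by apply: cvgM; [apply: cvgN; exact: exprn_continuous|exact: cvg_cst].
Qed.

Lemma measurable_std_pdf : measurable_fun setT std_pdf.
Proof. exact: continuous_measurable_fun continuous_std_pdf. Qed.

Lemma integral_std_pdf : (\int[lambda]_x (std_pdf x)%:E = 1)%E.
Proof.
rewrite -(integral_normal_pdf 0 1); apply: eq_integral => x _; congr EFin.
rewrite normal_pdfE ?oner_eq0// /normal_peak /normal_fun /std_pdf.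
by rewrite subr0 expr1n mul1r mulr_natl.
Qed.

Lemma monomial_std_pdf_le k (x : R) :
  `|x ^+ k * std_pdf x| <= (Num.sqrt (2 * pi))^-1 * k`!%:R * expR (`|x| - `|x| ^+ 2 / 2).
Proof.
rewrite normrM (ger0_norm (std_pdf_ge0 x)) normrX /std_pdf mulrCA -!mulrA.
apply: ler_wpM2l; first by rewrite invr_ge0.
(* A single term of the exponential series bounds the power. *)
have xk : `|x| ^+ k <= k`!%:R * expR `|x|.
  case: k => [|k]; first by rewrite expr0 fact0 mul1r -expR0 ler_expR.
  rewrite -ler_pdivrMl ?ltr0n ?fact_gt0//.
  by apply: le_trans (expR_ge1Dxn k (normr_ge0 x)); rewrite mulrC lerDr.
apply: le_trans (ler_wpM2r (expR_ge0 _) xk) _; rewrite -[leLHS]mulrA -expRD.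
by apply: ler_wpM2l => //; rewrite ler_expR -(real_normK (num_real x)); lra.
Qed.

Lemma monomial_std_pdf_bound k :
  exists C : R, forall x, `|x ^+ k * std_pdf x| <= C * expR (- `|x|).
Proof.
(* The exponent 2 comes from (|x| - 2)^2 >= 0, that is, |x| - x^2 / 2 <= 2 - |x|. *)
exists ((Num.sqrt (2 * pi))^-1 * k`!%:R * expR 2) => x.
apply: le_trans (monomial_std_pdf_le k x) _; rewrite -[leRHS]mulrA -expRD.
apply: ler_wpM2l; first by rewrite mulr_ge0// invr_ge0.
by rewrite ler_expR; have := sqr_ge0 (`|x| - 2); lra.
Qed.

Lemma is_derive_monomial_std_pdf k (x : R) :
  is_derive x 1 (fun x => - (x ^+ k * std_pdf x))
    (x ^+ k.+1 * std_pdf x - k%:R * (x ^+ k.-1 * std_pdf x)).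
Proof.
have dq : is_derive x 1 (fun x : R => - x ^+ 2 / 2) (- x).
  rewrite (_ : (fun _ => _) = (- (2^-1 : R)) \*: (fun x : R => x ^+ 2)).
    by apply: is_derive_eq; rewrite /GRing.scale /=; field.
  by apply: funext => y; rewrite -[RHS]/(- (2^-1) * y ^+ 2); field.
have de : is_derive x 1 (fun x : R => expR (- x ^+ 2 / 2)) (expR (- x ^+ 2 / 2) * - x).
  exact: (is_derive1_comp (f := expR) (g := fun x : R => - x ^+ 2 / 2)).
have dX : is_derive x 1 (fun x : R => x ^+ k) (k%:R * x ^+ k.-1).
  by apply: DeriveDef; [exact: exprn_derivable|rewrite exp_derive -[LHS]/((k%:R * x ^+ k.-1) * 1) mulr1].
pose c : R := (Num.sqrt (2 * pi))^-1.
have dF := is_deriveZ (- c) (is_deriveM dX de).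
rewrite (_ : (fun _ => _) = (- c) \*: ((fun x : R => x ^+ k) * (fun x : R => expR (- x ^+ 2 / 2)))).
  apply: (is_derive_eq dF); rewrite /std_pdf -/c (exprS x k).
  rewrite -[LHS]/(- c * (x ^+ k * (expR (- x ^+ 2 / 2) * - x) +
     expR (- x ^+ 2 / 2) * (k%:R * x ^+ k.-1))).
  by move: (expR _) => e; ring.
apply: funext => y.
rewrite -[RHS]/(- c * (y ^+ k * expR (- y ^+ 2 / 2))) /std_pdf -/c.
by move: (expR _) => e; ring.
Qed.

Lemma cvg_expR_bounded (F : R -> R) (C : R) :
  (forall x, 0 <= x -> `|F x| <= C * expR (- x)) -> F x @[x --> +oo] --> (0 : R).
Proof.
move=> FC; apply: (@squeeze_cvgr _ _ _ _ (fun x => - (C * expR (- x))) (fun x => C * expR (- x))).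
- by near=> x; rewrite -ler_norml FC//; near: x; exact: nbhs_pinfty_ge.
- by rewrite -[X in _ --> X]oppr0; apply: cvgN; exact: cvg_expRNy.
- exact: cvg_expRNy.
Unshelve. all: by end_near. Qed.

Lemma integrable_monomial_std_pdf k :
  lambda.-integrable setT (fun x => (x ^+ k * std_pdf x)%:E).
Proof.
have [C kC] := monomial_std_pdf_bound k; apply: integrable_le_expR_Nnorm kC.
by apply: measurable_funM; [exact: exprn_measurable|exact: measurable_std_pdf].
Qed.

Definition std_moment k : R := fine (\int[lambda]_x (x ^+ k * std_pdf x)%:E)%E.

Lemma integral_monomial_std_pdf k :
  (\int[lambda]_x (x ^+ k * std_pdf x)%:E = (std_moment k)%:E)%E.
Proof. by rewrite fineK// (integrable_fin_num measurableT (integrable_monomial_std_pdf k)). Qed.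

Lemma std_moment0 : std_moment 0 = 1.
Proof. by rewrite /std_moment; under eq_integral do rewrite expr0 mul1r; rewrite integral_std_pdf. Qed.

(** Integration by parts: the derivative of -x^k times the density has integral 0. For [k = 0] the
    truncated predecessor is harmless, as its coefficient is 0. *)
Lemma std_momentS k : std_moment k.+1 = k%:R * std_moment k.-1.
Proof.
have [C0 kC0] := monomial_std_pdf_bound k.
have [C1 kC1] := monomial_std_pdf_bound k.+1.
have [C2 kC2] := monomial_std_pdf_bound k.-1.
have F0 : - (x ^+ k * std_pdf x) @[x --> +oo] --> (0 : R).
  apply: (@cvg_expR_bounded _ C0) => x x0.
  by have := kC0 x; rewrite normrN (ger0_norm x0).
have F0' : - ((- x) ^+ k * std_pdf (- x)) @[x --> +oo] --> (0 : R).
  apply: (@cvg_expR_bounded _ C0) => x x0.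
  by have := kC0 (- x); rewrite !normrN (ger0_norm x0).
have cg l : continuous (fun x : R => x ^+ l * std_pdf x).
  by move=> x; apply: cvgM; [exact: exprn_continuous|exact: continuous_std_pdf].
have := @integral_derivative_eq0 _ _ (C1 + k%:R * C2) _ (is_derive_monomial_std_pdf k) F0 F0'.
have -> : (\int[lambda]_x (x ^+ k.+1 * std_pdf x - k%:R * (x ^+ k.-1 * std_pdf x))%:E =
    (std_moment k.+1 - k%:R * std_moment k.-1)%:E)%E.
  under eq_integral do rewrite EFinB (EFinM k%:R).
  rewrite integralB//; last 2 first.
  - exact: integrable_monomial_std_pdf.
  - by apply: integrableZl => //; exact: integrable_monomial_std_pdf.
  rewrite integralZl//; last exact: integrable_monomial_std_pdf.
  by rewrite !integral_monomial_std_pdf -EFinM -EFinB.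
move=> H; apply/eqP; rewrite -subr_eq0; apply/eqP; apply: EFin_inj; apply: H.
  move=> x; apply: cvgB; first exact: cg.
  by apply: cvgM; [exact: cvg_cst|exact: cg].
move=> x; rewrite mulrDl; apply: le_trans (ler_normB _ _) _; apply: lerD; first exact: kC1.
by rewrite normrM ger0_norm// -mulrA ler_wpM2l.
Qed.

End GaussianMoments.

(** * Normal laws on column vectors and independence of subvectors *)

Section GaussianLaw.
Context {R : realType}.
Local Notation lambda := (@lebesgue_measure R).

Definition std_density n (y : mvec R n) : R := \prod_k std_pdf (y k 0).

Lemma std_density_ge0 n (y : mvec R n) : 0 <= std_density y.
Proof. by apply: prodr_ge0 => k _; exact: std_pdf_ge0. Qed.

Lemma measurable_std_density n : measurable_fun setT (@std_density n).
Proof. by apply: (measurable_prod_coord (g := fun=> std_pdf)) => k; exact: measurable_std_pdf. Qed.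

Lemma std_densityE n (y : mvec R n) :
  std_density y = (Num.sqrt (2 * pi)) ^- n * expR (- (y^T *m y) 0 0 / 2).
Proof.
rewrite /std_density big_split /= prodr_const card_ord exprVn; congr (_ * _).
rewrite -expR_sum; congr expR; rewrite mxE -sumrN mulr_suml.
by apply: eq_bigr => k _; rewrite mxE expr2.
Qed.

(** With the covariance given as the inverse of a Gram matrix, the exponent is a squared norm in
    [K *m x] and the normalization is a Jacobian. *)
Lemma normal_densityE n (K : 'M[R]_n) (x : 'cV[R]_n) : K \in unitmx ->
  normal_density (invmx (K^T *m K)) x = `|\det K| * std_density (K *m x).
Proof.
move=> uK; have dK : \det K != 0 by rewrite -unitfE -unitmxE.
rewrite std_densityE /normal_density invmxK trmx_mul !mulmxA mulrA; congr (_ * _).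
rewrite det_inv det_mulmx det_tr sqrtrM ?exprn_ge0 ?mulr_ge0 ?pi_ge0//.
rewrite invfM mulrC; congr (_ * _).
  by rewrite -expr2 -exprVn sqrtr_sqr normfV invrK.
congr (_^-1); elim: n {K x uK dK} => [|n IH]; first by rewrite !expr0 sqrtr1.
by rewrite !exprS sqrtrM ?IH// mulr_ge0 ?pi_ge0.
Qed.

Lemma normal_density1 n (x : 'cV[R]_n) : normal_density 1%:M x = std_density x.
Proof.
have := @normal_densityE n 1%:M x (unitmx1 _ _).
by rewrite trmx1 !mul1mx invmx1 det1 normr1 mul1r.
Qed.

Lemma measurable_density_indic n (B : set (mvec R n)) : measurable B ->
  measurable_fun setT (fun x : mvec R n => \1_B x * std_density x).
Proof.
by move=> mB; apply: measurable_funM; [exact: measurable_indic|exact: measurable_std_density].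
Qed.

Lemma normal_law_std n (B : set (mvec R n)) : measurable B ->
  normal_law 1%:M B = (\int[leb n]_x (\1_B x * std_density x)%:E)%E.
Proof.
move=> mB; rewrite /normal_law -iintE; last 2 first.
- by apply/measurable_EFinP; exact: measurable_density_indic.
- by move=> x; rewrite lee_fin mulr_ge0// std_density_ge0.
by congr iint; apply: funext => x; rewrite normal_density1.
Qed.

Lemma normal_law_unitmx n (K : 'M[R]_n) (B : set (mvec R n)) : K \in unitmx -> measurable B ->
  normal_law (invmx (K^T *m K)) B = normal_law 1%:M (mulmx (invmx K) @^-1` B).
Proof.
move=> uK mB; have mK := measurable_preim_mulmx (invmx K) mB.
rewrite normal_law_std// -(ge0_integral_mulmx uK); last 2 first.
- by apply/measurable_EFinP; exact: measurable_density_indic.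
- by move=> x; rewrite lee_fin mulr_ge0// std_density_ge0.
have mf : measurable_fun setT (fun x : mvec R n => \1_B x * std_density (K *m x)).
  apply: measurable_funM; first exact: measurable_indic.
  by apply: (measurableT_comp (@measurable_std_density n)); exact: measurable_mulmx.
have f0 (x : mvec R n) : 0 <= \1_B x * std_density (K *m x).
  by rewrite mulr_ge0// std_density_ge0.
rewrite (eq_integral (fun x : mvec R n => (\1_B x * std_density (K *m x))%:E)); last first.
  move=> x _; rewrite !indicE; congr ((_ : bool)%:R * _)%:E.
  by rewrite -[in RHS](mulKmx uK x); apply/idP/idP => /set_mem H; exact/mem_set.
rewrite -ge0_integralZl//; [|exact/measurable_EFinP|by move=> x _; rewrite lee_fin].
rewrite /normal_law -iintE.
- by congr iint; apply: funext => x; rewrite normal_densityE// mulrCA.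
- by apply: emeasurable_funM => //; exact/measurable_EFinP.
- by move=> x; rewrite mule_ge0// lee_fin.
Qed.

(** [normal_law] is a bare set function given by iterated integrals; this version carries a measure
    structure, to which uniqueness of measures applies. *)
Definition gauss n (B : set (mvec R n)) : \bar R :=
  (\int[leb n]_(x in B) (std_density x)%:E)%E.

Let gauss0 n : @gauss n set0 = 0%E.
Proof. by rewrite /gauss integral_set0. Qed.

Let gauss_ge0 n B : (0 <= @gauss n B)%E.
Proof. by apply: integral_ge0 => x _; rewrite lee_fin std_density_ge0. Qed.

Let gauss_sigma_additive n : semi_sigma_additive (@gauss n).
Proof.
move=> F mF tF mUF; rewrite /gauss ge0_integral_bigcup//.
- apply: is_cvg_ereal_nneg_natsum_cond => k _ _.
  by apply: integral_ge0 => x _; rewrite lee_fin std_density_ge0.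
- by apply/measurable_EFinP; apply: measurable_funTS; exact: measurable_std_density.
- by move=> x _; rewrite lee_fin std_density_ge0.
Qed.

HB.instance Definition _ n :=
  isMeasure.Build _ _ _ (@gauss n) (gauss0 n) (@gauss_ge0 n) (@gauss_sigma_additive n).

Lemma normal_law_gauss n (B : set (mvec R n)) : measurable B -> normal_law 1%:M B = gauss B.
Proof.
move=> mB; rewrite normal_law_std// /gauss [RHS]integral_mkcond.
apply: eq_integral => x _; rewrite patchE indicE.
by case: ifPn => _; rewrite ?mul1r ?mul0r.
Qed.

Definition std_prob (A : set R) : \bar R := (\int[lambda]_x (\1_A x * std_pdf x)%:E)%E.

Lemma std_probT : std_prob setT = 1%E.
Proof.
rewrite /std_prob -integral_std_pdf; apply: eq_integral => x _.
by rewrite indicE in_setT mul1r.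
Qed.

Lemma integrable_indic_std_pdf (A : set R) : measurable A ->
  lambda.-integrable setT (fun x => (\1_A x * std_pdf x)%:E).
Proof.
move=> mA; apply: (le_integrable measurableT _ _ (integrable_monomial_std_pdf 0)).
- apply/measurable_EFinP; apply: measurable_funM; first exact: measurable_indic.
  exact: measurable_std_pdf.
- move=> x _; rewrite /= expr0 mul1r lee_fin normrM ler_piMl// indicE.
  by case: (_ \in _); rewrite ?normr1 ?normr0.
Qed.

Lemma gauss_box n (A : 'I_n -> set R) : (forall k, measurable (A k)) ->
  gauss (box A : set (mvec R n)) = (\prod_k std_prob (A k))%E.
Proof.
move=> mA; rewrite -normal_law_gauss; last exact: measurable_box.
rewrite /normal_law /std_prob -[RHS]mul1e -(@iint_prod R n (fun k x => \1_(A k) x * std_pdf x) 1).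
  congr iint; apply: funext => x; rewrite normal_density1 mul1r big_split /=; congr (_ * _)%:E.
  rewrite indicE; have [/set_mem xA|xA] := boolP (x \in box A).
    by rewrite big1// => k _; rewrite indicE mem_set//; exact: xA.
  have [k xk] : exists k, x k 0 \notin A k.
    apply: contrapT => H; move/negP: xA; apply; apply/mem_set => k.
    by apply: contrapT => xk; apply: H; exists k; apply/negP => /set_mem.
  by rewrite (bigD1 k)//= indicE (negbTE xk) mul0r.
by move=> k; exact: integrable_indic_std_pdf.
Qed.

Lemma gauss_setT n : gauss (setT : set (mvec R n)) = 1%E.
Proof.
rewrite (_ : setT = box (fun=> setT)); last by rewrite predeqE => x; split.
by rewrite gauss_box// big1// => k _; exact: std_probT.
Qed.

Lemma gauss_fin_num n (B : set (mvec R n)) : measurable B -> gauss B \is a fin_num.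
Proof.
move=> mB; rewrite ge0_fin_numE//; apply: (@le_lt_trans _ _ 1%E); last exact: ltry.
by rewrite -(@gauss_setT n); apply: le_measure => //; rewrite inE.
Qed.

(** Testing boxes suffices by uniqueness of measures, and the product on the right displays the
    independence of the coordinates. *)
Definition std_normal d (T : measurableType d) (P : probability T R) n (X : T -> mvec R n) :=
  measurable_fun setT X /\ forall A : 'I_n -> set R, (forall k, measurable (A k)) ->
    P (X @^-1` box A) = (\prod_k std_prob (A k))%E.

Lemma std_normal_mulmx d (T : measurableType d) (P : probability T R) n
    (Z : T -> 'cV[R]_n) (K : 'M[R]_n) : K \in unitmx ->
  is_normal_vector P Z (invmx (K^T *m K)) -> std_normal P (fun t => K *m Z t : mvec R n).
Proof.
move=> uK hZ; split=> [_ B mB|A mA].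
  rewrite setTI (_ : _ @^-1` B = Z @^-1` (mulmx K @^-1` B))//.
  by case: (hZ _ (measurable_preim_mulmx K mB)).
have mB := measurable_box mA; have [_] := hZ _ (measurable_preim_mulmx K mB).
rewrite normal_law_unitmx; [|by []|exact: measurable_preim_mulmx].
rewrite -gauss_box// -normal_law_gauss// => PE; apply: (etrans PE).
by congr (normal_law _ _); rewrite predeqE => y /=; rewrite mulKVmx.
Qed.

Lemma measurable_preim d (T : measurableType d) n (X : T -> mvec R n) (B : set (mvec R n)) :
  measurable_fun setT X -> measurable B -> measurable (X @^-1` B).
Proof. by move=> mX mB; rewrite -[X in measurable X]setTI; exact: mX. Qed.

Lemma finite_measure_mvec_eq n (m1 m2 : {measure set (mvec R n) -> \bar R}) :
  (m1 setT < +oo)%E ->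
  (forall A : 'I_n -> set R, (forall k, measurable (A k)) -> m1 (box A) = m2 (box A)) ->
  forall B, measurable B -> m1 B = m2 B.
Proof.
move=> m1fin m12; apply: measurable_mvec_eq => // r; apply: le_lt_trans m1fin.
by apply: le_measure => //; rewrite inE; [apply: measurable_box => k; exact: measurable_itv|].
Qed.

Lemma std_normal_family d (T : measurableType d) (P : probability T R) n
    (X : T -> mvec R n) (I : finType) (phi : I -> 'I_n) (A : I -> set R) :
  std_normal P X -> injective phi -> (forall l, measurable (A l)) ->
  P [set t | forall l, A l (X t (phi l) 0)] = (\prod_l std_prob (A l))%E.
Proof.
move=> [mX PX] phi_inj mA.
(* Coordinates outside the range of [phi] are left free and contribute the factor 1. *)
pose A' k := if [pick l | phi l == k] is Some l then A l else setT.
have A'phi l : A' (phi l) = A l.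
  rewrite /A'; case: pickP => [l' /eqP/phi_inj -> //|/(_ l)]; by rewrite eqxx.
have A'out k : k \notin codom phi -> A' k = setT.
  rewrite /A'; case: pickP => [l /eqP <-|//]; by rewrite codom_f.
have mA' k : measurable (A' k) by rewrite /A'; case: pickP.
have -> : [set t | forall l, A l (X t (phi l) 0)] = X @^-1` box A'.
  rewrite predeqE => t; split=> [H k /=|H l]; last by have := H (phi l); rewrite A'phi.
  have [/codomP[l ->]|/A'out ->//] := boolP (k \in codom phi).
  by rewrite A'phi; exact: H.
rewrite PX// (bigID (mem (codom phi)))/= [X in (_ * X)%E]big1 ?mule1; last first.
  by move=> k /A'out ->; exact: std_probT.
rewrite (eq_bigl (mem [set phi l | l : I]%SET)); last first.
  by move=> k; apply/idP/imsetP => [/codomP[l ->]|[l _ ->]]; [exists l|exact: codom_f].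
rewrite big_imset/=; last by move=> l l' _ _; exact: phi_inj.
by apply: eq_big => [l|l _]; rewrite ?inE ?A'phi.
Qed.

Lemma measurable_subvector d (T : measurableType d) n p (X : T -> mvec R n) (phi : 'I_p -> 'I_n) :
  measurable_fun setT X -> measurable_fun setT (fun t => \col_l X t (phi l) 0 : mvec R p).
Proof.
move=> mX; apply: measurable_to_mvec => l.
rewrite (_ : (fun _ => _) = (fun x : mvec R n => x (phi l) 0) \o X).
  exact: measurableT_comp (@measurable_coord R n (phi l)) mX.
by apply: funext => t; rewrite /= mxE.
Qed.

(** The identity holds for two boxes because the joint index map on the sum type is injective. It is
    then extended to Borel sets in one argument at a time. *)
Lemma std_normal_subvectors d (T : measurableType d) (P : probability T R) n p q
    (X : T -> mvec R n) (phi : 'I_p -> 'I_n) (psi : 'I_q -> 'I_n)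
    (B : set (mvec R p)) (C : set (mvec R q)) :
  std_normal P X -> injective phi -> injective psi -> (forall k l, phi k != psi l) ->
  measurable B -> measurable C ->
  P ((fun t => \col_l X t (phi l) 0 : mvec R p) @^-1` B `&`
     (fun t => \col_l X t (psi l) 0 : mvec R q) @^-1` C) =
  (normal_law 1%:M B * normal_law 1%:M C)%E.
Proof.
move=> nX phi_inj psi_inj phipsi mB mC.
have [mX _] := nX.
set X1 := fun t => _ : mvec R p; set X2 := fun t => _ : mvec R q.
have mX1 : measurable_fun setT X1 by exact: measurable_subvector.
have mX2 : measurable_fun setT X2 by exact: measurable_subvector.
have boxbox (A1 : 'I_p -> set R) (A2 : 'I_q -> set R) :
    (forall k, measurable (A1 k)) -> (forall k, measurable (A2 k)) ->
    P (X1 @^-1` box A1 `&` X2 @^-1` box A2) = (gauss (box A1) * gauss (box A2))%E.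
  move=> mA1 mA2; rewrite !gauss_box//.
  pose phipsi_ (s : 'I_p + 'I_q) := match s with inl k => phi k | inr k => psi k end.
  pose A s := match s with inl k => A1 k | inr k => A2 k end.
  have := @std_normal_family _ _ P n X _ phipsi_ A nX.
  rewrite big_sumType /= => <-.
  - congr (P _); rewrite predeqE => t; split=> [[H1 H2] [k|k]|H].
    + by have := H1 k; rewrite /X1 mxE.
    + by have := H2 k; rewrite /X2 mxE.
    + by split=> k; rewrite /X1 /X2 mxE; [exact: (H (inl k))|exact: (H (inr k))].
  - move=> [k|k] [l|l] /=; first by move/phi_inj ->.
    + by move=> E; have := phipsi k l; rewrite E eqxx.
    + by move=> E; have := phipsi l k; rewrite E eqxx.
    + by move/psi_inj ->.
  - by case.
rewrite !normal_law_gauss//.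
(* With the first box fixed, both sides are finite measures of the second set that agree on
   boxes. *)
have boxC (A1 : 'I_p -> set R) : (forall k, measurable (A1 k)) ->
    P (X1 @^-1` box A1 `&` X2 @^-1` C) = (gauss (box A1) * gauss C)%E.
  move=> mA1; have mbA := measurable_box mA1; have mD := measurable_preim mX1 mbA.
  pose m1 := pushforward_measure (mrestr P mD) mX2.
  pose r := NngNum (fine_ge0 (gauss_ge0 (box A1))).
  have : m1 C = mscale r (@gauss q) C.
    apply: finite_measure_mvec_eq => // [|A2 mA2]; rewrite /= /pushforward /mrestr.
      by rewrite preimage_setT setTI; apply: le_lt_trans (probability_le1 _ mD) (ltry _).
    by rewrite /mscale /= fineK ?gauss_fin_num// setIC boxbox.
  by rewrite /m1 /= /pushforward /mrestr /mscale /= fineK ?gauss_fin_num// setIC.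
(* The same argument in the first set, now with an arbitrary Borel set [C] fixed. *)
have mD := measurable_preim mX2 mC.
pose m1 := pushforward_measure (mrestr P mD) mX1.
pose r := NngNum (fine_ge0 (gauss_ge0 C)).
have : m1 B = mscale r (@gauss p) B.
  apply: finite_measure_mvec_eq => // [|A1 mA1]; rewrite /= /pushforward /mrestr.
    by rewrite preimage_setT setTI; apply: le_lt_trans (probability_le1 _ mD) (ltry _).
  by rewrite /mscale /= fineK ?gauss_fin_num// boxC// muleC.
by rewrite /m1 /= /pushforward /mrestr /mscale /= fineK ?gauss_fin_num// muleC.
Qed.

End GaussianLaw.

(** * Derivative of the normal log-density in the covariance *)

Section Score.
Context {R : realType}.

(** Derivatives of determinants and inverses are read off from second-order expansions, so that no
    matrix function has to be differentiated entry by entry. *)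
Lemma is_derive_at0 (f g : R -> R) (c : R) :
  {near (0 : R), forall t, f t = f 0 + t * c + t ^+ 2 * g t} -> {for 0, continuous g} ->
  is_derive (0 : R) 1 f c.
Proof.
move=> fE cg.
have lim : (fun h : R => h^-1 *: ((f \o shift 0) (h *: (1 : R)) - f 0)) @ 0^' --> c.
  have cgc : (fun h => c + h * g h) @ (0 : R) --> c + 0 * g 0.
    by apply: cvgD; [exact: cvg_cst|apply: cvgM; [exact: cvg_id|exact: cg]].
  rewrite mul0r addr0 in cgc.
  have cgc' : (fun h => c + h * g h) @ 0^' --> c.
    by apply: cvg_trans cgc; apply: cvg_app; exact: cvg_within.
  apply: cvg_trans cgc'; apply: near_eq_cvg; near=> h.
  have h0 : h != 0 by near: h; exact: nbhs_dnbhs_neq.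
  rewrite /= addr0 -[h%:A]/(h * 1) mulr1 -[_ *: _]/(_ * _).
  have -> : f h = f 0 + h * c + h ^+ 2 * g h by near: h; exact: cvg_within fE.
  by field.
apply: DeriveDef; first by apply/cvg_ex; exists c.
exact: cvg_lim lim.
Unshelve. all: by end_near. Qed.

Lemma invmx_mul n (A B : 'M[R]_n) : A \in unitmx -> B \in unitmx ->
  invmx (A *m B) = invmx B *m invmx A.
Proof.
move=> uA uB; have uAB : A *m B \in unitmx by rewrite unitmx_mul uA.
by apply: (can_inj (mulmxK uAB)); rewrite mulVmx// mulmxA mulmxKV// mulVmx.
Qed.

(** For t != 0 the determinant is t^n times the characteristic polynomial of [- F] at 1/t, whose two
    top coefficients are 1 and the trace of [F]. *)
Lemma det1D_expansion n (F : 'M[R]_n) :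
  exists q : {poly R}, forall t, \det (1%:M + t *: F) = 1 + t * \tr F + t ^+ 2 * q.[t].
Proof.
case: n F => [|n] F.
  by exists 0 => t; rewrite det_mx00 /mxtrace big_ord0 horner0 !mulr0 !addr0.
pose c := char_poly (- F); have sc : size c = n.+2 by exact: size_char_poly.
have cn : c`_n = \tr F by rewrite char_poly_trace// raddfN opprK.
have cSn : c`_n.+1 = 1 by have := char_poly_monic (- F); rewrite monicE /lead_coef sc => /eqP.
(* The remaining coefficients in reverse order, with t^2 taken out; the matrix has size [n.+1]
   here. *)
exists (\sum_(k < n) c`_k *: 'X^(n.-1 - k)) => t.
have [->|t0] := eqVneq t 0.
  by rewrite scale0r addr0 det1 expr2 !mul0r !addr0.
have -> : 1%:M + t *: F = t *: (t^-1%:M - - F).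
  by rewrite opprK scalerDr scale_scalar_mx divff.
rewrite detZ; have -> : \det (t^-1%:M - - F) = c.[t^-1].
  rewrite /c /char_poly -horner_evalE -det_map_mx; congr (\det _).
  apply/matrixP => i j; rewrite !mxE /= !rmorphB /= rmorphMn/= !horner_evalE.
  by rewrite hornerX hornerC.
rewrite horner_coef sc big_ord_recr big_ord_recr /= cSn cn.
have tV k : (k <= n.+1)%N -> t ^+ n.+1 * t^-1 ^+ k = t ^+ (n.+1 - k).
  by move=> kn; rewrite exprVn -{1}(subnK kn) exprD mulfK// expf_neq0.
rewrite mul1r !mulrDr tV// subnn expr0 mulrCA tV// subSnn expr1.
suff -> : t ^+ n.+1 * (\sum_(i < n) c`_i * t^-1 ^+ i) =
    t ^+ 2 * (\sum_(k < n) c`_k *: 'X^(n.-1 - k)).[t] by ring.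
rewrite horner_sum !mulr_sumr; apply: eq_bigr => k _.
have kn := ltn_ord k.
rewrite hornerZ hornerXn (mulrCA (t ^+ n.+1)) (mulrCA (t ^+ 2)) tV; last by lia.
by rewrite -exprD; congr (_ * _ ^+ _); lia.
Qed.

(** G = 1 + tF satisfies G^-1 = 1 - tF + t^2 F^2 G^-1. Writing the last inverse as adjugate over
    determinant makes the remainder a polynomial over a determinant, which is continuous near 0. *)
Lemma inv1D_expansion n (F : 'M[R]_n) (y : 'cV[R]_n) :
  exists r : {poly R}, forall t, 1%:M + t *: F \in unitmx ->
    (y^T *m invmx (1%:M + t *: F) *m y) 0 0 =
    (y^T *m y) 0 0 - t * (y^T *m F *m y) 0 0 + t ^+ 2 * (r.[t] / \det (1%:M + t *: F)).
Proof.
pose Fp : 'M[{poly R}]_n := 1%:M + 'X *: map_mx polyC F.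
exists ((map_mx polyC (y^T *m F *m F) *m \adj Fp *m map_mx polyC y) 0 0) => t uF.
have FpE : map_mx (horner_eval t) Fp = 1%:M + t *: F.
  apply/matrixP => i j; rewrite !mxE /horner_eval hornerD hornerM hornerX hornerC.
  by case: (i == j); rewrite ?hornerC ?horner0 ?hornerE.
have -> : ((map_mx polyC (y^T *m F *m F) *m \adj Fp *m map_mx polyC y) 0 0).[t] =
    (y^T *m F *m F *m \adj (1%:M + t *: F) *m y) 0 0.
  rewrite -[_.[t]]/(horner_eval t _) -FpE -map_mx_adj.
  have polyCK (p q : nat) (M : 'M[R]_(p, q)) : map_mx (horner_eval t) (map_mx polyC M) = M.
    by apply/matrixP => i j; rewrite !mxE /horner_eval hornerC.
  have -> : forall M : 'M[{poly R}]_1, horner_eval t (M 0 0) = map_mx (horner_eval t) M 0 0.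
    by move=> M; rewrite mxE.
  by rewrite !map_mxM/= !polyCK.
set G := 1%:M + t *: F in uF *.
have GE : invmx G = 1%:M - t *: F + t ^+ 2 *: (F *m F *m invmx G).
  apply: (can_inj (mulmxK uF)); rewrite mulVmx// mulmxDl -scalemxAl -[_ *m invmx G *m G]mulmxA.
  rewrite mulVmx// mulmx1 /G mulmxBl mul1mx mulmxDr mulmx1 -scalemxAl -scalemxAr.
  by rewrite scalerA expr2 opprD addrA addrK subrK.
rewrite {1}GE mulmxDr mulmxBr mulmx1 mulmxDl mulmxBl.
rewrite -!(scalemxAr, scalemxAl) !mulmxA.
have entryE (M N P : 'M[R]_1) a b : (M - a *: N + b *: P) 0 0 = M 0 0 - a * N 0 0 + b * P 0 0.
  by rewrite !mxE.
rewrite entryE; congr (_ + _ * _); rewrite /invmx uF -scalemxAr -scalemxAl.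
by rewrite [LHS]mxE mulrC.
Qed.

Lemma is_derive_ln_normal_density n (A E : 'M[R]_n) (x : 'cV[R]_n) : A \in unitmx ->
  let F := A *m E *m A^T in let y := A *m x in
  is_derive (0 : R) 1 (fun t => ln (normal_density (invmx (A^T *m A) + t *: E) x))
    (((y^T *m F *m y) 0 0 - \tr F) / 2).
Proof.
move=> uA F y; have uAT : A^T \in unitmx by rewrite unitmx_tr.
have dA : \det A != 0 by rewrite -unitfE -unitmxE.
(* Factoring out [A] reduces the perturbation of the covariance to one of the identity in the
   direction [F]. *)
have SE t : invmx (A^T *m A) + t *: E = invmx A *m (1%:M + t *: F) *m invmx A^T.
  rewrite mulmxDr mulmxDl mulmx1 -scalemxAr -scalemxAl /F !mulmxA mulVmx// mul1mx.
  by rewrite -mulmxA mulmxV// mulmx1 invmx_mul.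
have [q detE] := det1D_expansion F; have [r invE] := inv1D_expansion F y.
pose c : R := (2 * pi) ^+ n / \det A ^+ 2.
have c0 : 0 < c.
  apply: divr_gt0; last by rewrite exprn_even_gt0.
  by apply: exprn_gt0; rewrite mulr_gt0 ?pi_gt0.
have cdet : continuous (fun t : R => \det (1%:M + t *: F)).
  under eq_fun do rewrite detE.
  move=> t; apply: cvgD; last by apply: cvgM; [exact: exprn_continuous|exact: continuous_horner].
  by apply: cvgD; [exact: cvg_cst|apply: cvgM; [exact: cvg_id|exact: cvg_cst]].
have det0 : \det (1%:M + (0 : R) *: F) = 1 by rewrite scale0r addr0 det1.
have near_det : \forall t \near (0 : R), 0 < \det (1%:M + t *: F).
  by apply: (cvgr_gt _ (cdet 0)); rewrite det0.
pose g t := - (ln c + ln (\det (1%:M + t *: F))) / 2 -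
  (y^T *m invmx (1%:M + t *: F) *m y) 0 0 / 2.
apply: (@near_eq_is_derive _ _ _ g).
  near=> t; have dt : 0 < \det (1%:M + t *: F) by near: t.
  have ut : 1%:M + t *: F \in unitmx by rewrite unitmxE unitfE gt_eqF.
  rewrite SE /normal_density.
  have -> : (2 * pi) ^+ n * \det (invmx A *m (1%:M + t *: F) *m invmx A^T) =
      c * \det (1%:M + t *: F).
    by rewrite !det_mulmx !det_inv det_tr /c; field.
  rewrite !invmx_mul ?unitmx_mul ?unitmx_inv ?uA ?uAT ?ut// !invmxK.
  have -> : x^T *m (A^T *m (invmx (1%:M + t *: F) *m A)) *m x =
      y^T *m invmx (1%:M + t *: F) *m y by rewrite /y trmx_mul !mulmxA.
  have cd0 : 0 < c * \det (1%:M + t *: F) by rewrite mulr_gt0.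
  have s0 : 0 < Num.sqrt (c * \det (1%:M + t *: F)) by rewrite sqrtr_gt0.
  rewrite lnM ?posrE ?invr_gt0 ?expR_gt0// expRK lnV ?posrE// /g -lnM ?posrE//.
  rewrite -[in LHS](sqr_sqrtr (ltW cd0)) lnXn// mulr2n; lra.
have dln : is_derive (0 : R) 1 (fun t => ln (\det (1%:M + t *: F))) (\tr F).
  have dd : is_derive (0 : R) 1 (fun t => \det (1%:M + t *: F)) (\tr F).
    apply: (@is_derive_at0 _ (horner q)); last exact: continuous_horner.
    by near=> t; rewrite det0 detE.
  have dl : is_derive (\det (1%:M + (0 : R) *: F)) 1 (@ln R) 1.
    by rewrite det0 -[X in is_derive _ _ _ X]invr1; apply: is_derive1_ln.
  by rewrite -[\tr F]mul1r; exact: (is_derive1_comp (f := @ln R)).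
have dinv : is_derive (0 : R) 1 (fun t => (y^T *m invmx (1%:M + t *: F) *m y) 0 0)
    (- (y^T *m F *m y) 0 0).
  apply: (@is_derive_at0 _ (fun t => r.[t] / \det (1%:M + t *: F))).
    near=> t; have dt : 0 < \det (1%:M + t *: F) by near: t.
    rewrite invE ?unitmxE ?unitfE ?gt_eqF// [in RHS]invE ?scale0r ?addr0 ?unitmx1//.
    by ring.
  apply: cvgM; first exact: continuous_horner.
  by apply: cvgV; [rewrite det0 oner_eq0|exact: cdet].
have -> : g = (- (2^-1)) \*: (cst (ln c) + (fun t => ln (\det (1%:M + t *: F))) +
    (fun t => (y^T *m invmx (1%:M + t *: F) *m y) 0 0)).
  apply: funext => t; rewrite /g -[RHS]/(- (2^-1) * (ln c + _ + _)); lra.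
apply: is_derive_eq.
rewrite -[LHS]/(- (2^-1) * (0 + \tr F + - (y^T *m F *m y) 0 0)); lra.
Unshelve. all: by end_near. Qed.

End Score.

(** * Gaussian expectations of polynomials and Isserlis' theorem *)

Section GaussianExpectation.
Context {R : realType}.
Local Notation lambda := (@lebesgue_measure R).

Let quarter : R := 4^-1.

Let quarter_gt0 : 0 < quarter. Proof. by rewrite invr_gt0. Qed.

(** The functions for which the iterated integral against the standard normal density is a true
    expectation. The rate is fixed, so that sums stay in the class. *)
Definition tame n (f : mvec R n -> R) := measurable_fun setT f /\
  exists c, dominated (fun y => f y * std_density y) quarter c.

Definition Ex n (f : mvec R n -> R) : R :=
  fine (\int[leb n]_y (f y * std_density y)%:E)%E.

Lemma tame_measurable n (f : mvec R n -> R) : tame f ->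
  measurable_fun setT (fun y => f y * std_density y).
Proof. by move=> [mf _]; apply: measurable_funM => //; exact: measurable_std_density. Qed.

Lemma tame_integrable n (f : mvec R n -> R) : tame f ->
  (leb n).-integrable setT (fun y => (f y * std_density y)%:E).
Proof.
move=> tf; have [_ [c fc]] := tf.
exact: (dominated_integrable quarter_gt0 (tame_measurable tf) fc).
Qed.

Lemma integral_tame n (f : mvec R n -> R) : tame f ->
  (\int[leb n]_y (f y * std_density y)%:E = (Ex f)%:E)%E.
Proof. by move=> tf; rewrite fineK// (integrable_fin_num measurableT (tame_integrable tf)). Qed.

Lemma iint_tame n (f : mvec R n -> R) : tame f ->
  iint (fun y => (f y * std_density y)%:E) = (Ex f)%:E.
Proof.
move=> tf; rewrite -integral_tame//; have [_ [c fc]] := tf.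
exact: (iint_dominated quarter_gt0 (tame_measurable tf) fc).
Qed.

Lemma tameD n (f g : mvec R n -> R) : tame f -> tame g -> tame (fun y => f y + g y).
Proof.
move=> [mf [c fc]] [mg [c' gc]]; split; first exact: measurable_funD.
exists (c + c') => y; rewrite !mulrDl; apply: le_trans (ler_normD _ _) _.
exact: lerD (fc y) (gc y).
Qed.

Lemma tameZ n (a : R) (f : mvec R n -> R) : tame f -> tame (fun y => a * f y).
Proof.
move=> [mf [c fc]]; split; first exact: measurable_funM.
exists (`|a| * c) => y; rewrite -!mulrA normrM; exact: ler_wpM2l (fc y).
Qed.

Lemma ExD n (f g : mvec R n -> R) : tame f -> tame g ->
  Ex (fun y => f y + g y) = Ex f + Ex g.
Proof.
move=> tf tg; apply: EFin_inj; rewrite EFinD -!integral_tame//; last exact: tameD.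
rewrite -integralD//; [|exact: tame_integrable|exact: tame_integrable].
by apply: eq_integral => y _; rewrite mulrDl EFinD.
Qed.

Lemma ExZ n (a : R) (f : mvec R n -> R) : tame f -> Ex (fun y => a * f y) = a * Ex f.
Proof.
move=> tf; apply: EFin_inj; rewrite EFinM -!integral_tame//; last exact: tameZ.
rewrite -integralZl//; last exact: tame_integrable.
by apply: eq_integral => y _; rewrite -EFinM mulrA.
Qed.

(** Indices are listed with repetition, the exponent of a coordinate being its multiplicity; this
    suits the recursion on moments. *)
Definition monomial n (s : seq 'I_n) (y : mvec R n) : R := \prod_(k <- s) y k 0.

Lemma monomialE n (s : seq 'I_n) (y : mvec R n) :
  monomial s y = \prod_k y k 0 ^+ count_mem k s.
Proof.
elim: s => [|l s IH]; first by rewrite /monomial big_nil big1.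
rewrite /monomial big_cons -/(monomial s y) IH.
rewrite (bigD1 l)//= [RHS](bigD1 l)//= eqxx exprD expr1 -mulrA; congr (_ * (_ * _)).
by apply: eq_bigr => k kl; rewrite eq_sym (negbTE kl).
Qed.

Lemma monomial_std_pdf_gauss k :
  exists C : R, 0 <= C /\ forall x, `|x ^+ k * std_pdf x| <= C * expR (- quarter * x ^+ 2).
Proof.
(* Again (|x| - 2)^2 >= 0, now as |x| - x^2 / 2 <= 1 - x^2 / 4, which explains the rate
   [quarter]. *)
exists ((Num.sqrt (2 * pi))^-1 * k`!%:R * expR 1); split.
  by rewrite !mulr_ge0 ?invr_ge0// expR_ge0.
move=> x; apply: le_trans (monomial_std_pdf_le k x) _; rewrite -[leRHS]mulrA -expRD.
apply: ler_wpM2l; first by rewrite mulr_ge0// invr_ge0.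
rewrite ler_expR -(real_normK (num_real x)) /quarter.
by have := sqr_ge0 (`|x| - 2); lra.
Qed.

Lemma tame_monomial n (s : seq 'I_n) : tame (monomial s).
Proof.
split.
  rewrite (_ : monomial s = fun y : mvec R n => \prod_k y k 0 ^+ count_mem k s); last first.
    by apply: funext => y; rewrite monomialE.
  by apply: (measurable_prod_coord (g := fun k x => x ^+ count_mem k s)) => k; exact: exprn_measurable.
have /choice [C CP] (k : 'I_n) := monomial_std_pdf_gauss (count_mem k s).
exists (\prod_k C k) => y; rewrite monomialE /std_density -!big_split /= normr_prod.
by apply: ler_prod => k _; rewrite normr_ge0 (CP k).2.
Qed.

Definition moment n (s : seq 'I_n) : R := \prod_k std_moment (count_mem k s).

Lemma Ex_monomial n (s : seq 'I_n) : Ex (monomial s) = moment s.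
Proof.
apply: EFin_inj; rewrite -iint_tame; last exact: tame_monomial.
have := @iint_prod R n (fun k x => x ^+ count_mem k s * std_pdf x) 1.
rewrite mul1e => H; transitivity (\prod_k (std_moment (count_mem k s) : R)%:E)%E; last by rewrite prodEFin.
rewrite -(eq_bigr _ (fun k _ => integral_monomial_std_pdf (count_mem k s))) -H => [|k].
  by congr iint; apply: funext => y; rewrite mul1r big_split monomialE.
exact: integrable_monomial_std_pdf.
Qed.

Lemma moment_nil n : moment ([::] : seq 'I_n) = 1.
Proof. by rewrite /moment big1// => k _; rewrite std_moment0. Qed.

(** The first index is paired with each equal index in the tail; all these pairings leave the same
    moment, hence the factor [count_mem k s]. *)
Lemma moment_cons n (k : 'I_n) (s : seq 'I_n) :
  moment (k :: s) = (count_mem k s)%:R * moment (rem k s).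
Proof.
rewrite /moment (bigD1 k)//= [in RHS](bigD1 k)//= eqxx add1n std_momentS mulrA.
congr (_ * std_moment _ * _).
  by rewrite count_rem /= eqxx andbT; case: (boolP (k \in s)) => [_|/count_memPn ->];
      rewrite ?subn1.
apply: eq_bigr => l lk; congr std_moment.
rewrite eq_sym (negbTE lk) add0n count_rem /= eq_sym (negbTE lk).
by rewrite andbF subn0.
Qed.

Lemma moment2 n (k l : 'I_n) : moment [:: k; l] = (k == l)%:R.
Proof.
rewrite moment_cons /= addn0 (eq_sym l); case: eqVneq => _; last by rewrite mul0r.
by rewrite mul1r moment_nil.
Qed.

Lemma moment4 n (k l p q : 'I_n) : moment [:: k; l; p; q] =
  (k == l)%:R * (p == q)%:R + (k == p)%:R * (l == q)%:R + (k == q)%:R * (l == p)%:R.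
Proof.
rewrite moment_cons /= addn0 !(eq_sym k).
case: (eqVneq l k) => [->|lk]; case: (eqVneq p k) => [->|pk]; case: (eqVneq q k) => [->|qk];
  rewrite /= ?addn0 ?add0n ?mul0r ?add0r ?addr0 ?mul1r // ?moment2 ?eqxx.
- by rewrite !natrD mulr1 addrA.
- by rewrite eq_sym (negbTE qk) mulr0 addr0.
- by rewrite (negbTE pk) mulr0 addr0.
- by [].
- by rewrite natrD mulrDl mul1r.
- by [].
- by [].
Qed.

Lemma tame_sum n (I : finType) (f : I -> mvec R n -> R) : (forall i, tame (f i)) ->
  tame (fun y => \sum_i f i y) /\ Ex (fun y => \sum_i f i y) = \sum_i Ex (f i).
Proof.
move=> tf.
have t0 : tame (fun _ : mvec R n => 0 : R).
  by split; [exact: measurable_cst|exists 0 => y; rewrite !mul0r normr0].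
rewrite -[index_enum I]/(index_enum I); elim: (index_enum I) => [|i s [IHt IHE]].
  have -> : (fun y : mvec R n => \sum_(i <- [::]) f i y) = (fun _ => 0).
    by apply: funext => y; rewrite big_nil.
  split => //; rewrite big_nil /Ex.
  by under eq_integral do rewrite mul0r; rewrite integral0.
have -> : (fun y => \sum_(i <- i :: s) f i y) = (fun y => f i y + \sum_(i <- s) f i y).
  by apply: funext => y; rewrite big_cons.
by split; [exact: tameD|rewrite ExD// IHE big_cons].
Qed.

Definition quad n (F : 'M[R]_n) (y : 'cV[R]_n) : R := (y^T *m F *m y) 0 0.

Lemma quadE n (F : 'M[R]_n) (y : 'cV[R]_n) :
  quad F y = \sum_(kl : 'I_n * 'I_n) F kl.1 kl.2 * (y kl.1 0 * y kl.2 0).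
Proof.
rewrite /quad mxE -(pair_bigA _ (fun k l => F k l * (y k 0 * y l 0))) /= exchange_big.
apply: eq_bigr => l _; rewrite mxE mulr_suml; apply: eq_bigr => k _.
by rewrite mxE; ring.
Qed.

Lemma Ex_quad n (F : 'M[R]_n) : tame (quad F) /\ Ex (quad F) = \tr F.
Proof.
have -> : quad F = (fun y : mvec R n =>
    \sum_(kl : 'I_n * 'I_n) F kl.1 kl.2 * monomial [:: kl.1; kl.2] y).
  apply: funext => y; rewrite quadE; apply: eq_bigr => kl _.
  by rewrite /monomial !big_cons big_nil mulr1.
have [|t ->] := @tame_sum n _ (fun (kl : 'I_n * 'I_n) y => F kl.1 kl.2 * monomial [:: kl.1; kl.2] y).
  by move=> kl; apply: tameZ; exact: tame_monomial.
split => //; rewrite -(pair_bigA _ (fun k l => Ex (fun y => F k l * monomial [:: k; l] y))) /=.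
apply: eq_bigr => k _; rewrite (bigD1 k)//= big1 => [|l lk].
  by rewrite ExZ ?Ex_monomial ?moment2 ?eqxx ?mulr1 ?addr0//; exact: tame_monomial.
rewrite ExZ ?Ex_monomial ?moment2; last exact: tame_monomial.
by rewrite eq_sym (negbTE lk) mulr0.
Qed.

Lemma sum_delta n (G : 'M[R]_n) (k l : 'I_n) :
  \sum_p \sum_q G p q * ((k == p)%:R * (l == q)%:R) = G k l.
Proof.
rewrite (bigD1 k)//= [X in _ + X]big1 ?addr0 => [|p pk]; last first.
  by rewrite big1// => q _; rewrite eq_sym (negbTE pk) mul0r mulr0.
rewrite (bigD1 l)//= big1 ?addr0 => [|q ql]; first by rewrite !eqxx !mulr1.
by rewrite [l == q]eq_sym (negbTE ql) !mulr0.
Qed.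

Lemma sum_diag n (G : 'M[R]_n) : \sum_p \sum_q G p q * (p == q)%:R = \tr G.
Proof.
apply: eq_bigr => p _; rewrite (bigD1 p)//= big1 ?addr0 => [|q qp].
  by rewrite eqxx mulr1.
by rewrite eq_sym (negbTE qp) mulr0.
Qed.

Lemma Ex_quadM n (F G : 'M[R]_n) : G^T = G ->
  tame (fun y => quad F y * quad G y) /\
  Ex (fun y => quad F y * quad G y) =
    \tr F * \tr G + 2 * \sum_k \sum_l F k l * G k l.
Proof.
move=> symG.
have -> : (fun y => quad F y * quad G y) = (fun y : mvec R n =>
    \sum_(s : ('I_n * 'I_n) * ('I_n * 'I_n)) (F s.1.1 s.1.2 * G s.2.1 s.2.2) *
       monomial [:: s.1.1; s.1.2; s.2.1; s.2.2] y).
  apply: funext => y; rewrite !quadE mulr_suml.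
  under eq_bigr do rewrite mulr_sumr.
  rewrite pair_bigA /=; apply: eq_bigr => s _.
  by rewrite /monomial !big_cons big_nil; ring.
have [|t ->] := @tame_sum n _ (fun (s : ('I_n * 'I_n) * ('I_n * 'I_n)) y =>
    (F s.1.1 s.1.2 * G s.2.1 s.2.2) * monomial [:: s.1.1; s.1.2; s.2.1; s.2.2] y).
  by move=> kl; apply: tameZ; exact: tame_monomial.
split => //.
rewrite (eq_bigr (fun s : ('I_n * 'I_n) * ('I_n * 'I_n) => F s.1.1 s.1.2 * G s.2.1 s.2.2 *
    ((s.1.1 == s.1.2)%:R * (s.2.1 == s.2.2)%:R + (s.1.1 == s.2.1)%:R * (s.1.2 == s.2.2)%:R +
     (s.1.1 == s.2.2)%:R * (s.1.2 == s.2.1)%:R))); last first.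
  by move=> s _; rewrite ExZ ?Ex_monomial ?moment4//; exact: tame_monomial.
have inner k l : \sum_(pq : 'I_n * 'I_n) F k l * G pq.1 pq.2 *
    ((k == l)%:R * (pq.1 == pq.2)%:R + (k == pq.1)%:R * (l == pq.2)%:R +
     (k == pq.2)%:R * (l == pq.1)%:R) = F k l * (k == l)%:R * \tr G + 2 * (F k l * G k l).
  (* The two crossed pairings contribute equally because [G] is symmetric. *)
  have -> : 2 * (F k l * G k l) = F k l * G k l + F k l * G l k.
    have -> : G l k = G k l by rewrite -[in LHS]symG mxE.
    by ring.
  rewrite -[in RHS](sum_delta G k l) -[in RHS](sum_delta G l k) -[in RHS]sum_diag.
  rewrite !pair_bigA /= !mulr_sumr -!big_split /=; apply: eq_bigr => pq _; ring.
rewrite -(pair_bigA _ (fun kl pq : 'I_n * 'I_n => F kl.1 kl.2 * G pq.1 pq.2 *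
    ((kl.1 == kl.2)%:R * (pq.1 == pq.2)%:R + (kl.1 == pq.1)%:R * (kl.2 == pq.2)%:R +
     (kl.1 == pq.2)%:R * (kl.2 == pq.1)%:R))) /=.
rewrite (eq_bigr _ (fun kl _ => inner kl.1 kl.2)) big_split /= -mulr_suml -mulr_sumr.
rewrite -(pair_bigA _ (fun k l => F k l * (k == l)%:R)) sum_diag.
by rewrite -(pair_bigA _ (fun k l => F k l * G k l)).
Qed.

(* Isserlis' theorem for two quadratic forms. *)
Lemma Ex_quad_cov n (F G : 'M[R]_n) : G^T = G ->
  let f y := (quad F y - \tr F) * (quad G y - \tr G) in
  tame f /\ Ex f = 2 * \sum_k \sum_l F k l * G k l.
Proof.
move=> symG f; have [tF EF] := Ex_quad F; have [tG EG] := Ex_quad G.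
have [tFG EFG] := Ex_quadM F symG.
have t1 : tame (fun _ : mvec R n => 1 : R) /\ Ex (fun _ : mvec R n => 1 : R) = 1.
  have := tame_monomial ([::] : seq 'I_n); have := Ex_monomial ([::] : seq 'I_n).
  rewrite moment_nil (_ : monomial [::] = fun=> 1)//.
  by apply: funext => y; rewrite /monomial big_nil.
have -> : f = (fun y => quad F y * quad G y +
    ((- \tr G) * quad F y + ((- \tr F) * quad G y + (\tr F * \tr G) * 1))).
  by apply: funext => y; rewrite /f; ring.
have tA := tameZ (\tr F * \tr G) t1.1.
have tB := tameD (tameZ (- \tr F) tG) tA.
have tC := tameD (tameZ (- \tr G) tF) tB.
split; first exact: tameD.
rewrite !ExD// ?ExZ//; [|exact: t1.1|exact: tameZ|exact: tameZ].
by rewrite EFG EF EG t1.2; ring.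
Qed.

Lemma sqr_sum_le n (a : 'I_n -> R) : (\sum_k a k) ^+ 2 <= n%:R * \sum_k a k ^+ 2.
Proof.
have -> : n%:R * \sum_k a k ^+ 2 = \sum_k \sum_l (a k ^+ 2 + a l ^+ 2) / 2.
  pose s := \sum_l a l ^+ 2.
  rewrite [RHS](eq_bigr (fun k => 2^-1 * (n%:R * a k ^+ 2 + s))) => [|k _].
    rewrite -mulr_sumr big_split /= -mulr_sumr sumr_const card_ord -/s -mulr_natl; lra.
  rewrite -mulr_suml big_split /= sumr_const card_ord -/s -mulr_natl; lra.
rewrite expr2 mulr_suml; apply: ler_sum => k _; rewrite mulr_sumr; apply: ler_sum => l _.
by have := sqr_ge0 (a k - a l); lra.
Qed.

Lemma sqr_mulmx_le n (B : 'M[R]_n) :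
  exists2 M : R, 0 < M & forall y : 'cV[R]_n, \sum_k (B *m y) k 0 ^+ 2 <= M * \sum_k y k 0 ^+ 2.
Proof.
pose b := \sum_k \sum_l B k l ^+ 2.
have b0 : 0 <= b by apply: sumr_ge0 => k _; apply: sumr_ge0 => l _; exact: sqr_ge0.
(* Cauchy-Schwarz in each row gives the constant n times the sum of the squared entries; adding 1
   makes it positive. *)
exists (1 + n%:R * b); first by rewrite ltr_pwDl// mulr_ge0.
move=> y; pose s := \sum_l y l 0 ^+ 2.
have s0 : 0 <= s by apply: sumr_ge0 => l _; exact: sqr_ge0.
apply: (@le_trans _ _ (n%:R * b * s)); last by rewrite -/s mulrDl lerDr mul1r.
rewrite -mulrA /b mulr_suml mulr_sumr; apply: ler_sum => k _.
rewrite mxE; apply: le_trans (sqr_sum_le _) _; apply: ler_wpM2l => //.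
rewrite mulr_suml; apply: ler_sum => l _; rewrite exprMn ler_wpM2l ?sqr_ge0//.
by rewrite /s (bigD1 l)//= lerDl; apply: sumr_ge0 => j _; exact: sqr_ge0.
Qed.

(** The squared norm of x is at most M times that of A x, by the bound for [invmx A]; the envelope
    survives at the rate e / M. *)
Lemma dominated_mulmx n (f : mvec R n -> R) (A : 'M[R]_n) (e c : R) : A \in unitmx -> 0 < e ->
  dominated f e c -> exists2 e', 0 < e' & dominated (fun x => f (A *m x)) e' c.
Proof.
move=> uA e0 fe; have [M M0 BM] := sqr_mulmx_le (invmx A).
have c0 : 0 <= c.
  have := le_trans (normr_ge0 _) (fe 0); rewrite pmulr_lge0//.
  by apply: prodr_gt0 => k _; exact: expR_gt0.
exists (e / M); first exact: divr_gt0.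
move=> x; apply: le_trans (fe _) _; apply: ler_wpM2l => //.
rewrite -!expR_sum ler_expR -!mulr_sumr !mulNr lerN2 -mulrA ler_pM2l//.
by rewrite ler_pdivrMl//; have := BM (A *m x); rewrite mulKmx.
Qed.

End GaussianExpectation.

(** * The Fisher information and its square root *)

Section Fisher.
Context {R : realType}.

Lemma derive_line (V : normedModType R) (f : V -> R) (a v : V) (c : R) :
  is_derive (0 : R) 1 (fun t : R => f (a + t *: v)) c -> 'D_v f a = c.
Proof.
have E : (fun h : R => h^-1 *: ((f \o shift a) (h *: v) - f a)) =
    (fun h : R => h^-1 *: (((fun t : R => f (a + t *: v)) \o shift 0) (h *: (1 : R)) -
       f (a + (0 : R) *: v))).
  by apply: funext => h; rewrite /= scale0r !addr0 [h%:A]mulr1 (addrC a).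
by case=> _ <-; rewrite /derive E.
Qed.

Lemma unvechD m (x y : 'cV[R]_(symdim m)) : unvech (x + y) = unvech x + unvech y.
Proof.
by apply/matrixP => g h; rewrite !mxE -big_split; apply: eq_bigr => a _; rewrite mxE.
Qed.

Lemma unvechZ m (c : R) (x : 'cV[R]_(symdim m)) : unvech (c *: x) = c *: unvech x.
Proof.
by apply/matrixP => g h; rewrite !mxE mulr_sumr; apply: eq_bigr => a _; rewrite mxE.
Qed.

Lemma unvech_sym m (x : 'cV[R]_(symdim m)) : (unvech x)^T = unvech x.
Proof. by apply/matrixP => g h; rewrite !mxE; apply: eq_bigl => a; rewrite orbC. Qed.

Lemma unvechK m (x : 'cV[R]_(symdim m)) : vech (unvech x) = x.
Proof.
apply/colP => a; rewrite !mxE (big_pred1 a) // => b.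
have ab : (pair_of b == pair_of a) = (b == a).
  by apply/eqP/eqP => [/val_inj/enum_val_inj|->].
rewrite -surjective_pairing ab /=; apply/idP/idP => [/orP[//|/eqP ba]|-> //].
have le_a : ((pair_of a).1 <= (pair_of a).2)%N := valP (enum_val a).
have le_b : ((pair_of b).1 <= (pair_of b).2)%N := valP (enum_val b).
have e : (pair_of a).1 = (pair_of a).2.
  by apply/val_inj/eqP; rewrite eqn_leq le_a; rewrite ba in le_b.
by rewrite -ab ba -e {2}e -surjective_pairing.
Qed.

Definition congr_dir m (A : 'M[R]_m) (a : 'I_(symdim m)) : 'M[R]_m :=
  A *m unvech (delta_mx a 0) *m A^T.

Lemma congr_dir_sym m (A : 'M[R]_m) a : (congr_dir A a)^T = congr_dir A a.
Proof. by rewrite /congr_dir !trmx_mul trmxK unvech_sym mulmxA. Qed.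

Lemma score_normal m (A : 'M[R]_m) (a : 'I_(symdim m)) (x : 'cV[R]_m) : A \in unitmx ->
  score (fun theta => normal_density (unvech theta)) (vech (invmx (A^T *m A))) a x =
  (quad (congr_dir A a) (A *m x) - \tr (congr_dir A a)) / 2.
Proof.
move=> uA; apply: derive_line.
have -> : (fun t : R => ln (normal_density (unvech (vech (invmx (A^T *m A)) + t *: delta_mx a 0)) x))
  = (fun t : R => ln (normal_density (invmx (A^T *m A) + t *: unvech (delta_mx a 0)) x)).
  apply: funext => t; rewrite unvechD unvechZ vechK//.
  by rewrite trmx_inv trmx_mul trmxK.
exact: is_derive_ln_normal_density.
Qed.

(** The substitution y = A x turns the entry into a standard normal expectation: the two scores
    contribute 1/4 and Isserlis' theorem contributes 2. Domination is established in the variable x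
    as well, where the iterated integral is taken. *)
Lemma normal_fisherE m (A : 'M[R]_m) (a b : 'I_(symdim m)) : A \in unitmx ->
  normal_fisher (invmx (A^T *m A)) a b =
  (\sum_k \sum_l congr_dir A a k l * congr_dir A b k l) / 2.
Proof.
move=> uA; set F := congr_dir A a; set G := congr_dir A b.
pose f y := (quad F y - \tr F) * (quad G y - \tr G).
have [tf Ef] := Ex_quad_cov F (congr_dir_sym A b).
have {}tf := tameZ 4^-1 tf.
rewrite mxE; have -> : (fun x => (score (fun theta => normal_density (unvech theta))
    (vech (invmx (A^T *m A))) a x * score (fun theta => normal_density (unvech theta))
    (vech (invmx (A^T *m A))) b x * normal_density (unvech (vech (invmx (A^T *m A)))) x)%:E) =
    (fun x => (`|\det A| * (4^-1 * f (A *m x) * std_density (A *m x)))%:E).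
  apply: funext => x; rewrite !score_normal// vechK; last by rewrite trmx_inv trmx_mul trmxK.
  by rewrite normal_densityE// /f -/F -/G; congr EFin; field.
have [mf [c fc]] := tf.
have q0 : 0 < 4^-1 :> R by rewrite invr_gt0.
have [e e0 fAc] := dominated_mulmx uA q0 fc.
have mfA := measurableT_comp (tame_measurable tf) (measurable_mulmx A).
have mh : measurable_fun setT (fun x : mvec R m => `|\det A| * (4^-1 * f (A *m x) * std_density (A *m x))).
  by apply: measurable_funM => //; exact: mfA.
have hc : dominated (fun x : mvec R m => `|\det A| * (4^-1 * f (A *m x) * std_density (A *m x)))
    e (`|\det A| * c).
  by move=> x; rewrite normrM normr_id -[leRHS]mulrA; apply: ler_wpM2l => //; exact: fAc.
rewrite (iint_dominated e0 mh hc).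
have intA := dominated_integrable e0 mfA fAc.
under eq_integral do rewrite EFinM.
rewrite integralZl//.
transitivity (Ex (fun y => 4^-1 * f y)).
  by apply: (congr1 (@fine R) (y := (_)%:E));
    exact: etrans (integral_mulmx uA (tame_measurable tf) intA) (integral_tame tf).
rewrite ExZ; last by have [] := Ex_quad_cov F (congr_dir_sym A b).
by rewrite Ef; field.
Qed.

(** Half the sum over all ordered pairs counts an off-diagonal entry once and a diagonal entry with
    weight 1/2; the scale is the square root of this weight. *)
Definition fisher_scale m (a : 'I_(symdim m)) : R :=
  if (pair_of a).1 == (pair_of a).2 then (Num.sqrt 2)^-1 else 1.

(* The square root of the Fisher information: [fisher_root A z] lists the entries of
   [A *m unvech z *m A^T], those on the diagonal divided by sqrt 2. *)
Definition fisher_root m (A : 'M[R]_m) : 'M[R]_(symdim m) :=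
  \matrix_(a, b) (fisher_scale a * congr_dir A b (pair_of a).1 (pair_of a).2).

Lemma fisher_rootE m (A : 'M[R]_m) (z : 'cV[R]_(symdim m)) a :
  (fisher_root A *m z) a 0 =
  fisher_scale a * (A *m unvech z *m A^T) (pair_of a).1 (pair_of a).2.
Proof.
have zE : z = \sum_b z b 0 *: delta_mx b 0.
  apply/colP => c; rewrite summxE (bigD1 c)//= big1 => [|b bc]; first by rewrite !mxE !eqxx mulr1 addr0.
  by rewrite !mxE eq_sym (negbTE bc) mulr0.
have uE : unvech z = \sum_b z b 0 *: unvech (delta_mx b 0).
  rewrite {1}zE (big_morph _ (@unvechD m) (_ : unvech 0 = 0)).
    by apply: eq_bigr => b _; rewrite unvechZ.
  by rewrite -(scale0r (0 : 'cV[R]_(symdim m))) unvechZ scale0r.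
rewrite uE mulmx_sumr mulmx_suml summxE mulr_sumr mxE; apply: eq_bigr => b _.
rewrite -scalemxAr -scalemxAl [in RHS]mxE [in LHS]mxE /congr_dir.
by move: (A *m _ *m _) => M; ring.
Qed.

Lemma fisher_scale_sqr m (a : 'I_(symdim m)) :
  fisher_scale a ^+ 2 = if (pair_of a).1 == (pair_of a).2 then 2^-1 else 1.
Proof. by rewrite /fisher_scale; case: ifP => _; rewrite ?expr1n// exprVn sqr_sqrtr. Qed.

Lemma sum_sympair m (f : 'I_m -> 'I_m -> R) : (forall g h, f g h = f h g) ->
  \sum_(a < symdim m) fisher_scale a ^+ 2 * f (pair_of a).1 (pair_of a).2 =
  (\sum_g \sum_h f g h) / 2.
Proof.
move=> fsym; under eq_bigr do rewrite fisher_scale_sqr.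
pose w (p : 'I_m * 'I_m) := (if p.1 == p.2 then 2^-1 else 1) * f p.1 p.2.
rewrite -[LHS]/(\sum_(a < symdim m) w (val (enum_val a))).
rewrite -(@big_enum_val _ _ _ (sympair m) {: sympair m} (fun p => w (val p))).
have -> : \sum_(p in {: sympair m}) w (val p) = \sum_(p : 'I_m * 'I_m | (p.1 <= p.2)%N) w p.
  apply/esym; apply: etrans (big_sub [pred p : 'I_m * 'I_m | (p.1 <= p.2)%N] w) _.
  by apply: eq_bigl => p; rewrite inE.
rewrite pair_bigA /=.
rewrite [RHS](_ : _ = (\sum_(p : 'I_m * 'I_m | (p.1 <= p.2)%N) f p.1 p.2 +
   \sum_(p : 'I_m * 'I_m | (p.1 < p.2)%N) f p.1 p.2) / 2); last first.
  congr (_ / _); rewrite (bigID (fun p : 'I_m * 'I_m => (p.1 <= p.2)%N)) /=; congr (_ + _).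
  rewrite (reindex_inj (h := fun p : 'I_m * 'I_m => (p.2, p.1))) /=; last by move=> [a b] [c d] [-> ->].
  by apply: eq_big => p; rewrite -?ltnNge// => _; exact: fsym.
rewrite big_mkcond [in RHS]big_mkcond [X in _ + X]big_mkcond -big_split mulr_suml /=.
apply: eq_bigr => -[g h] _ /=; rewrite /w /=; case: ltngtP => [gh|gh|/val_inj ->] /=.
- rewrite -val_eqE (ltn_eqF gh); lra.
- by rewrite addr0 mul0r.
- rewrite eqxx; lra.
Qed.

Lemma normal_fisher_root m (A : 'M[R]_m) : A \in unitmx ->
  normal_fisher (invmx (A^T *m A)) = (fisher_root A)^T *m fisher_root A.
Proof.
move=> uA; apply/matrixP => a b; rewrite normal_fisherE// -sum_sympair; last first.
  by move=> g h; rewrite -[in LHS](congr_dir_sym A a) -[in LHS](congr_dir_sym A b) !mxE.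
by rewrite mxE; apply: eq_bigr => c _; rewrite !mxE; ring.
Qed.

Lemma fisher_scale_neq0 m (a : 'I_(symdim m)) : fisher_scale a != 0.
Proof.
rewrite /fisher_scale; case: ifP => _; last exact: oner_neq0.
by rewrite invr_eq0 gt_eqF// sqrtr_gt0.
Qed.

Lemma sym_entry m (M : 'M[R]_m) g h : M^T = M -> M g h = M h g.
Proof. by move=> symM; rewrite -[in LHS]symM mxE. Qed.

Lemma congr_sym m (A M : 'M[R]_m) : M^T = M -> (A *m M *m A^T)^T = A *m M *m A^T.
Proof. by move=> symM; rewrite !trmx_mul trmxK symM mulmxA. Qed.

Lemma pair_of_surj m (g h : 'I_m) : (g <= h)%N -> exists a, pair_of a = (g, h).
Proof.
by move=> gh; exists (enum_rank (exist _ (g, h) gh : sympair m)); rewrite /pair_of enum_rankK.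
Qed.

Lemma pair_of_le m (a : 'I_(symdim m)) : ((pair_of a).1 <= (pair_of a).2)%N.
Proof. exact: valP (enum_val a). Qed.

Lemma pair_of_inj m : injective (@pair_of m).
Proof. by move=> a b /val_inj/enum_val_inj. Qed.

Lemma sym_eq0 m (M : 'M[R]_m) : M^T = M ->
  (forall a : 'I_(symdim m), M (pair_of a).1 (pair_of a).2 = 0) -> M = 0.
Proof.
move=> symM M0; apply/matrixP => g h; rewrite mxE.
wlog gh : g h / (g <= h)%N.
  by move=> wl; case: (leqP g h) => [/wl //|/ltnW/wl]; rewrite sym_entry.
by have [a aE] := pair_of_surj gh; have := M0 a; rewrite aE.
Qed.

Lemma fisher_root_unit m (A : 'M[R]_m) : A \in unitmx -> fisher_root A \in unitmx.
Proof.
move=> uA; rewrite -unitmx_tr -row_free_unit; apply: inj_row_free => v vK.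
have {vK} : fisher_root A *m v^T = 0 by rewrite -[LHS]trmxK trmx_mul trmxK vK trmx0.
move: (v^T) (trmxK v) => z <- Kz {v}; suff -> : z = 0 by rewrite trmx0.
have N0 : A *m unvech z *m A^T = 0.
  apply: sym_eq0 => [|a]; first exact/congr_sym/unvech_sym.
  have : (fisher_root A *m z) a 0 = 0 by rewrite Kz mxE.
  rewrite fisher_rootE => /eqP.
  by rewrite mulf_eq0 (negbTE (fisher_scale_neq0 a)) => /eqP.
rewrite -[LHS]unvechK; have -> : unvech z = 0.
  rewrite -[LHS](mulKmx uA) -[X in _ *m X](mulmxK (_ : A^T \in unitmx)) ?unitmx_tr//.
  by rewrite N0 mul0mx mulmx0.
by apply/colP => a; rewrite !mxE.
Qed.

Lemma sq_mahalanobisE m (A : 'M[R]_m) (z s : 'cV[R]_(symdim m)) : A \in unitmx ->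
  sq_mahalanobis (normal_fisher (invmx (A^T *m A))) z s =
  \sum_a ((fisher_root A *m z) a 0 - (fisher_root A *m s) a 0) ^+ 2.
Proof.
move=> uA; rewrite /sq_mahalanobis normal_fisher_root// mulmxA -trmx_mul -mulmxA mxE.
by apply: eq_bigr => a _; rewrite [in LHS]mxE -expr2 mulmxBr !mxE.
Qed.

End Fisher.

(** * Polynomials along lines and parabolas *)

Section MpolyCurves.
Import -(notations) mpoly.
Context {R : realType}.

Lemma mevalv_mshift k (theta x : 'cV[R]_k) (f : mpoly k R) :
  mevalv (mshift theta f) x = mevalv f (x + theta).
Proof.
rewrite /mevalv /mshift comp_mpoly_meval; apply: meval_eq => i.
by rewrite tnth_mktuple mevalD mevalXU mevalC mxE.
Qed.

Lemma mevalv_pihomogZ k e (f : mpoly k R) (t : R) (x : 'cV[R]_k) :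
  mevalv (pihomog (@mdeg k) e f) (t *: x) = t ^+ e * mevalv (pihomog (@mdeg k) e f) x.
Proof.
rewrite /mevalv !mevalE mulr_sumr big_seq [RHS]big_seq; apply: eq_bigr => m mf.
have /dhomogP/(_ m mf) /= <- := pihomogP (@mdeg k) e f.
rewrite mulrCA mdegE; congr (_ * _); rewrite expr_sum -big_split /=.
by apply: eq_bigr => i _; rewrite mxE exprMn.
Qed.

Definition curve_poly k (c : 'I_k -> {poly R}) (f : mpoly k R) : {poly R} := mmap polyC c f.

Lemma curve_polyE k (c : 'I_k -> {poly R}) (f : mpoly k R) t :
  (curve_poly c f).[t] = mevalv f (\col_i (c i).[t]).
Proof.
rewrite /curve_poly /mevalv mevalE /mmap horner_sum; apply: eq_bigr => m _.
rewrite hornerM hornerC; congr (_ * _).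
rewrite /mmap1 horner_prod; apply: eq_bigr => i _.
by rewrite horner_exp mxE.
Qed.

Lemma poly_eq0_gt (p : {poly R}) (t0 : R) : (forall t, t0 < t -> p.[t] = 0) -> p = 0.
Proof.
move=> p0; apply/eqP; apply: contraT => pn0.
have := max_poly_roots (rs := [seq t0 + 1 + i%:R | i <- iota 0 (size p)]) pn0.
rewrite size_map size_iota ltnn; apply.
  by apply/allP => _ /mapP[i _ ->]; apply/rootP/p0; rewrite -addrA ltrDl ltr_pwDl.
by rewrite map_inj_uniq ?iota_uniq// => i j /addrI/eqP; rewrite eqr_nat => /eqP.
Qed.

(** Restricted to the line, [f] is a univariate polynomial with infinitely many roots. This is the
    only passage to a Zariski closure in the proof. *)
Lemma mevalv_line_eq0 k (f : mpoly k R) (x y : 'cV[R]_k) (t0 : R) :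
  (forall t, t0 < t -> mevalv f (x + t *: y) = 0) -> forall t, mevalv f (x + t *: y) = 0.
Proof.
move=> f0; pose c i : {poly R} := (x i 0)%:P + 'X * (y i 0)%:P.
have cE t : mevalv f (x + t *: y) = (curve_poly c f).[t].
  rewrite curve_polyE; congr mevalv; apply/colP => i.
  by rewrite !mxE /c hornerD hornerM hornerX !hornerC.
have p0 : curve_poly c f = 0 by apply: (@poly_eq0_gt _ t0) => t /f0; rewrite cE.
by move=> t; rewrite cE p0 horner0.
Qed.

(** Along the parabola the shifted polynomial is evaluated at t (tau + t q), which gives t^e P(t)
    where P(0) is the value of the lowest form at [tau]. The acceleration [q] drops out at t = 0. *)
Lemma lowest_form_parabola k (f g : mpoly k R) (theta tau q : 'cV[R]_k) :
  is_lowest_form (mshift theta f) g ->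
  (forall t : R, mevalv f (theta + t *: tau + t ^+ 2 *: q) = 0) -> mevalv g tau = 0.
Proof.
move=> [e [-> _ lowe]] f0; set h := mshift theta f in lowe *.
(* Large enough to contain all homogeneous components, and the index [e] in particular. *)
pose N := maxn (msize h) e.+1.
pose c i : {poly R} := (tau i 0)%:P + 'X * (q i 0)%:P.
have cE (p : mpoly k R) t : mevalv p (tau + t *: q) = (curve_poly c p).[t].
  rewrite curve_polyE; congr mevalv; apply/colP => i.
  by rewrite !mxE /c hornerD hornerM hornerX !hornerC.
pose P : {poly R} := \sum_(d < N | (e <= d)%N) 'X^(d - e) * curve_poly c (pihomog (@mdeg k) d h).
have PE t : mevalv h (t *: (tau + t *: q)) = t ^+ e * P.[t].
  rewrite [in LHS](pihomog_partitionE (mf := @mdeg k) (k := N) (p := h)); last exact: leq_maxl.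
  rewrite /mevalv raddf_sum /= horner_sum mulr_sumr (bigID (fun d : 'I_N => (e <= d)%N)) /=.
  rewrite [X in _ + X]big1 ?addr0 => [|d]; last first.
    by rewrite -ltnNge => /lowe ->; rewrite meval0.
  apply: eq_bigr => d ed; rewrite -[meval _ _]/(mevalv _ _) mevalv_pihomogZ cE.
  by rewrite hornerM hornerXn mulrA -exprD subnKC.
have P0 : P = 0.
  apply: (@poly_eq0_gt _ 0) => t t0; apply/eqP.
  have te : t ^+ e != 0 by rewrite expf_neq0// gt_eqF.
  have : t ^+ e * P.[t] == 0.
    rewrite -PE mevalv_mshift addrC scalerDr addrA scalerA -expr2.
    by rewrite f0.
  by rewrite mulf_eq0 (negbTE te).
have : P.[0] = 0 by rewrite P0 horner0.
have eN : (e < N)%N by rewrite /N leq_max ltnSn orbT.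
rewrite horner_sum (bigD1 (Ordinal eN))//= big1 ?addr0 => [|d /andP[ed dne]].
  by rewrite subnn expr0 mul1r -cE scale0r addr0.
have de : (0 < d - e)%N.
  by rewrite subn_gt0 ltn_neqAle ed andbT eq_sym; apply: contraNneq dne => de; apply/eqP/val_inj.
by rewrite hornerM hornerXn expr0n -[_ == 0]negbK -lt0n de mul0r.
Qed.

End MpolyCurves.

(** * The algebraic tangent cone of the one-factor model *)

Section TangentCone.
Context {R : realType}.
Import -(notations) mpoly.

Lemma vechD m (M N : 'M[R]_m) : vech (M + N) = vech M + vech N.
Proof. by apply/colP => a; rewrite !mxE. Qed.

Lemma vechZ m (c : R) (M : 'M[R]_m) : vech (c *: M) = c *: vech M.
Proof. by apply/colP => a; rewrite !mxE. Qed.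

(** A positive [kappa] is absorbed into the loadings through its square root. The signs of [d] and
    then of [kappa] are freed by extending from a ray to a line, along the identity matrix and along
    [gam *m gam^T]. *)
Lemma vanishing_factor m (f : mpoly (symdim m) R) (d : 'rV[R]_m) (kappa : R) (gam : 'cV[R]_m) :
  vanishing_ideal (@vech R m @` @one_factor R m) f ->
  mevalv f (vech (diag_mx d + kappa *: (gam *m gam^T))) = 0.
Proof.
move=> f0.
have pos (e : 'rV[R]_m) (k : R) (c : 'cV[R]_m) : (forall g, 0 < e 0 g) -> 0 < k ->
    mevalv f (vech (diag_mx e + k *: (c *m c^T))) = 0.
  move=> e0 k0; apply: f0; eexists; last reflexivity.
  exists e, (Num.sqrt k *: c); split => //; congr (_ + _).
  rewrite linearZ /= -scalemxAl -scalemxAr scalerA -expr2 sqr_sqrtr//.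
  exact: ltW.
have posk (k : R) (c : 'cV[R]_m) : 0 < k -> mevalv f (vech (diag_mx d + k *: (c *m c^T))) = 0.
  move=> k0; pose x := vech (diag_mx d + k *: (c *m c^T)).
  pose y := vech (diag_mx (const_mx 1 : 'rV[R]_m)).
  have := @mevalv_line_eq0 R _ f x y (\sum_g `|d 0 g|).
  move=> /(_ _ 0); rewrite scale0r addr0; apply => t td.
  rewrite /x /y -vechZ -vechD addrAC -linearZ -linearD /=.
  apply: (pos (d + t *: const_mx 1) k c) => // g; rewrite !mxE mulr1.
  have : `|d 0 g| <= \sum_g `|d 0 g| by rewrite (bigD1 g)//= lerDl sumr_ge0.
  by have := ler_norm (- d 0 g); rewrite normrN; lra.
rewrite vechD vechZ.
apply: (@mevalv_line_eq0 R _ f (vech (diag_mx d)) (vech (gam *m gam^T)) 0) => t t0.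
by rewrite -vechZ -vechD posk.
Qed.

(* If the off-diagonal parts of [S0] and [S] are the zeroth and first order terms of
   [kappa (a + t b)(a + t b)^T], the parabola through [S0] with velocity [S] and acceleration
   [kappa b b^T] stays in the Zariski closure of the model: diagonals are unconstrained there. *)
Lemma factor_tangent m (S0 S : 'M[R]_m) (kappa : R) (a b : 'cV[R]_m)
    (f g : mpoly (symdim m) R) :
  (forall k l, k != l -> S0 k l = kappa * (a k 0 * a l 0)) ->
  (forall k l, k != l -> S k l = kappa * (a k 0 * b l 0 + b k 0 * a l 0)) ->
  vanishing_ideal (@vech R m @` @one_factor R m) f ->
  is_lowest_form (mshift (vech S0) f) g -> mevalv g (vech S) = 0.
Proof.
move=> S0E SE f0 lowg.
apply: (lowest_form_parabola (q := vech (kappa *: (b *m b^T))) lowg) => t.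
rewrite -!vechZ -!vechD; pose c := a + t *: b.
pose d : 'rV[R]_m := \row_k (S0 k k + t * S k k + t ^+ 2 * (kappa * b k 0 ^+ 2) - kappa * c k 0 ^+ 2).
have -> : S0 + t *: S + t ^+ 2 *: (kappa *: (b *m b^T)) = diag_mx d + kappa *: (c *m c^T).
  apply/matrixP => k l; rewrite !mxE !big_ord1 !mxE.
  have [->|kl] := eqVneq k l; first by rewrite mulr1n; ring.
  by rewrite mulr0n S0E// SE//; ring.
exact: vanishing_factor.
Qed.

Definition cone_spec m (i j : 'I_m) (S : 'M[R]_m) :=
  (forall k l, k != l -> k \notin [:: i; j] -> l \notin [:: i; j] -> S k l = 0) /\
  (forall k l, k \notin [:: i; j] -> l \notin [:: i; j] -> S i k * S j l = S i l * S j k).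

Lemma rank_one_columns m (i j : 'I_m) (S : 'M[R]_m) : cone_spec i j S ->
  exists (u1 u2 : R) (w : 'I_m -> R), forall k, k \notin [:: i; j] ->
    S i k = u1 * w k /\ S j k = u2 * w k.
Proof.
move=> [_ minor].
have [[k kij /orP kn0]|all0] := pselect (exists2 k, k \notin [:: i; j] & (S i k != 0) || (S j k != 0)).
  (* The nonzero column [k] is the pivot; the weights are quotients by whichever of its entries is
     nonzero. *)
  exists (S i k), (S j k), (fun l => if S i k != 0 then S i l / S i k else S j l / S j k).
  move=> l lij; case: ifPn => [n0|z0].
    split; first by field.
    by apply: (mulfI n0); rewrite (minor _ _ kij lij); field.
  have {}kn0 : S j k != 0 by case: kn0 => //; rewrite (negbTE z0).
  move: z0; rewrite negbK => /eqP z0.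
  have := minor _ _ kij lij; rewrite z0 mul0r => /esym/eqP; rewrite mulf_eq0 (negbTE kn0) orbF => /eqP ->.
  by split; [rewrite mul0r|rewrite mulrC divfK].
exists 1, 1, (fun=> 0) => k kij; rewrite mulr0.
by split; apply/eqP/contraT => n0; case: all0; exists k => //; rewrite n0 ?orbT.
Qed.

Lemma cone_spec_sub m (S0 : 'M[R]_m) (i j : 'I_m) (S : 'M[R]_m) :
  i != j -> S0^T = S0 -> S0 i j != 0 ->
  (forall k l, k != l -> ~~ [&& k \in [:: i; j] & l \in [:: i; j]] -> S0 k l = 0) ->
  S^T = S -> cone_spec i j S ->
  algebraic_tangent_cone (@vech R m @` @one_factor R m) (vech S0) (vech S).
Proof.
move=> ij symS0 c0 S0off symS coneS f g _ f0 lowg.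
have [u1 [u2 [w uw]]] := rank_one_columns coneS; have [Sout _] := coneS.
pose w' k := if k \in [:: i; j] then 0 else w k.
(* Adding [e *: S'] replaces the row weights [u1], [u2] of the block by [u1 + e], [u2 + e] and
   leaves the entry (i, j) and the diagonal unchanged. For large [e] both weights are nonzero, and
   the conclusion returns to [e = 0] along the line. *)
pose S' : 'M[R]_m := \matrix_(k, l)
  (if (k \in [:: i; j]) then w' l else if l \in [:: i; j] then w' k else 0).
rewrite -[vech S]addr0 -(scale0r (vech S')).
apply: (@mevalv_line_eq0 R _ g (vech S) (vech S') (`|u1| + `|u2|)) => e eu.
have v1 : u1 + e != 0.
  by rewrite gt_eqF//; have := ler_norm (- u1); rewrite normrN; have := normr_ge0 u2; lra.
have v2 : u2 + e != 0.
  by rewrite gt_eqF//; have := ler_norm (- u2); rewrite normrN; have := normr_ge0 u1; lra.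
rewrite -vechZ -vechD.
(* Forced by the requirement that kappa a_i a_j be [S0 i j]; it may be negative. *)
pose kappa := S0 i j / ((u1 + e) * (u2 + e)).
have k0 : kappa != 0 by rewrite mulf_neq0// invr_neq0// mulf_neq0.
pose a : 'cV[R]_m := \col_k (if k == i then u1 + e else if k == j then u2 + e else 0).
(* The weights w / kappa produce the block. Since b_j = 0, the entry (i, j) of the velocity is kappa
   b_i a_j, which determines b_i. *)
pose b : 'cV[R]_m := \col_k (if k == i then (u1 + e) * S i j / S0 i j else w' k / kappa).
have ji : (j == i) = false by rewrite eq_sym (negbTE ij).
have iin : i \in [:: i; j] by rewrite inE eqxx.
have jin : j \in [:: i; j] by rewrite !inE eqxx orbT.
have w'i : w' i = 0 by rewrite /w' iin.
have w'j : w' j = 0 by rewrite /w' jin.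
have w'out k : k \notin [:: i; j] -> w' k = w k by rewrite /w' => /negbTE ->.
have notin k : k != i -> k != j -> k \notin [:: i; j] by move=> ki kj; rewrite !inE negb_or ki.
apply: (@factor_tangent m S0 _ kappa a b f g) => // k l kl; rewrite !mxE.
  move: kl; have [->|ki] := eqVneq k i; [|have [->|kj] := eqVneq k j];
    (have [->|li] := eqVneq l i; [|have [->|lj] := eqVneq l j]); rewrite ?ji ?eqxx //= => kl.
  - by rewrite /kappa; field; rewrite ?v1 ?v2 ?c0.
  - by rewrite S0off 1?eq_sym// ?(negbTE (notin l li lj)) ?andbF// !mulr0.
  - by rewrite (sym_entry j i symS0) /kappa; field; rewrite ?v1 ?v2 ?c0.
  - by rewrite S0off 1?eq_sym// ?(negbTE (notin l li lj)) ?andbF// !mulr0.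
  - by rewrite S0off// ?(negbTE (notin k ki kj))// mul0r mulr0.
  - by rewrite S0off// ?(negbTE (notin k ki kj))// mul0r mulr0.
  - by rewrite S0off// ?(negbTE (notin k ki kj))// mul0r mulr0.
move: kl; have [->|ki] := eqVneq k i; [|have [->|kj] := eqVneq k j];
  (have [->|li] := eqVneq l i; [|have [->|lj] := eqVneq l j]); rewrite ?ji ?eqxx //= => kl;
  rewrite ?iin ?jin ?w'i ?w'j.
- by rewrite /kappa; field; rewrite ?v1 ?v2 ?c0.
- by have lij := notin l li lj; rewrite w'out// (uw l lij).1; field; rewrite ?k0 ?c0 ?v1 ?v2.
- by rewrite (sym_entry j i symS) /kappa; field; rewrite ?v1 ?v2 ?c0.
- by have lij := notin l li lj; rewrite w'out// (uw l lij).2; field; rewrite ?k0 ?c0 ?v1 ?v2.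
- have kij := notin k ki kj.
  by rewrite (negbTE kij) w'out// (sym_entry k i symS) (uw k kij).1; field; rewrite ?k0 ?c0 ?v1 ?v2.
- have kij := notin k ki kj.
  by rewrite (negbTE kij) w'out// (sym_entry k j symS) (uw k kij).2; field; rewrite ?k0 ?c0 ?v1 ?v2.
- have kij := notin k ki kj; have lij := notin l li lj.
  by rewrite (negbTE kij) (negbTE lij) Sout//; ring.
Qed.

Definition tetrad k (a b c d : 'I_k) : mpoly k R :=
  mpolyX R (mnm1 a) * mpolyX R (mnm1 b) - mpolyX R (mnm1 c) * mpolyX R (mnm1 d).

(** The linear part of the tetrad at [theta]. *)
Definition tetrad_form k (theta : 'cV[R]_k) (a b c d : 'I_k) : mpoly k R :=
  theta a 0 *: mpolyX R (mnm1 b) + theta b 0 *: mpolyX R (mnm1 a)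
  - theta c 0 *: mpolyX R (mnm1 d) - theta d 0 *: mpolyX R (mnm1 c).

Lemma mevalv_tetrad k (x : 'cV[R]_k) (a b c d : 'I_k) :
  mevalv (tetrad a b c d) x = x a 0 * x b 0 - x c 0 * x d 0.
Proof. by rewrite /mevalv mevalB !mevalM !mevalXU. Qed.

Lemma mevalv_tetrad_form k (theta x : 'cV[R]_k) (a b c d : 'I_k) :
  mevalv (tetrad_form theta a b c d) x =
  theta a 0 * x b 0 + theta b 0 * x a 0 - theta c 0 * x d 0 - theta d 0 * x c 0.
Proof. by rewrite /mevalv !mevalB mevalD !mevalZ !mevalXU. Qed.

Lemma mshift_tetrad k (theta : 'cV[R]_k) (a b c d : 'I_k) :
  theta a 0 * theta b 0 = theta c 0 * theta d 0 ->
  mshift theta (tetrad a b c d) = tetrad_form theta a b c d + tetrad a b c d.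
Proof.
move=> th0; rewrite /mshift /tetrad /tetrad_form raddfB /= !rmorphM /= !comp_mpolyXU.
rewrite -!tnth_nth !tnth_mktuple -!mul_mpolyC.
have : mpolyC k (theta a 0) * mpolyC k (theta b 0) = mpolyC k (theta c 0) * mpolyC k (theta d 0).
  by rewrite -!mpolyCM th0.
by move: (mpolyX R _) (mpolyX R _) (mpolyX R _) (mpolyX R _) (mpolyC k _) (mpolyC k _)
  (mpolyC k _) (mpolyC k _) => x y z w p q r s pq; ring: pq.
Qed.

Lemma pihomog_tetrad k e (a b c d : 'I_k) :
  pihomog (@mdeg k) e (tetrad a b c d) = if e == 2 then tetrad a b c d else 0.
Proof.
rewrite raddfB /= -!mpolyXD !pihomogX /= !mdegD !mdeg1 eq_sym.
by rewrite addn1; case: ifP => _; rewrite ?subr0// /tetrad -!mpolyXD.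
Qed.

Lemma pihomog_tetrad_form k e (theta : 'cV[R]_k) (a b c d : 'I_k) :
  pihomog (@mdeg k) e (tetrad_form theta a b c d) =
  if e == 1 then tetrad_form theta a b c d else 0.
Proof.
rewrite !raddfB !raddfD /= !linearZ /= !pihomogX /= !mdeg1 eq_sym.
by case: ifP => _; rewrite ?oppr0 !(scaler0, scalerN) ?addr0.
Qed.

(** A nonzero linear part is the lowest form, since the constant term cancels at a point where the
    tetrad vanishes; a zero linear part makes the claim trivial. *)
Lemma tangent_tetrad_form k (Theta : set 'cV[R]_k) (theta tau : 'cV[R]_k) (a b c d : 'I_k) :
  algebraic_tangent_cone Theta theta tau -> vanishing_ideal Theta (tetrad a b c d) ->
  theta a 0 * theta b 0 = theta c 0 * theta d 0 ->
  mevalv (tetrad_form theta a b c d) tau = 0.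
Proof.
move=> cone_tau van th0; have [->|g0] := eqVneq (tetrad_form theta a b c d) 0.
  exact: meval0.
have hE e : pihomog (@mdeg k) e (mshift theta (tetrad a b c d)) =
    (if e == 1 then tetrad_form theta a b c d else 0) + (if e == 2 then tetrad a b c d else 0).
  by rewrite mshift_tetrad// raddfD /= pihomog_tetrad pihomog_tetrad_form.
apply: (cone_tau (tetrad a b c d)) => //.
  apply: contraNneq g0 => f0; have := hE 1%N; rewrite f0 /= addr0 => <-.
  by rewrite /mshift raddf0 raddf0.
by exists 1%N; split => [|//|[|//] _]; rewrite hE /= addr0.
Qed.

Lemma tangent_tetrad k (Theta : set 'cV[R]_k) (theta tau : 'cV[R]_k) (a b c d : 'I_k) :
  algebraic_tangent_cone Theta theta tau -> vanishing_ideal Theta (tetrad a b c d) ->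
  [/\ theta a 0 = 0, theta b 0 = 0, theta c 0 = 0 & theta d 0 = 0] ->
  mevalv (tetrad a b c d) tau = 0.
Proof.
move=> cone_tau van [a0 b0 c0 d0]; have [->|f0] := eqVneq (tetrad a b c d) 0.
  exact: meval0.
apply: (cone_tau (tetrad a b c d)) => //.
rewrite mshift_tetrad ?a0 ?c0 ?mul0r//.
have -> : tetrad_form theta a b c d = 0 by rewrite /tetrad_form a0 b0 c0 d0 !scale0r !subr0 addr0.
by rewrite add0r; exists 2%N; split => [|//|[|[|//]] _]; rewrite pihomog_tetrad.
Qed.

Lemma sym_index m (g h : 'I_m) :
  exists a : 'I_(symdim m), forall M : 'M[R]_m, M^T = M -> vech M a 0 = M g h.
Proof.
have [gh|hg] := leqP g h.
  by have [a aE] := pair_of_surj gh; exists a => M symM; rewrite mxE aE.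
by have [a aE] := pair_of_surj (ltnW hg); exists a => M symM; rewrite mxE aE; apply: sym_entry.
Qed.

Lemma one_factor_sym m (S : 'M[R]_m) : one_factor S -> S^T = S.
Proof.
by move=> [d [g [_ ->]]]; rewrite linearD /= tr_diag_mx trmx_mul trmxK.
Qed.

(** The four inequalities keep all entries off the diagonal, where the matrix coincides with the
    rank-one matrix [c *m c^T]. *)
Lemma one_factor_tetrad m (S : 'M[R]_m) g h k l : one_factor S ->
  g != h -> k != l -> g != k -> h != l -> S g h * S k l = S g k * S h l.
Proof.
move=> [d [c [_ ->]]] /negbTE gh /negbTE kl /negbTE gk /negbTE hl.
by rewrite !mxE !big_ord1 !mxE gh kl gk hl !mulr0n; ring.
Qed.

Lemma cone_spec_of_tangent m (S0 : 'M[R]_m) (i j : 'I_m) (tau : 'cV[R]_(symdim m)) :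
  i != j -> S0^T = S0 -> S0 i j != 0 ->
  (forall k l, k != l -> ~~ [&& k \in [:: i; j] & l \in [:: i; j]] -> S0 k l = 0) ->
  algebraic_tangent_cone (@vech R m @` @one_factor R m) (vech S0) tau ->
  cone_spec i j (unvech tau).
Proof.
move=> ij symS0 c0 S0off cone_tau.
have symtau := unvech_sym tau.
have tauE a g h : (forall M : 'M[R]_m, M^T = M -> vech M a 0 = M g h) ->
    tau a 0 = unvech tau g h.
  by move=> aE; rewrite -[in LHS](unvechK tau) aE.
have van g h k l a b c d : g != h -> k != l -> g != k -> h != l ->
    (forall M : 'M[R]_m, M^T = M -> vech M a 0 = M g h) ->
    (forall M : 'M[R]_m, M^T = M -> vech M b 0 = M k l) ->
    (forall M : 'M[R]_m, M^T = M -> vech M c 0 = M g k) ->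
    (forall M : 'M[R]_m, M^T = M -> vech M d 0 = M h l) ->
    vanishing_ideal (@vech R m @` @one_factor R m) (tetrad a b c d).
  move=> gh kl gk hl aE bE cE dE _ [M M1 <-]; have symM := one_factor_sym M1.
  by rewrite mevalv_tetrad aE// bE// cE// dE// (one_factor_tetrad M1)// subrr.
have out_i k : k \notin [:: i; j] -> i != k.
  by rewrite !inE negb_or eq_sym => /andP[].
have out_j k : k \notin [:: i; j] -> j != k.
  by rewrite !inE negb_or eq_sym => /andP[_]; rewrite eq_sym.
have S00 k l : k \notin [:: i; j] -> k != l -> S0 k l = 0.
  by move=> kij kl; apply: S0off; rewrite // (negbTE kij).
split=> [k l kl kij lij|k l kij lij].
  (* In the tetrad on (i, j), (k, l) against (i, k), (j, l) only the entry (i, j) of [S0] is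
     nonzero, so the linear part is [S0 i j] times the entry (k, l) of the tangent vector. *)
  have [a aE] := sym_index i j; have [b bE] := sym_index k l.
  have [c cE] := sym_index i k; have [d dE] := sym_index j l.
  have th0 : [/\ vech S0 b 0 = 0, vech S0 c 0 = 0 & vech S0 d 0 = 0].
    rewrite bE// cE// dE// S00// (sym_entry i k)// (sym_entry j l)//.
    by rewrite !S00// eq_sym ?out_i ?out_j.
  have [b0 cz d0] := th0.
  have := tangent_tetrad_form cone_tau (van _ _ _ _ _ _ _ _ ij kl (out_i _ kij) (out_j _ lij) aE bE cE dE).
  rewrite b0 cz mulr0 mul0r => /(_ erefl).
  rewrite mevalv_tetrad_form b0 cz d0 !mul0r !subr0 addr0 aE// (tauE _ _ _ bE) => /eqP.
  by rewrite mulf_eq0 (negbTE c0) => /eqP.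
have [->//|kl] := eqVneq k l.
(* All four entries of [S0] in this tetrad vanish, so the tetrad is its own lowest form; it is the
   minor of the columns [k] and [l]. *)
have [a aE] := sym_index i k; have [b bE] := sym_index l j.
have [c cE] := sym_index i l; have [d dE] := sym_index k j.
have lj : l != j by rewrite eq_sym out_j.
have kj : k != j by rewrite eq_sym out_j.
have th0 : [/\ vech S0 a 0 = 0, vech S0 b 0 = 0, vech S0 c 0 = 0 & vech S0 d 0 = 0].
  rewrite aE// bE// cE// dE// (sym_entry i k)// (sym_entry i l)//.
  by rewrite !S00// eq_sym out_i.
have := tangent_tetrad cone_tau (van _ _ _ _ _ _ _ _ (out_i _ kij) lj (out_i _ lij) kj aE bE cE dE) th0.
rewrite mevalv_tetrad !(tauE _ _ _ aE, tauE _ _ _ bE, tauE _ _ _ cE, tauE _ _ _ dE).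
by rewrite (sym_entry l j symtau) (sym_entry k j symtau) => /eqP; rewrite subr_eq0 => /eqP.
Qed.

End TangentCone.

(** * Smallest eigenvalues of 2 x 2 Gram matrices and rank-one approximation *)

Section MinEigenvalue.
Context {R : realType}.
Implicit Types p q r a b : R.

(** The smaller root of the characteristic polynomial of the symmetric matrix with diagonal p, r and
    off-diagonal entry q. *)
Definition min_eig2 p q r : R := (p + r - Num.sqrt ((p - r) ^+ 2 + 4 * q ^+ 2)) / 2.

Lemma min_eig2P p q r (l := min_eig2 p q r) :
  [/\ 0 <= p - l, 0 <= r - l & (p - l) * (r - l) = q ^+ 2].
Proof.
pose s := Num.sqrt ((p - r) ^+ 2 + 4 * q ^+ 2).
have q0 : 0 <= 4 * q ^+ 2 by rewrite mulr_ge0// sqr_ge0.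
have s2 : s ^+ 2 = (p - r) ^+ 2 + 4 * q ^+ 2 by rewrite sqr_sqrtr// addr_ge0// sqr_ge0.
have : `|p - r| <= s by rewrite -sqrtr_sqr ler_sqrt ?lerDl// addr_ge0// sqr_ge0.
rewrite ler_norml => /andP[s_r s_l].
have lE : l = (p + r - s) / 2 by [].
split; [lra|lra|].
have -> : (p - l) * (r - l) = (s ^+ 2 - (p - r) ^+ 2) / 4 by rewrite lE; field.
by rewrite s2; field.
Qed.

(** Subtracting the eigenvalue leaves a singular positive semidefinite form; multiplied by its first
    diagonal entry it becomes a square. *)
Lemma min_eig2_le p q r a b : a ^+ 2 + b ^+ 2 = 1 ->
  min_eig2 p q r <= a ^+ 2 * p + 2 * a * b * q + b ^+ 2 * r.
Proof.
move=> ab1; have [] := min_eig2P p q r; set l := min_eig2 p q r => u0 v0 uv.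
rewrite -[l]mul1r -{1}ab1 -subr_ge0.
have -> : a ^+ 2 * p + 2 * a * b * q + b ^+ 2 * r - (a ^+ 2 + b ^+ 2) * l =
  a ^+ 2 * (p - l) + 2 * a * b * q + b ^+ 2 * (r - l) by ring.
have [u0'|un0] := eqVneq (p - l) 0.
  move: uv; rewrite u0' mul0r => /esym/eqP; rewrite sqrf_eq0 => /eqP ->.
  by rewrite !mulr0 !add0r mulr_ge0// sqr_ge0.
have up : 0 < p - l by rewrite lt_neqAle eq_sym un0.
rewrite -(pmulr_rge0 _ up).
have -> : (p - l) * (a ^+ 2 * (p - l) + 2 * a * b * q + b ^+ 2 * (r - l)) =
  (a * (p - l) + b * q) ^+ 2 + b ^+ 2 * ((p - l) * (r - l) - q ^+ 2) by ring.
by rewrite uv subrr mulr0 addr0 sqr_ge0.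
Qed.

Lemma unit_vector2 (x y : R) : exists a b : R, a ^+ 2 + b ^+ 2 = 1 /\ a * x + b * y = 0.
Proof.
pose n2 := x ^+ 2 + y ^+ 2; have n20 : 0 <= n2 by rewrite addr_ge0// sqr_ge0.
have [n0|nn0] := eqVneq n2 0.
  exists 1, 0; split; first by rewrite expr1n expr0n addr0.
  move/eqP: n0; rewrite paddr_eq0 ?sqr_ge0// !sqrf_eq0 => /andP[/eqP -> _].
  by rewrite mulr0 mul0r addr0.
have s2 : Num.sqrt n2 ^+ 2 = n2 by rewrite sqr_sqrtr.
have sn0 : Num.sqrt n2 != 0 by rewrite sqrtr_eq0 -ltNge lt_neqAle eq_sym nn0.
exists (y / Num.sqrt n2), (- x / Num.sqrt n2); split; last by field.
have -> : (y / Num.sqrt n2) ^+ 2 + (- x / Num.sqrt n2) ^+ 2 = n2 / Num.sqrt n2 ^+ 2.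
  by rewrite /n2; field.
by rewrite s2 divff.
Qed.

(** The shifted matrix is singular, so a unit vector orthogonal to its nonzero first row is
    orthogonal to the second row too; if the first row is zero, (1, 0) serves. *)
Lemma min_eig2_vector p q r (l := min_eig2 p q r) :
  exists a b, [/\ a ^+ 2 + b ^+ 2 = 1, a * p + b * q = l * a & a * q + b * r = l * b].
Proof.
have [] := min_eig2P p q r; rewrite -/l => u0 v0 uv.
have [uq0|uqn0] := boolP ((p - l == 0) && (q == 0)).
  move/andP: uq0 => [/eqP pl /eqP ->]; exists 1, 0.
  by split; rewrite ?expr1n ?expr0n ?mulr0 ?mul0r ?addr0//; lra.
have [a [b [ab1 ab0]]] := unit_vector2 (p - l) q.
exists a, b; split => //; first by apply/eqP; rewrite -subr_eq0 -ab0; apply/eqP; ring.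
have [q0|qn0] := eqVneq q 0.
  move: uqn0 ab0 uv; rewrite q0 eqxx andbT mulr0 addr0 expr0n /= => pln0 /eqP.
  rewrite mulf_eq0 (negbTE pln0) orbF => /eqP -> /eqP.
  by rewrite mulf_eq0 (negbTE pln0) /= subr_eq0 => /eqP ->; ring.
apply: (mulfI qn0); apply/eqP; rewrite -subr_eq0.
have -> : q * (a * q + b * r) - q * (l * b) =
  a * (q ^+ 2 - (p - l) * (r - l)) + (r - l) * (a * (p - l) + b * q) by ring.
by rewrite uv ab0 subrr !mulr0 addr0.
Qed.

Lemma inf_eq (E : set R) x : is_minimum E x -> inf E = x.
Proof.
move=> [Ex lbx]; apply/eqP; rewrite eq_le; apply/andP; split.
  by apply: ge_inf => //; exists x.
by apply: lb_le_inf => //; exists x.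
Qed.

Lemma ord2P (k : 'I_2) : k = 0 \/ k = 1.
Proof. by case: k => [[|[|//]] ?]; [left|right]; apply: val_inj. Qed.

Lemma min_eigenvalue2 (G : 'M[R]_2) : G^T = G ->
  min_eigenvalue G = min_eig2 (G 0 0) (G 0 1) (G 1 1).
Proof.
move=> symG; apply: inf_eq.
have G10 : G 1 0 = G 0 1 by rewrite (sym_entry 1 0 symG).
split.
  have [a [b [ab1 e0 e1]]] := min_eig2_vector (G 0 0) (G 0 1) (G 1 1).
  apply/eigenvalueP; exists (\row_k if k == 0 then a else b).
    apply/rowP => k; rewrite !mxE !big_ord_recl big_ord0 !mxE addr0.
    have -> : lift ord0 ord0 = 1 :> 'I_2 by apply: val_inj.
    by have [->|->] := ord2P k; rewrite //= G10.
  apply: contra_eqN ab1 => /eqP/rowP v0.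
  have := v0 0; have := v0 1; rewrite !mxE /= => -> ->.
  by rewrite expr0n addr0 eq_sym oner_eq0.
move=> x /eigenvalueP[v vG v0].
have e0 := congr1 (fun M : 'rV_2 => M 0 0) vG; have e1 := congr1 (fun M : 'rV_2 => M 0 1) vG.
move: e0 e1; rewrite !mxE !big_ord_recl !big_ord0.
have -> : lift ord0 ord0 = 1 :> 'I_2 by apply: val_inj.
rewrite !addr0 G10 => e0 e1; set a := v 0 0 in e0 e1; set b := v 0 1 in e0 e1.
have n0 : 0 < a ^+ 2 + b ^+ 2.
  rewrite lt_neqAle eq_sym addr_ge0 ?sqr_ge0// andbT.
  apply: contra_neq v0 => /eqP; rewrite paddr_eq0 ?sqr_ge0// !sqrf_eq0 => /andP[/eqP a0 /eqP b0].
  by apply/rowP => k; rewrite mxE; have [->|->] := ord2P k.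
pose n := Num.sqrt (a ^+ 2 + b ^+ 2).
have n2 : n ^+ 2 = a ^+ 2 + b ^+ 2 by rewrite sqr_sqrtr// ltW.
have nn0 : n != 0 by rewrite gt_eqF// sqrtr_gt0.
have := @min_eig2_le (G 0 0) (G 0 1) (G 1 1) (a / n) (b / n).
have -> : (a / n) ^+ 2 + (b / n) ^+ 2 = (a ^+ 2 + b ^+ 2) / n ^+ 2 by field.
rewrite n2 divff ?gt_eqF// => /(_ erefl) /le_trans; apply.
have -> : (a / n) ^+ 2 * G 0 0 + 2 * (a / n) * (b / n) * G 0 1 + (b / n) ^+ 2 * G 1 1 =
  (a * (a * G 0 0 + b * G 0 1) + b * (a * G 0 1 + b * G 1 1)) / n ^+ 2 by field.
rewrite e0 e1; have -> : a * (x * a) + b * (x * b) = x * n ^+ 2 by rewrite n2; ring.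
by rewrite mulfK// expf_neq0.
Qed.

Definition rank_le1 n (X : 'M[R]_(2, n)) := forall s t, X 0 s * X 1 t = X 0 t * X 1 s.

Lemma sum_ord2 (F : 'I_2 -> R) : \sum_k F k = F 0 + F 1.
Proof.
rewrite !big_ord_recl big_ord0 addr0; congr (_ + F _).
exact: val_inj.
Qed.

Lemma gram_form n (Y : 'M[R]_(2, n)) a b :
  a ^+ 2 * (Y *m Y^T) 0 0 + 2 * a * b * (Y *m Y^T) 0 1 + b ^+ 2 * (Y *m Y^T) 1 1 =
  \sum_s (a * Y 0 s + b * Y 1 s) ^+ 2.
Proof.
rewrite !mxE !mulr_sumr -!big_split /=; apply: eq_bigr => s _; rewrite !mxE; ring.
Qed.

Lemma gram_sym n (Y : 'M[R]_(2, n)) : (Y *m Y^T)^T = Y *m Y^T.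
Proof. by rewrite trmx_mul trmxK. Qed.

(** A matrix of rank at most one has a unit left null vector (a, b). The distance from [Y] to it is
    at least the norm of (a, b) applied to [Y], which is a Rayleigh quotient of the Gram matrix. *)
Lemma min_eigenvalue_gram_le n (Y X : 'M[R]_(2, n)) : rank_le1 X ->
  min_eigenvalue (Y *m Y^T) <= \sum_s \sum_k (Y k s - X k s) ^+ 2.
Proof.
move=> X1; rewrite min_eigenvalue2 ?gram_sym//.
have [a [b [ab1 abX]]] : exists a b, a ^+ 2 + b ^+ 2 = 1 /\ forall s, a * X 0 s + b * X 1 s = 0.
  have [[t tn0]|all0] := pselect (exists t, (X 0 t != 0) || (X 1 t != 0)).
    have [a [b [ab1 ab0]]] := unit_vector2 (X 0 t) (X 1 t); exists a, b; split => // s.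
    have e0 : X 0 t * (a * X 0 s + b * X 1 s) = X 0 s * (a * X 0 t + b * X 1 t).
      by rewrite !mulrDr ![_ * (b * _)]mulrCA (X1 t s); ring.
    have e1 : X 1 t * (a * X 0 s + b * X 1 s) = X 1 s * (a * X 0 t + b * X 1 t).
      by rewrite !mulrDr ![_ * (a * _)]mulrCA [X 1 t * X 0 s]mulrC (X1 s t); ring.
    move: e0 e1; rewrite ab0 !mulr0 => /eqP + /eqP; rewrite !mulf_eq0.
    by case/orP: tn0 => /negbTE -> /=; [move=> /eqP|move=> _ /eqP].
  exists 1, 0; split=> [|s]; first by rewrite expr1n expr0n addr0.
  suff -> : X 0 s = 0 by rewrite mulr0 mul0r addr0.
  by apply/eqP/contraT => n0; case: all0; exists s; rewrite n0.
apply: le_trans (min_eig2_le _ _ _ ab1) _; rewrite gram_form; apply: ler_sum => s _.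
rewrite sum_ord2.
have -> : a * Y 0 s + b * Y 1 s = a * (Y 0 s - X 0 s) + b * (Y 1 s - X 1 s).
  by have := abX s; lra.
set x := Y 0 s - _; set y := Y 1 s - _.
rewrite -[leRHS]mul1r -ab1 -subr_ge0.
have -> : (a ^+ 2 + b ^+ 2) * (x ^+ 2 + y ^+ 2) - (a * x + b * y) ^+ 2 = (a * y - b * x) ^+ 2 by ring.
exact: sqr_ge0.
Qed.

Lemma min_eigenvalue_gram_attained n (Y : 'M[R]_(2, n)) :
  exists2 X : 'M[R]_(2, n), rank_le1 X &
    min_eigenvalue (Y *m Y^T) = \sum_s \sum_k (Y k s - X k s) ^+ 2.
Proof.
rewrite min_eigenvalue2 ?gram_sym//.
have [a [b [ab1 e0 e1]]] :=
  min_eig2_vector ((Y *m Y^T) 0 0) ((Y *m Y^T) 0 1) ((Y *m Y^T) 1 1).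
(* The columns of [Y] projected onto the line spanned by (b, -a), orthogonal to the eigenvector (a,
   b). *)
exists (\matrix_(k, s) ((if k == 0 then b else - a) * (b * Y 0 s - a * Y 1 s))).
  by move=> s t; rewrite !mxE /=; ring.
set l := min_eig2 _ _ _ in e0 e1 *.
have -> : l = a ^+ 2 * (Y *m Y^T) 0 0 + 2 * a * b * (Y *m Y^T) 0 1 + b ^+ 2 * (Y *m Y^T) 1 1.
  transitivity (a * (l * a) + b * (l * b)); first by rewrite -[LHS]mulr1 -{1}ab1; ring.
  by rewrite -e0 -e1; ring.
rewrite gram_form; apply: eq_bigr => s _; rewrite sum_ord2 !mxE /=.
have -> : Y 0 s - b * (b * Y 0 s - a * Y 1 s) =
    a * (a * Y 0 s + b * Y 1 s) + Y 0 s * (1 - (a ^+ 2 + b ^+ 2)) by ring.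
have -> : Y 1 s - - a * (b * Y 0 s - a * Y 1 s) =
    b * (a * Y 0 s + b * Y 1 s) + Y 1 s * (1 - (a ^+ 2 + b ^+ 2)) by ring.
rewrite ab1 subrr !mulr0 !addr0 !exprMn -mulrDl ab1 mul1r//.
Qed.

End MinEigenvalue.

(** * Whitening by an explicit triangular factor *)

Section Whitening.
Context {R : realType}.

(* For suitable [al] and [e] this is the inverse Cholesky factor of a covariance matrix whose
   only nonzero off-diagonal entry is [(i, j)]. *)
Definition whitener m (i j : 'I_m) (al : 'rV[R]_m) (e : R) : 'M[R]_m :=
  diag_mx al + e *: delta_mx i j.

Lemma whitener_mulE m (i j : 'I_m) al e (M : 'M[R]_m) g h :
  (whitener i j al e *m M) g h = al 0 g * M g h + (g == i)%:R * (e * M j h).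
Proof.
rewrite /whitener mulmxDl mul_diag_mx -scalemxAl !mxE; congr (_ + _).
rewrite (bigD1 j)//= big1 => [|k kj]; first by rewrite mxE eqxx andbT addr0; ring.
by rewrite mxE (negbTE kj) andbF mul0r.
Qed.

Lemma whitener_congrE m (i j : 'I_m) al e (M : 'M[R]_m) g h :
  (whitener i j al e *m M *m (whitener i j al e)^T) g h =
  al 0 g * al 0 h * M g h + (h == i)%:R * (e * al 0 g * M g j)
  + (g == i)%:R * (e * al 0 h * M j h) + (g == i)%:R * (h == i)%:R * (e ^+ 2 * M j j).
Proof.
transitivity ((whitener i j al e *m (whitener i j al e *m M)^T)^T g h).
  by rewrite [in RHS]trmx_mul trmxK.
rewrite mxE whitener_mulE ![(_ *m M)^T _ _]mxE !whitener_mulE; ring.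
Qed.

Lemma whitener_exists m (S0 : 'M[R]_m) (i j : 'I_m) : one_factor S0 -> i != j ->
  (forall k l, k != l -> ~~ [&& k \in [:: i; j] & l \in [:: i; j]] -> S0 k l = 0) ->
  exists (al : 'rV[R]_m) (e : R), [/\ forall g, al 0 g != 0, whitener i j al e \in unitmx &
    S0 = invmx ((whitener i j al e)^T *m whitener i j al e)].
Proof.
move=> one ij off; have symS0 := one_factor_sym one.
have ji : (j == i) = false by rewrite eq_sym (negbTE ij).
have [d [c [d0 SE]]] := one.
have pos g : 0 < S0 g g.
  by rewrite SE !mxE big_ord1 mxE eqxx mulr1n ltr_pwDl// -expr2 sqr_ge0.
(* The Schur complement: the residual variance of coordinate [i] after regression on coordinate
   [j]. *)
pose q := S0 i i - S0 i j ^+ 2 / S0 j j.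
have rn0 : S0 j j != 0 by rewrite gt_eqF.
have qpos : 0 < q.
  rewrite -(pmulr_rgt0 _ (pos j)).
  have -> : S0 j j * q = S0 i i * S0 j j - S0 i j ^+ 2 by rewrite /q; field.
  rewrite SE !mxE !big_ord1 !mxE !eqxx (negbTE ij) !mulr1n mulr0n add0r.
  have -> : (d 0 i + c i 0 * c i 0) * (d 0 j + c j 0 * c j 0) - (c i 0 * c j 0) ^+ 2 =
    d 0 i * d 0 j + d 0 i * c j 0 ^+ 2 + d 0 j * c i 0 ^+ 2 by ring.
  by rewrite ltr_pwDl ?ltr_pwDl ?mulr_gt0// mulr_ge0// ?sqr_ge0// ltW.
pose v g := if g == i then q else S0 g g.
have vpos g : 0 < v g by rewrite /v; case: ifP.
pose al : 'rV[R]_m := \row_g (Num.sqrt (v g))^-1.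
have al2 g : al 0 g ^+ 2 * v g = 1.
  by rewrite mxE exprVn sqr_sqrtr ?mulVf// ?ltW// gt_eqF.
have aln0 g : al 0 g != 0 by rewrite mxE invr_eq0 gt_eqF// sqrtr_gt0.
(* Row [i] of the whitener is the normalized residual of this regression. *)
pose e := - al 0 i * S0 i j / S0 j j.
have white : whitener i j al e *m S0 *m (whitener i j al e)^T = 1%:M.
  have al2i := al2 i; rewrite /v eqxx in al2i.
  apply/matrixP => g h; rewrite whitener_congrE [RHS]mxE.
  wlog: g h / (h == i) ==> (g == i) => [wl|].
    have [/wl //|] := boolP ((h == i) ==> (g == i)).
    rewrite negb_imply => /andP[/eqP hi gi].
    have := wl h g; rewrite hi eqxx implybT => /(_ isT).
    rewrite (eq_sym i g) (negbTE gi) (sym_entry i g symS0) (sym_entry j g symS0) /= => E.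
    by apply: etrans E; ring.
  have [gi|gi] := eqVneq g i; have [hi|hi] := eqVneq h i => // _; rewrite ?gi ?hi ?eqxx.
  - by apply: etrans al2i; rewrite /e /q (sym_entry j i symS0) /=; field.
  - rewrite (eq_sym i h) (negbTE hi) /=; have [->|hj] := eqVneq h j.
      by rewrite /e; field.
    have S0h k : k != h -> S0 k h = 0.
      by move=> kh; rewrite off// !inE (negbTE hi) (negbTE hj) andbF.
    by rewrite !S0h ?(eq_sym _ h)// /=; ring.
  - have [<-|gh] := eqVneq g h.
      by rewrite /= !mul0r !addr0 -(al2 g) /v (negbTE gi) expr2.
    rewrite off//; first by rewrite /= !mul0r mulr0 !addr0.
    rewrite !inE (negbTE gi) (negbTE hi) /=; apply: contra gh => /andP[/eqP -> /eqP ->].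
    exact: eqxx.
have [u1 _] := mulmx1_unit white; have uA : whitener i j al e \in unitmx.
  by move: u1; rewrite unitmx_mul => /andP[].
exists al, e; split => //; apply/esym.
have uAt : (whitener i j al e)^T \in unitmx by rewrite unitmx_tr.
rewrite invmx_mul//.
by rewrite -[S0](mulKmx uA) -[_ *m S0](mulmxK uAt) white mul1mx.
Qed.

(** Entries outside [{i, j}] are rescaled, and in the block a multiple of row [j] is added to row
    [i]; hence the minors change by nonzero factors. *)
Lemma cone_spec_whitener m (i j : 'I_m) (al : 'rV[R]_m) (e : R) (M : 'M[R]_m) :
  i != j -> (forall g, al 0 g != 0) ->
  cone_spec i j (whitener i j al e *m M *m (whitener i j al e)^T) <-> cone_spec i j M.
Proof.
move=> ij aln0; have ji : (j == i) = false by rewrite eq_sym (negbTE ij).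
set N := _ *m M *m _.
have notin k : k \notin [:: i; j] -> (k == i) = false.
  by rewrite !inE negb_or => /andP[/negbTE].
have Nrest k l : k \notin [:: i; j] -> l \notin [:: i; j] -> N k l = al 0 k * al 0 l * M k l.
  by move=> /notin ki /notin li; rewrite whitener_congrE ki li /= !mul0r !addr0.
have Nminor k l : k \notin [:: i; j] -> l \notin [:: i; j] ->
    N i k * N j l - N i l * N j k =
    (al 0 i * al 0 j * al 0 k * al 0 l) * (M i k * M j l - M i l * M j k).
  by move=> /notin ki /notin li; rewrite !whitener_congrE ki li ji eqxx /=; ring.
split=> [[off minor]|[off minor]]; split => k l.
- move=> kl kij lij; have /eqP := off k l kl kij lij; rewrite Nrest//.
  by rewrite !mulf_eq0 !(negbTE (aln0 _)) => /eqP.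
- move=> kij lij; apply/eqP; rewrite -subr_eq0.
  have /eqP := minor k l kij lij; rewrite -subr_eq0 Nminor//.
  by rewrite !mulf_eq0 !(negbTE (aln0 _)).
- by move=> kl kij lij; rewrite Nrest// off// mulr0.
- by move=> kij lij; apply/eqP; rewrite -subr_eq0 Nminor// minor// subrr mulr0.
Qed.

End Whitening.

(** * Enumeration of the coordinates that contribute to the distance *)

Lemma strict_pairs p : exists f : 'I_('C(p, 2)) -> 'I_p * 'I_p,
  [/\ injective f, forall l, ((f l).1 < (f l).2)%N &
      forall s t : 'I_p, (s < t)%N -> exists l, f l = (s, t)].
Proof.
case: p => [|n].
  have -> : 'C(0, 2) = 0%N by [].
  have no (l : 'I_0) : False by case: l.
  by exists (fun l => False_rect _ (no l)); split=> [l|l|l]; case: (no l).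
have binE : 'C(n.+1, 2) = symdim n by rewrite symdimE.
(* Raising the second component by one turns weakly ordered pairs below [n] into strictly ordered
   pairs below [n.+1]. *)
pose f (l : 'I_('C(n.+1, 2))) : 'I_n.+1 * 'I_n.+1 :=
  let a := pair_of (cast_ord binE l) in (widen_ord (leqnSn n) a.1, lift ord0 a.2).
exists f; split=> [k l fkl|l|s t st].
- have e1 : (pair_of (cast_ord binE k)).1 = (pair_of (cast_ord binE l)).1.
    by apply: val_inj; apply: (congr1 (fun p => nat_of_ord p.1) fkl).
  have e2 := lift_inj (congr1 snd fkl).
  apply: (@cast_ord_inj _ _ binE); apply: pair_of_inj.
  by rewrite [LHS]surjective_pairing [RHS]surjective_pairing e1 e2.
- by rewrite /f /= /bump /= add1n ltnS pair_of_le.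
have sn : (s < n)%N by rewrite (leq_trans st) // -ltnS.
have t0 : (0 < t)%N by apply: leq_ltn_trans st.
have tn : (t.-1 < n)%N by rewrite -ltnS prednK.
have [a aE] : exists a, pair_of a = (Ordinal sn, Ordinal tn).
  by apply: pair_of_surj; rewrite /= -ltnS prednK.
exists (cast_ord (esym binE) a); rewrite /f cast_ordKV aE /=.
by congr (_, _); apply: val_inj => //=; rewrite /bump /= add1n prednK.
Qed.

Lemma rest_enum m (i j : 'I_m) : i != j -> exists rest : 'I_(m - 2) -> 'I_m,
  [/\ injective rest, forall s, rest s \notin [:: i; j] &
      forall k, k \notin [:: i; j] -> exists s, rest s = k].
Proof.
move=> ij; pose A := ~: [set i; j].
have inA k : (k \in A) = (k \notin [:: i; j]) by rewrite !inE.
have cA : (m - 2 = #|A|)%N.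
  by rewrite -[in LHS](card_ord m) -(cardsC [set i; j]) cards2 ij addKn.
exists (fun s => enum_val (cast_ord cA s)); split=> [s t /enum_val_inj/cast_ord_inj//|s|k].
  by rewrite -inA enum_valP.
rewrite -inA => kA; exists (cast_ord (esym cA) (enum_rank_in kA k)).
by rewrite cast_ordKV enum_rankK_in.
Qed.

Lemma pair_index m : exists idx : 'I_m -> 'I_m -> 'I_(symdim m), forall g h,
  pair_of (idx g h) = if (g <= h)%N then (g, h) else (h, g).
Proof.
have /choice[idx idxE] : forall p : 'I_m * 'I_m, exists a,
    pair_of a = if (p.1 <= p.2)%N then (p.1, p.2) else (p.2, p.1).
  by move=> [g h] /=; case: (leqP g h) => [gh|/ltnW hg]; apply: pair_of_surj.
by exists (fun g h => idx (g, h)) => g h; apply: idxE.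
Qed.

Lemma sum_disjoint_images (R : realType) (I J K : finType) (phi : J -> I) (psi : K -> I)
    (F : I -> R) : injective phi -> injective psi -> (forall k l, phi k != psi l) ->
  \sum_a F a = \sum_l F (phi l) + \sum_k F (psi k) +
    \sum_(a | (a \notin codom phi) && (a \notin codom psi)) F a.
Proof.
move=> injphi injpsi disj.
have sum_codom (L : finType) (chi : L -> I) (G : I -> R) : injective chi ->
    \sum_(a in codom chi) G a = \sum_l G (chi l).
  move=> injchi; rewrite -big_uniq; last by rewrite map_inj_uniq// enum_uniq.
  by rewrite big_map big_enum.
rewrite (bigID (mem (codom phi))) /= sum_codom// -addrA; congr (_ + _).
rewrite (bigID (mem (codom psi))) /= -(sum_codom _ psi)//; congr (_ + _).
apply: eq_bigl => a; have [/codomP[k ->]|] := boolP (a \in codom psi); rewrite ?andbF// andbT.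
by apply/negP => /codomP[l /eqP]; rewrite eq_sym (negbTE (disj l k)).
Qed.

Lemma sum_mxvec (R : realType) p n (F : 'I_(p * n) -> R) :
  \sum_k F k = \sum_s \sum_r F (mxvec_index r s).
Proof.
rewrite exchange_big pair_big /=; have /= := curry_mxvec_bij p n => bij.
by rewrite (reindex _ bij); apply: eq_bigr => -[].
Qed.

(* [phi] runs through the entries above the diagonal outside the rows and columns [i] and [j],
   [psi] through the 2 x (m - 2) block of the rows [i], [j] and the remaining columns. *)
Definition block_indexing m (i j : 'I_m) (rest : 'I_(m - 2) -> 'I_m)
    (phi : 'I_('C(m - 2, 2)) -> 'I_(symdim m)) (psi : 'I_(2 * (m - 2)) -> 'I_(symdim m)) :=
  [/\ [/\ injective phi, injective psi & forall k l, phi k != psi l],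
    (forall s, rest s \notin [:: i; j]),
    (forall k, k \notin [:: i; j] -> exists s, rest s = k),
    (forall a, (exists l, phi l = a) <-> [/\ (pair_of a).1 != (pair_of a).2,
       (pair_of a).1 \notin [:: i; j] & (pair_of a).2 \notin [:: i; j]]) &
    (forall r s (g := if r == 0 then i else j),
       pair_of (psi (mxvec_index r s)) =
       if (g <= rest s)%N then (g, rest s) else (rest s, g))].

Lemma block_indexing_exists m (i j : 'I_m) : i != j ->
  exists rest phi psi, @block_indexing m i j rest phi psi.
Proof.
move=> ij; have [rest [injr restN restP]] := rest_enum ij.
have [f [injf flt fP]] := strict_pairs (m - 2).
have [idx idxE] := pair_index m.
have idx_inj g h g' h' : idx g h = idx g' h' -> (g, h) = (g', h') \/ (g, h) = (h', g').
  move=> /(congr1 (@pair_of m)); rewrite !idxE.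
  by case: ifP => _; case: ifP => _ [-> ->]; [left|right|right|left].
pose ijr (r : 'I_2) := if r == 0 then i else j.
have ijrN r s : ijr r = rest s -> False.
  by move=> e; have := restN s; rewrite -e /ijr; case: ifP; rewrite !inE eqxx ?orbT.
have ijr_inj : injective ijr.
  move=> r r'; rewrite /ijr; have [->|->] := ord2P r; have [->|->] := ord2P r' => //=.
    by move/eqP; rewrite (negbTE ij).
  by move/esym/eqP; rewrite (negbTE ij).
pose phi l := idx (rest (f l).1) (rest (f l).2).
(* Numbering through [mxvec] matches the reshaping in [wishart_law], so that [row_blocks] recovers
   the block. *)
pose B := \matrix_(r, s) idx (ijr r) (rest s).
pose psi k := mxvec B 0 k.
have psiE r s : psi (mxvec_index r s) = idx (ijr r) (rest s) by rewrite /psi mxvecE mxE.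
have psiP (k : 'I_(2 * (m - 2))) : exists (r : 'I_2) (s : 'I_(m - 2)), k = mxvec_index r s.
  by case/mxvec_indexP: k => r s; exists r, s.
exists rest, phi, psi; split=> //; first split.
- move=> k l /idx_inj[[/injr e1 /injr e2]|[/injr e1 /injr e2]]; apply: injf.
    by rewrite [LHS]surjective_pairing [RHS]surjective_pairing e1 e2.
  by have := flt k; have := flt l; rewrite e1 e2 => /ltn_trans/[apply]; rewrite ltnn.
- move=> k l; have [r [s ->]] := psiP k; have [r' [s' ->]] := psiP l.
  by rewrite !psiE => /idx_inj[[/ijr_inj -> /injr ->]//|[/ijrN]].
- move=> k l; have [r [s ->]] := psiP l; apply/eqP.
  by rewrite psiE => /idx_inj[[/esym/ijrN]|[_ /esym/ijrN]].
- move=> a; split=> [[l <-]|[ne n1 n2]].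
    rewrite idxE; case: ifP => _ /=; split=> //; apply: contraTneq (flt l) => /injr ->; rewrite ltnn//.
  have [s sE] := restP _ n1; have [t tE] := restP _ n2.
  have st : s != t by apply: contraNneq ne => st; rewrite -sE -tE st.
  have pa : ((pair_of a).1 < (pair_of a).2)%N.
    by rewrite ltn_neqAle pair_of_le andbT; apply: contra ne => /eqP/val_inj ->.
  have idxa : idx (pair_of a).1 (pair_of a).2 = a.
    by apply: pair_of_inj; rewrite idxE (ltnW pa) -surjective_pairing.
  have [ts|st'|/val_inj] := ltngtP t s; last by move/eqP; rewrite eq_sym (negbTE st).
    have [l lE] := fP _ _ ts; exists l; rewrite /phi lE /= sE tE.
    apply: pair_of_inj; rewrite idxE; move: pa; rewrite ltnNge => /negbTE ->.
    by rewrite -surjective_pairing.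
  by have [l lE] := fP _ _ st'; exists l; rewrite /phi lE /= sE tE.
- by move=> r s /=; rewrite psiE idxE.
Qed.

(** * The distance to the tangent cone *)

Section ConeMinimum.
Context {R : realType}.

Lemma sorted_pair_entry m (M : 'M[R]_m) (a : 'I_(symdim m)) (g h : 'I_m) : M^T = M ->
  pair_of a = (if (g <= h)%N then (g, h) else (h, g)) ->
  M (pair_of a).1 (pair_of a).2 = M g h.
Proof. by move=> symM ->; case: ifP => _ //; rewrite (sym_entry h g symM). Qed.

Definition row_blocks p n (x : 'cV[R]_(p * n)) : 'M[R]_(p, n) := vec_mx x^T.

Lemma row_blocksE p n (x : 'cV[R]_(p * n)) r s : row_blocks x r s = x (mxvec_index r s) 0.
Proof. by rewrite -[LHS]mxvecE vec_mxK mxE. Qed.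

(* The diagonal entries and the entry [(i, j)] are free in the cone, so that only the
   coordinates indexed by [phi] and [psi] contribute to the distance. *)
Lemma cone_minimum m (S0 : 'M[R]_m) (i j : 'I_m) al e
    rest phi psi (A := whitener i j al e) (z : 'cV[R]_(symdim m)) (xi := fisher_root A *m z)
    (Y := row_blocks (\col_k xi (psi k) 0)) :
  block_indexing i j rest phi psi ->
  i != j -> S0^T = S0 -> S0 i j != 0 ->
  (forall k l, k != l -> ~~ [&& k \in [:: i; j] & l \in [:: i; j]] -> S0 k l = 0) ->
  (forall g, al 0 g != 0) -> A \in unitmx -> S0 = invmx (A^T *m A) ->
  is_minimum
    (sq_mahalanobis (normal_fisher S0) z @`
       algebraic_tangent_cone (@vech R m @` @one_factor R m) (vech S0))
    (\sum_l xi (phi l) 0 ^+ 2 + min_eigenvalue (Y *m Y^T)).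
Proof.
move=> [[injphi injpsi disj] restN restP phiP psiP] ij symS0 c0 off aln0 uA S0E.
have disjN k : psi k \notin codom phi.
  by apply/negP => /codomP[l /eqP]; rewrite eq_sym (negbTE (disj _ _)).
have offdiagE (s : 'cV[R]_(symdim m)) a : (pair_of a).1 != (pair_of a).2 ->
    (fisher_root A *m s) a 0 = (A *m unvech s *m A^T) (pair_of a).1 (pair_of a).2.
  by move=> /negbTE ne; rewrite fisher_rootE /fisher_scale ne mul1r.
have symN s : (A *m unvech s *m A^T)^T = A *m unvech s *m A^T by rewrite congr_sym// unvech_sym.
have ijN r s : (if r == 0 then i else j) != rest s :> 'I_m.
  have := restN s; rewrite !inE negb_or eq_sym [rest s == j]eq_sym => /andP[? ?]; by case: ifP.
have psiE s r t : (fisher_root A *m s) (psi (mxvec_index r t)) 0 =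
    (A *m unvech s *m A^T) (if r == 0 then i else j) (rest t).
  rewrite offdiagE.
    by rewrite (sorted_pair_entry _ (psiP r t)).
  by rewrite psiP; case: ifP => _ //=; rewrite // eq_sym.
have phiE s k l : k != l -> k \notin [:: i; j] -> l \notin [:: i; j] ->
    exists b, (fisher_root A *m s) (phi b) 0 = (A *m unvech s *m A^T) k l.
  move=> kl kij lij; have [a aE] : exists a : 'I_(symdim m),
      pair_of a = (if (k <= l)%N then (k, l) else (l, k)).
    by case: leqP => [kl'|/ltnW lk']; apply: pair_of_surj.
  have lk : l != k by rewrite eq_sym.
  have [b bE] : exists b, phi b = a by apply/phiP; rewrite aE; case: ifP.
  exists b; rewrite bE offdiagE; first by rewrite (sorted_pair_entry _ aE).
  by rewrite aE; case: ifP.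
have coneE s : cone_spec i j (unvech s) <->
    (forall l, (fisher_root A *m s) (phi l) 0 = 0) /\
    rank_le1 (row_blocks (\col_k (fisher_root A *m s) (psi k) 0)).
  split=> [/(cone_spec_whitener e (unvech s) ij aln0)[out minor]|[out minor]].
    split=> [l|t u].
      have [ne n1 n2] : [/\ (pair_of (phi l)).1 != (pair_of (phi l)).2,
          (pair_of (phi l)).1 \notin [:: i; j] & (pair_of (phi l)).2 \notin [:: i; j]].
        by apply/phiP; exists l.
      by rewrite offdiagE// out.
    by rewrite !row_blocksE ![fun_of_matrix (\col_k _) _ _]mxE !psiE /= minor.
  apply/(cone_spec_whitener e (unvech s) ij aln0); split=> [k l kl kij lij|k l kij lij].
    by have [b <-] := phiE s _ _ kl kij lij.
  have [t <-] := restP _ kij; have [u <-] := restP _ lij.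
  have := minor t u; rewrite !row_blocksE ![fun_of_matrix (\col_k _) _ _]mxE.
  by rewrite !psiE.
rewrite S0E in symS0 c0 off *.
split; last first.
  move=> _ [s cone_s <-]; have /coneE[s_phi s_psi] := cone_spec_of_tangent ij symS0 c0 off cone_s.
  rewrite sq_mahalanobisE// (sum_disjoint_images _ injphi injpsi disj) -[leLHS]addr0.
  apply: lerD; last by apply: sumr_ge0 => a _; apply: sqr_ge0.
  apply: lerD; first by apply: ler_sum => l _; rewrite s_phi subr0.
  apply: le_trans (min_eigenvalue_gram_le Y s_psi) _.
  rewrite sum_mxvec; apply: ler_sum => t _; apply: ler_sum => r _.
  by rewrite /Y !row_blocksE ![fun_of_matrix (\col_k _) _ _]mxE.
have [X X1 XE] := min_eigenvalue_gram_attained Y.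
(* The nearest point in whitened coordinates: the best approximation [X] in the block, 0 on the
   constrained entries, and [xi] itself on the free ones. *)
pose eta : 'cV[R]_(symdim m) := \col_a
  if [pick k | psi k == a] is Some k then mxvec X 0 k
  else if a \in codom phi then 0 else xi a 0.
have eta_psi k : eta (psi k) 0 = mxvec X 0 k.
  rewrite mxE; case: pickP => [k' /eqP/injpsi -> //|/(_ k)]; by rewrite eqxx.
have eta_phi l : eta (phi l) 0 = 0.
  rewrite mxE codom_f; case: pickP => // k /eqP e'.
  by have := disj l k; rewrite e' eqxx.
have eta_other a : a \notin codom phi -> a \notin codom psi -> eta a 0 = xi a 0.
  move=> aphi apsi; rewrite mxE (negbTE aphi); case: pickP => // k /eqP e'.
  by move: apsi; rewrite -e' codom_f.
have uK : fisher_root A \in unitmx by exact: fisher_root_unit.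
pose s := invmx (fisher_root A) *m eta.
have Ks : fisher_root A *m s = eta by rewrite /s mulKVmx.
exists s.
  rewrite -(unvechK s); apply: (cone_spec_sub ij symS0 c0 off (unvech_sym s)).
  apply/coneE; rewrite Ks (_ : row_blocks _ = X)//.
  by apply/matrixP => r t; rewrite row_blocksE mxE eta_psi mxvecE.
rewrite sq_mahalanobisE// Ks (sum_disjoint_images _ injphi injpsi disj).
rewrite [X in _ + X]big1 ?addr0 => [|a /andP[aphi apsi]]; last first.
  by rewrite eta_other// subrr expr0n.
congr (_ + _); first by apply: eq_bigr => l _; rewrite eta_phi subr0.
rewrite XE sum_mxvec; apply: eq_bigr => t _; apply: eq_bigr => r _.
by rewrite eta_psi mxvecE /Y row_blocksE [fun_of_matrix (\col_k _) _ _]mxE.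
Qed.

End ConeMinimum.

(** * The law of a sum of independent variables *)

Section SumLaw.
Context {R : realType}.

(** The joint law is the product measure by uniqueness. The right-hand side mentions only the two
    marginals, so sums on different probability spaces can be compared. *)
Lemma law_of_sum d (T : measurableType d) (P : probability T R)
    (m1 m2 : probability R R) (V W : T -> R) :
  measurable_fun setT V -> measurable_fun setT W ->
  (forall A B : set R, measurable A -> measurable B ->
     P (V @^-1` A `&` W @^-1` B) = (m1 A * m2 B)%E) ->
  forall B : set R, measurable B ->
    P ((fun t => V t + W t) @^-1` B) = (m1 \x m2)%E [set x | B (x.1 + x.2)].
Proof.
move=> mV mW PVW B mB.
have mVW : measurable_fun setT (fun t => (V t, W t)) by apply: measurable_fun_pair.
have msum : measurable_fun setT (fun x : R * R => x.1 + x.2).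
  by apply: measurable_funD; [exact: measurable_fst|exact: measurable_snd].
have mC : measurable [set x : R * R | B (x.1 + x.2)].
  by rewrite -[X in measurable X]setTI; exact: msum.
have E := @product_measure_unique _ _ _ _ R m1 m2 (pushforward_measure P mVW) PVW _ mC.
exact: esym E.
Qed.

Lemma measurable_sum_sqr n : measurable_fun setT (fun x : mvec R n => \sum_k x k 0 ^+ 2).
Proof.
apply: measurable_sum => k; apply: measurable_funX; exact: measurable_coord.
Qed.

(** Measurability is clear from the closed formula for the smaller eigenvalue, not from its
    definition as an infimum. *)
Lemma measurable_min_eigenvalue_gram n :
  measurable_fun setT (fun x : mvec R (2 * n) =>
    min_eigenvalue (row_blocks x *m (row_blocks x)^T)).
Proof.
have mG k l : measurable_fun setT (fun x : mvec R (2 * n) => (row_blocks x *m (row_blocks x)^T) k l).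
  rewrite (_ : (fun _ => _) = fun x : mvec R (2 * n) =>
      \sum_s x (mxvec_index k s) 0 * x (mxvec_index l s) 0).
    by apply: measurable_sum => s; apply: measurable_funM; exact: measurable_coord.
  by apply: funext => x; rewrite mxE; apply: eq_bigr => s _;
    rewrite [(row_blocks x)^T _ _]mxE !row_blocksE.
rewrite (_ : (fun _ => _) = fun x : mvec R (2 * n) =>
  min_eig2 ((row_blocks x *m (row_blocks x)^T) 0 0) ((row_blocks x *m (row_blocks x)^T) 0 1)
    ((row_blocks x *m (row_blocks x)^T) 1 1)).
  rewrite /min_eig2; apply: measurable_funM; last exact: measurable_cst.
  apply: measurable_funB; first exact: measurable_funD.
  apply: (measurableT_comp (f := fun y : R => Num.sqrt y)).
    exact: continuous_measurable_fun (@sqrt_continuous R).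
  apply: measurable_funD; first by apply: measurable_funX; exact: measurable_funB.
  by apply: measurable_funM; [exact: measurable_cst|exact: measurable_funX].
by apply: funext => x; rewrite min_eigenvalue2// gram_sym.
Qed.

End SumLaw.

Theorem theorem6p3 (R : realType) (m : nat) (hm : (4 <= m)%N)
    (S0 : 'M[R]_m) (i j : 'I_m)
    (hS0 : one_factor S0)
    (hij : (i < j)%N)
    (hne : S0 i j != 0)
    (hoff : forall g h : 'I_m, (g < h)%N -> (g, h) <> (i, j) -> S0 g h = 0)
    (d : measure_display) (T : measurableType d) (P : probability T R)
    (Z : T -> 'cV[R]_(symdim m))
    (hZ : is_normal_vector P Z (invmx (normal_fisher S0)))
    (d' : measure_display) (T' : measurableType d') (Q : probability T' R)
    (V W : {RV Q >-> R})
    (hV : has_chi_square_law 'C(m - 2, 2) V)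
    (hW : has_min_wishart_law 2 (m - 2) W)
    (hVW : independent_RV V W) :
  exists D : {RV P >-> R},
    (forall w : T,
       is_minimum
         (sq_mahalanobis (normal_fisher S0) (Z w) @`
            algebraic_tangent_cone (@vech R m @` @one_factor R m) (vech S0))
         (D w)) /\
    (forall B : set R, measurable B ->
       P (D @^-1` B) = Q ((fun w => V w + W w) @^-1` B)).
Proof.
have ij : i != j by apply: contraTneq hij => ->; rewrite ltnn.
have symS0 := one_factor_sym hS0.
have off k l : k != l -> ~~ [&& k \in [:: i; j] & l \in [:: i; j]] -> S0 k l = 0.
  move=> kl nkl; have [lk|kl'|/val_inj e] := ltngtP l k; last by rewrite e eqxx in kl.
    rewrite sym_entry//; apply: hoff => // -[li kj].
    by move: nkl; rewrite li kj !inE !eqxx orbT.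
  by apply: hoff => // -[ki lj]; move: nkl; rewrite ki lj !inE !eqxx orbT.
have [al [e [aln0 uA S0E]]] := whitener_exists hS0 ij off.
set A := whitener i j al e in uA S0E.
have [rest [phi [psi idx]]] := block_indexing_exists ij.
have [[injphi injpsi disj] _ _ _ _] := idx.
pose X t : mvec R (symdim m) := fisher_root A *m Z t.
have fisherE : normal_fisher S0 = (fisher_root A)^T *m fisher_root A.
  by rewrite S0E normal_fisher_root.
have nX : std_normal P X.
  apply: std_normal_mulmx; first exact: fisher_root_unit.
  by move: hZ; rewrite fisherE.
pose X1 t : mvec R 'C(m - 2, 2) := \col_l X t (phi l) 0.
pose X2 t : mvec R (2 * (m - 2)) := \col_k X t (psi k) 0.
have mX1 : measurable_fun setT X1 by apply: measurable_subvector; case: nX.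
have mX2 : measurable_fun setT X2 by apply: measurable_subvector; case: nX.
pose chi (x : mvec R 'C(m - 2, 2)) : R := \sum_l x l 0 ^+ 2.
pose lam (x : mvec R (2 * (m - 2))) : R := min_eigenvalue (row_blocks x *m (row_blocks x)^T).
have mchi : measurable_fun setT chi := @measurable_sum_sqr R _.
have mlam : measurable_fun setT lam := @measurable_min_eigenvalue_gram R _.
have mV : measurable_fun setT (chi \o X1) := measurableT_comp mchi mX1.
have mW : measurable_fun setT (lam \o X2) := measurableT_comp mlam mX2.
(* The two terms of the distance are independent under [P] with the marginals of [V] and [W] under
   [Q]. *)
have PVW (B C : set R) : measurable B -> measurable C ->
    P ((chi \o X1) @^-1` B `&` (lam \o X2) @^-1` C) = (distribution Q V B * distribution Q W C)%E.
  move=> mB mC; rewrite hV// hW//.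
  have mB' : measurable (chi @^-1` B) by rewrite -[X in measurable X]setTI; exact: mchi.
  have mC' : measurable (lam @^-1` C) by rewrite -[X in measurable X]setTI; exact: mlam.
  exact: std_normal_subvectors nX injphi injpsi disj mB' mC'.
have mD : measurable_fun setT (fun t => chi (X1 t) + lam (X2 t)) by exact: measurable_funD.
pose D0 t := chi (X1 t) + lam (X2 t).
pose D : {RV P >-> R} := HB.pack D0 (isMeasurableFun.Build _ _ _ _ D0 mD).
exists D; split=> [w|B mB].
  rewrite /= /D0 /chi (eq_bigr (fun l => X w (phi l) 0 ^+ 2)); last by move=> l _; rewrite mxE.
  exact: (cone_minimum (Z w) idx ij symS0 hne off aln0 uA S0E).
have QVW (C E : set R) : measurable C -> measurable E ->
    Q (V @^-1` C `&` W @^-1` E) = (distribution Q V C * distribution Q W E)%E by exact: hVW.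
rewrite (@law_of_sum _ _ _ Q (distribution Q V) (distribution Q W) V W _ _ QVW _ mB)//.
exact: (@law_of_sum _ _ _ P (distribution Q V) (distribution Q W) _ _ mV mW PVW _ mB).
Qed.
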